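(* The hyperspace $\mathrm{mpcc}(\mathbb R^{\omega_1})$ of nonempty compact max-plus convex subsets of $\mathbb R^{\omega_1}$ is homeomorphic to $\mathbb R^{\omega_1}$.
   Context: For a cardinal $\tau$, $x,y\in\mathbb R^\tau$ and $\lambda\in\mathbb R_{\max}=\mathbb R\cup\{-\infty\}$, $x\oplus y$ denotes the coordinatewise maximum and $\lambda\odot x$ the vector obtained by adding $\lambda$ to every coordinate. A subset $A\subset\mathbb R^\tau$ is max-plus convex if $\alpha\odot a\oplus\beta\odot b\in A$ for all $a,b\in A$ and $\alpha,\beta\in\mathbb R_{\max}$ with $\max(\alpha,\beta)=0$. $\mathrm{mpcc}(\mathbb R^\tau)$ is the set of all nonempty compact max-plus convex subsets of $\mathbb R^\tau$, where $\mathbb R^\tau$ has the Tychonov product topology, endowed with the Vietoris topology (basic open sets $\{A: A\subset\bigcup_{i=1}^nU_i,\ A\cap U_i\ne\emptyset\ \forall i\}$ for open $U_1,\dots,U_n$). *)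

(* Defs.v *)
From Stdlib Require Import Reals List.
Open Scope R_scope.

Definition countable_set {T : Type} (P : T -> Prop) : Prop :=
  exists f : T -> nat, forall x y, P x -> P y -> f x = f y -> x = y.

(* T carries a well-order of type omega_1: a strict total well-order
   whose proper initial segments are all countable, while T itself is
   uncountable.  Such a T is order-isomorphic to omega_1, hence has
   cardinality aleph_1. *)
Definition omega1_type (T : Type) : Prop :=
  exists lt : T -> T -> Prop,
    (forall x, ~ lt x x) /\
    (forall x y z, lt x y -> lt y z -> lt x z) /\
    (forall x y, lt x y \/ x = y \/ lt y x) /\
    well_founded lt /\
    (forall x, countable_set (fun y => lt y x)) /\
    ~ countable_set (fun _ : T => True).

(* R_max = R ∪ {-oo}, with None standing for -oo. *)
Definition Rmaxplus := option R.

Definition rmp_max (a b : Rmaxplus) : Rmaxplus :=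
  match a, b with
  | None, _ => b
  | _, None => a
  | Some x, Some y => Some (Rmax x y)
  end.

(* (alpha ⊙ a) ⊕ (beta ⊙ b), coordinatewise; when alpha = -oo the term
   alpha ⊙ a is the constant -oo vector, which is neutral for ⊕.
   The case alpha = beta = -oo never occurs under max(alpha,beta)=0. *)
Definition mp_comb {I : Type} (alpha : Rmaxplus) (a : I -> R)
  (beta : Rmaxplus) (b : I -> R) : I -> R :=
  fun i =>
    match alpha, beta with
    | Some al, Some be => Rmax (al + a i) (be + b i)
    | Some al, None => al + a i
    | None, Some be => be + b i
    | None, None => 0
    end.

Definition mp_convex {I : Type} (A : (I -> R) -> Prop) : Prop :=
  forall a b alpha beta, A a -> A b ->
    rmp_max alpha beta = Some 0 -> A (mp_comb alpha a beta b).

Definition prod_open (I : Type) (U : (I -> R) -> Prop) : Prop :=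
  forall x, U x -> exists (F : list I) (eps : R), 0 < eps /\
    forall y, (forall i, In i F -> Rabs (y i - x i) < eps) -> U y.

Definition compact_in {X : Type} (open : (X -> Prop) -> Prop)
  (A : X -> Prop) : Prop :=
  forall (J : Type) (U : J -> X -> Prop),
    (forall j, open (U j)) ->
    (forall x, A x -> exists j, U j x) ->
    exists F : list J, forall x, A x -> exists j, In j F /\ U j x.

Definition mpcc (I : Type) : Type :=
  { A : (I -> R) -> Prop |
    (exists x, A x) /\ compact_in (prod_open I) A /\ mp_convex A }.

Definition in_vietoris_basic {X : Type} (Us : list (X -> Prop))
  (A : X -> Prop) : Prop :=
  (forall x, A x -> exists U, In U Us /\ U x) /\
  (forall U, In U Us -> exists x, A x /\ U x).

Definition vietoris_open (I : Type) (W : mpcc I -> Prop) : Prop :=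
  forall A, W A -> exists Us : list ((I -> R) -> Prop),
    (forall U, In U Us -> prod_open I U) /\
    in_vietoris_basic Us (proj1_sig A) /\
    (forall B, in_vietoris_basic Us (proj1_sig B) -> W B).

Definition continuous_map {X Y : Type} (openX : (X -> Prop) -> Prop)
  (openY : (Y -> Prop) -> Prop) (f : X -> Y) : Prop :=
  forall V, openY V -> openX (fun x => V (f x)).

Definition homeomorphic {X Y : Type} (openX : (X -> Prop) -> Prop)
  (openY : (Y -> Prop) -> Prop) : Prop :=
  exists (f : X -> Y) (g : Y -> X),
    (forall x, g (f x) = x) /\ (forall y, f (g y) = y) /\
    continuous_map openX openY f /\ continuous_map openY openX g.

(* Main.v *)
Require Import Defs.
From Stdlib Require Import Reals List.
From Stdlib Require Import Ranalysis5 Lra Lia Arith ZArith Cantor Classical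
  ClassicalEpsilon FunctionalExtensionality PropExtensionality.
From mathcomp Require filter choice.
Open Scope R_scope.

(** Write X for mpcc(R^I), X_P for the sets whose points vanish off P, and
    restriction for the coordinate projection X_Q -> X_P when P is contained
    in Q.  A set A in X is determined by the values phi_w(A) = max_A w, where
    w(a) = min_l (a_k - a_jl + q_l) and one extra coordinate is constantly 0.
    These w satisfy w(al.a (+) be.b) <= max(w a, w b).

    Let P = {j < i} and Q = {j <= i}; countably many phi_k suffice on X_Q.
    We show X_Q x R^N ~ X_P x R^N over X_P.  Consider pairs (A, x) in which
    x_0, x_1, ... are successive approximations of the numbers phi_k(A), each
    confined to an open interval depending on A and the earlier guesses, and
    determining every phi_k(A) in the limit.  Given A, each guess ranges over
    an open interval with continuous endpoints, so the pairs form X_Q x R^N.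
    Given instead B in X_P, the sets A over B compatible with finitely many
    guesses can be joined through a level set of w in the convex hull of a
    union, so again each guess ranges over an open interval; since restriction
    is open, these intervals form an open set, which is a trivial line bundle
    because X_P is metrizable.  The pairs thus also form X_P x R^N.

    Well-founded recursion along I assembles these homeomorphisms into
    X x R^(I x N) ~ R^(I x N).  Finally X ~ X x R^(I x N), because X is
    R^I (the maximum of A) times the sets with maximum 0, and I ~ I x N. *)

(** * Continuity with respect to a family of coordinate functions *)

(** Restriction X_Q -> X_P is not a bundle: over a one-point set the fibre is the closed half-plane
    of intervals [lo, hi], while over a nondegenerate interval it is infinite-dimensional. The
    factor R^N absorbs this: it turns every guess into a free choice in an open interval, so
    boundary points of the fibres do no harm. Of the fibres only two properties are used, an
    intermediate value property for each functional and completeness under convergence of all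
    functionals. The line bundles are trivialized by a formula: height, plus the reciprocal of the
    distance to the upper boundary, minus the reciprocal of the distance to the lower one. Distances
    require a metrizable base. This is why coordinates are added one at a time over countable
    initial segments; a limit stage costs nothing, being the inverse limit of the earlier ones. *)

Definition close {T K : Type} (c : K -> T -> R) (F : list K) (d : R) (x y : T) :=
  forall k, In k F -> Rabs (c k y - c k x) < d.

(** A space is a type with a family [c] of real functions generating its topology, and a subspace is
    a predicate [D]. [ev] means: for all points of [D] close enough to [x]. *)
Definition ev {T K : Type} (c : K -> T -> R) (D : T -> Prop) (x : T)
  (P : T -> Prop) :=
  exists F d, 0 < d /\ forall y, D y -> close c F d x y -> P y.

Definition cts {T K : Type} (c : K -> T -> R) (D : T -> Prop) (g : T -> R) :=
  forall x, D x -> forall e, 0 < e -> ev c D x (fun y => Rabs (g y - g x) < e).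

Section Cts.
Variables (T K : Type) (c : K -> T -> R) (D : T -> Prop).

Lemma ev_mono x (P Q : T -> Prop) :
  ev c D x P -> (forall y, D y -> P y -> Q y) -> ev c D x Q.
Proof. intros (F & d & Hd & H) HPQ. exists F, d. split; auto. Qed.

Lemma ev_all x (P : T -> Prop) : (forall y, D y -> P y) -> ev c D x P.
Proof. intros H. exists nil, 1. split; [lra|auto]. Qed.

Lemma close_weaken F G d d' x y :
  incl F G -> d <= d' -> close c G d x y -> close c F d' x y.
Proof.
  intros HF Hd H k Hk. specialize (H k (HF k Hk)). lra.
Qed.

Lemma ev_and x (P Q : T -> Prop) :
  ev c D x P -> ev c D x Q -> ev c D x (fun y => P y /\ Q y).
Proof.
  intros (F & d & Hd & H) (F' & d' & Hd' & H').
  exists (F ++ F'), (Rmin d d'). split; [apply Rmin_glb_lt; auto|].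
  intros y Dy Hy. split.
  - apply H; auto. eapply close_weaken; [| |exact Hy]; [apply incl_appl, incl_refl|apply Rmin_l].
  - apply H'; auto. eapply close_weaken; [| |exact Hy]; [apply incl_appr, incl_refl|apply Rmin_r].
Qed.

Lemma ev_list {A : Type} x (P : A -> T -> Prop) (l : list A) :
  (forall a, In a l -> ev c D x (P a)) ->
  ev c D x (fun y => forall a, In a l -> P a y).
Proof.
  induction l as [|a l IH]; intros H.
  - apply ev_all. intros y _ a [].
  - eapply ev_mono.
    + apply ev_and; [apply (H a); left; reflexivity|apply IH; intros; apply H; right; auto].
    + intros y _ [H1 H2] b [<-|Hb]; auto.
Qed.

Lemma cts_coord k : cts c D (c k).
Proof.
  intros x Dx e He. exists (k :: nil), e. split; auto.
  intros y Dy H. apply H. left; reflexivity.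
Qed.

Lemma cts_const r : cts c D (fun _ => r).
Proof.
  intros x Dx e He. apply ev_all. intros. rewrite Rminus_diag, Rabs_R0. exact He.
Qed.

Lemma cts_ext f g : (forall x, D x -> f x = g x) -> cts c D f -> cts c D g.
Proof.
  intros H Hf x Dx e He. eapply ev_mono; [apply (Hf x Dx e He)|].
  intros y Dy Hy. rewrite <- (H x Dx), <- (H y Dy). exact Hy.
Qed.

Lemma cts_plus f g : cts c D f -> cts c D g -> cts c D (fun x => f x + g x).
Proof.
  intros Hf Hg x Dx e He.
  eapply ev_mono; [apply ev_and; [apply (Hf x Dx (e/2))|apply (Hg x Dx (e/2))]; lra|].
  intros y Dy [H1 H2]. apply Rabs_def2 in H1. apply Rabs_def2 in H2.
  apply Rabs_def1; lra.
Qed.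

Lemma cts_comp1 (u : R -> R) f :
  (forall x, D x -> continuity_pt u (f x)) -> cts c D f -> cts c D (fun x => u (f x)).
Proof.
  intros Hu Hf x Dx e He. destruct (Hu x Dx e He) as (d & Hd & H).
  eapply ev_mono; [apply (Hf x Dx d Hd)|]. intros y Dy Hy.
  destruct (Req_dec (f x) (f y)) as [E|E].
  - rewrite E, Rminus_diag, Rabs_R0. exact He.
  - apply (H (f y)). split; [split; [exact I|exact E]|exact Hy].
Qed.

Lemma cts_opp f : cts c D f -> cts c D (fun x => - f x).
Proof.
  intros Hf x Dx e He. eapply ev_mono; [apply (Hf x Dx e He)|].
  intros y _ H. apply Rabs_def2 in H. apply Rabs_def1; lra.
Qed.

Lemma cts_minus f g : cts c D f -> cts c D g -> cts c D (fun x => f x - g x).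
Proof. intros. apply cts_plus; auto. apply cts_opp; auto. Qed.

Lemma cts_sqr f : cts c D f -> cts c D (fun x => f x * f x).
Proof.
  intros Hf. apply (cts_comp1 (fun r => r * r)); auto.
  intros x _. apply (continuity_pt_mult id id); apply derivable_continuous_pt, derivable_pt_id.
Qed.

Lemma cts_scal r f : cts c D f -> cts c D (fun x => r * f x).
Proof.
  intros Hf. apply (cts_comp1 (fun s => r * s)); auto.
  intros x _. apply (continuity_pt_scal id); apply derivable_continuous_pt, derivable_pt_id.
Qed.

Lemma cts_mult f g : cts c D f -> cts c D g -> cts c D (fun x => f x * g x).
Proof.
  intros Hf Hg.
  (* Polarisation reduces products to squares, hence to maps of one real variable. *)
  apply cts_ext with (fun x => / 4 * ((f x + g x) * (f x + g x) - (f x - g x) * (f x - g x))).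
  { intros. field. }
  apply cts_scal, cts_minus; apply cts_sqr; [apply cts_plus|apply cts_minus]; auto.
Qed.

Lemma cts_inv f : cts c D f -> (forall x, D x -> f x <> 0) -> cts c D (fun x => / f x).
Proof.
  intros Hf H. apply cts_comp1; auto. intros x Dx.
  apply (continuity_pt_inv id); [apply derivable_continuous_pt, derivable_pt_id|apply (H x Dx)].
Qed.

Lemma cts_div f g : cts c D f -> cts c D g -> (forall x, D x -> g x <> 0) ->
  cts c D (fun x => f x / g x).
Proof. intros. apply cts_mult; auto. apply cts_inv; auto. Qed.

Lemma cts_abs f : cts c D f -> cts c D (fun x => Rabs (f x)).
Proof. intros Hf. apply cts_comp1; auto. intros. apply Rcontinuity_abs. Qed.

Lemma cts_max f g : cts c D f -> cts c D g -> cts c D (fun x => Rmax (f x) (g x)).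
Proof.
  intros Hf Hg. apply cts_ext with (fun x => / 2 * (f x + g x + Rabs (f x - g x))).
  { intros. unfold Rmax, Rabs. destruct Rle_dec, Rcase_abs; lra. }
  apply cts_scal, cts_plus; [apply cts_plus; auto|apply cts_abs, cts_minus; auto].
Qed.

Lemma cts_min f g : cts c D f -> cts c D g -> cts c D (fun x => Rmin (f x) (g x)).
Proof.
  intros Hf Hg. apply cts_ext with (fun x => - Rmax (- f x) (- g x)).
  { intros. unfold Rmax, Rmin. repeat destruct Rle_dec; lra. }
  apply cts_opp, cts_max; apply cts_opp; auto.
Qed.

Lemma cts_unif g : (forall e, 0 < e -> exists f, cts c D f /\
  forall x, D x -> Rabs (g x - f x) <= e) -> cts c D g.
Proof.
  intros H x Dx e He. destruct (H (e/4)) as (f & Hf & Hfg); [lra|].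
  eapply ev_mono; [apply (Hf x Dx (e/4)); lra|]. intros y Dy Hy.
  pose proof (Hfg x Dx) as H1. pose proof (Hfg y Dy) as H2.
  revert Hy H1 H2. unfold Rabs. repeat destruct Rcase_abs; lra.
Qed.

End Cts.

Lemma ev_comp {T K T' K' : Type} (c : K -> T -> R) D (c' : K' -> T' -> R)
  (D' : T' -> Prop) (m : T -> T') x (P : T' -> Prop) :
  (forall y, D y -> D' (m y)) -> (forall k, cts c D (fun y => c' k (m y))) ->
  D x -> ev c' D' (m x) P -> ev c D x (fun y => P (m y)).
Proof.
  intros Hm Hk Dx (F & d & Hd & H).
  eapply ev_mono.
  - apply (ev_list T K c D x (fun k y => Rabs (c' k (m y) - c' k (m x)) < d) F).
    intros k _. apply (Hk k x Dx d Hd).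
  - intros y Dy Hy. apply H; auto.
Qed.

Lemma cts_comp {T K T' K' : Type} (c : K -> T -> R) D (c' : K' -> T' -> R)
  (D' : T' -> Prop) (m : T -> T') (h : T' -> R) :
  cts c' D' h -> (forall y, D y -> D' (m y)) ->
  (forall k, cts c D (fun y => c' k (m y))) -> cts c D (fun y => h (m y)).
Proof.
  intros Hh Hm Hk x Dx e He.
  apply (ev_comp c D c' D' m x (fun z => Rabs (h z - h (m x)) < e)); auto.
Qed.

(** * Open sets with interval fibres *)

Definition addc {Z K : Type} (c : K -> Z -> R) (k : option K) (z : Z * R) : R :=
  match k with Some k => c k (fst z) | None => snd z end.

Section Fibre.
Variables (Z K : Type) (c : K -> Z -> R) (E : R -> Z -> Z -> Prop)
  (D : Z -> Prop) (O : Z -> R -> Prop).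
Hypothesis E_refl : forall s p, 0 <= s -> E s p p.
Hypothesis E_sym : forall s p q, E s p q -> E s q p.
Hypothesis E_tri : forall r s p q z, 0 <= r -> 0 <= s ->
  E r p q -> E s q z -> E (r + s) p z.
Hypothesis EC : forall p s, 0 < s ->
  exists F d, 0 < d /\ forall q, close c F d p q -> E s p q.
Hypothesis CE : forall F p d, 0 < d ->
  exists s, 0 < s /\ forall q, E s p q -> close c F d p q.
Hypothesis O_open : forall p t, D p -> O p t -> exists F d, 0 < d /\
  forall q t', D q -> close c F d p q -> Rabs (t' - t) < d -> O q t'.
Hypothesis O_conv : forall p t1 t2 t, D p -> O p t1 -> O p t2 ->
  t1 <= t <= t2 -> O p t.
Hypothesis O_ne : forall p, D p -> exists t, O p t.

Definition slackset (sg : R) (p : Z) (t s : R) : Prop :=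
  0 <= s <= 1 /\ (s = 0 \/ exists d, s <= sg * (d - t) /\
    forall q, D q -> E s p q -> O q d).

Lemma slackset_bound sg p t : bound (slackset sg p t).
Proof. exists 1. intros s [H _]. lra. Qed.

Lemma slackset_inh sg p t : exists s, slackset sg p t s.
Proof. exists 0. split; [lra|left; reflexivity]. Qed.

(* The distance from [(p, t)] to the complement of [O], looking only upwards
   ([sg = 1]) or only downwards ([sg = -1]) in the fibre, hence monotone in [t]. *)
Definition slack (sg : R) (p : Z) (t : R) : R :=
  proj1_sig (completeness _ (slackset_bound sg p t) (slackset_inh sg p t)).

Lemma slack_lub sg p t : is_lub (slackset sg p t) (slack sg p t).
Proof. unfold slack. destruct completeness. exact i. Qed.

Lemma slack_ge sg p t s : slackset sg p t s -> s <= slack sg p t.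
Proof. apply slack_lub. Qed.

Lemma slack_le sg p t v : (forall s, slackset sg p t s -> s <= v) -> slack sg p t <= v.
Proof. intros H. apply slack_lub. exact H. Qed.

Lemma slack_nonneg sg p t : 0 <= slack sg p t.
Proof. apply slack_ge. split; [lra|left; reflexivity]. Qed.

Lemma slack_pos sg p t : sg = 1 \/ sg = -1 -> D p -> O p t -> 0 < slack sg p t.
Proof.
  intros Hsg Dp Op. destruct (O_open p t Dp Op) as (F & d & Hd & H).
  destruct (CE F p d Hd) as (s & Hs & HE).
  assert (Hm : exists m, 0 < m /\ m <= 1 /\ m <= s /\ m < d).
  { exists (Rmin (Rmin 1 s) (d/2)).
    pose proof (Rmin_l (Rmin 1 s) (d/2)). pose proof (Rmin_r (Rmin 1 s) (d/2)).
    pose proof (Rmin_l 1 s). pose proof (Rmin_r 1 s).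
    repeat split; try lra. repeat apply Rmin_glb_lt; lra. }
  destruct Hm as (m & Hm0 & Hm1 & Hms & Hmd).
  apply Rlt_le_trans with m; auto. apply slack_ge. split; [lra|right].
  exists (t + sg * m). split.
  - destruct Hsg; subst sg; lra.
  - intros q Dq Eq. apply H; auto.
    + apply HE. replace s with (m + (s - m)) by ring.
      apply E_tri with q; auto; try lra. apply E_refl. lra.
    + destruct Hsg; subst sg; apply Rabs_def1; lra.
Qed.

(** Triangle inequality: the witness d for radius s at (p, t) serves at (q, t') for radius s - r -
    u. Enlarging a radius of [E] is done by [E_tri] with a reflexive step. *)
Lemma slack_lip sg p q t t' r u : sg = 1 \/ sg = -1 -> 0 <= r -> E r p q ->
  Rabs (t - t') <= u -> slack sg p t <= slack sg q t' + r + u.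
Proof.
  intros Hsg Hr HE Ht. apply slack_le. intros s [Hs H].
  assert (Hu : 0 <= u) by (pose proof (Rabs_pos (t - t')); lra).
  assert (Ht' : t - t' <= u /\ t' - t <= u).
  { split; [|rewrite Rabs_minus_sym in Ht]; eapply Rle_trans; try exact Ht; apply Rle_abs. }
  destruct (Rle_dec s (r + u)) as [Hle|Hgt].
  { pose proof (slack_nonneg sg q t'). lra. }
  enough (s - r - u <= slack sg q t') by lra.
  apply slack_ge. split; [lra|right].
  destruct H as [H|(d & Hd & H)]; [lra|]. exists d. split.
  - destruct Hsg; subst sg; lra.
  - intros z Dz Hz. apply H; auto.
    replace s with ((r + (s - r - u)) + u) by ring. apply E_tri with z; try lra.
    + apply E_tri with q; auto; lra.
    + apply E_refl. exact Hu.
Qed.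

Lemma slack_mono sg p t t' : sg * t <= sg * t' -> slack sg p t' <= slack sg p t.
Proof.
  intros H. apply slack_le. intros s [Hs Hd]. apply slack_ge. split; auto.
  destruct Hd as [Hd|(d & Hd & HO)]; [left; auto|right]. exists d. split; auto. lra.
Qed.

Lemma slack_bound sg p t v : D p -> 0 <= v ->
  (forall d, O p d -> sg * (d - t) <= v) -> slack sg p t <= v.
Proof.
  intros Dp Hv H. apply slack_le. intros s [Hs [->|(d & Hd & HO)]]; auto.
  apply Rle_trans with (1 := Hd). apply H, HO; auto. apply E_refl; lra.
Qed.

(** Both reciprocal terms are monotone in t, so the sum increases strictly. At a finite end of the
    fibre the slack towards it tends to 0 and its reciprocal blows up; at an infinite end t itself
    does. Hence each fibre is stretched onto the whole line. *)
Definition fib (p : Z) (t : R) : R := t + / slack 1 p t - / slack (-1) p t.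

Lemma fib_lt p t t' : D p -> O p t -> O p t' -> t < t' -> fib p t < fib p t'.
Proof.
  intros Dp Ot Ot' Ht. unfold fib.
  assert (/ slack 1 p t <= / slack 1 p t').
  { apply Rinv_le_contravar; [apply slack_pos; auto|apply slack_mono; lra]. }
  assert (/ slack (-1) p t' <= / slack (-1) p t).
  { apply Rinv_le_contravar; [apply slack_pos; auto|apply slack_mono; lra]. }
  lra.
Qed.

Lemma fib_inj p t t' : D p -> O p t -> O p t' -> fib p t = fib p t' -> t = t'.
Proof.
  intros Dp Ot Ot' H. destruct (Rtotal_order t t') as [L|[L|L]]; auto.
  - pose proof (fib_lt p t t' Dp Ot Ot' L). lra.
  - pose proof (fib_lt p t' t Dp Ot' Ot L). lra.
Qed.

Definition OD (z : Z * R) : Prop := D (fst z) /\ O (fst z) (snd z).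

Lemma slack_cts sg : sg = 1 \/ sg = -1 ->
  cts (addc c) OD (fun z => slack sg (fst z) (snd z)).
Proof.
  intros Hsg [p t] _ e He. destruct (EC p (e/3)) as (F & d & Hd & H); [lra|].
  exists (None :: map Some F), (Rmin d (e/3)). split; [apply Rmin_glb_lt; lra|].
  intros [q t'] _ Hc. simpl.
  assert (HE : E (e/3) p q).
  { apply H. intros k Hk. eapply Rlt_le_trans; [|apply (Rmin_l d (e/3))].
    apply (Hc (Some k)). right. apply in_map. exact Hk. }
  assert (Ht : Rabs (t' - t) <= e/3).
  { apply Rlt_le. eapply Rlt_le_trans; [|apply (Rmin_r d (e/3))].
    apply (Hc None). left. reflexivity. }
  pose proof (slack_lip sg q p t' t (e/3) (e/3) Hsg ltac:(lra) (E_sym _ _ _ HE) Ht).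
  rewrite Rabs_minus_sym in Ht.
  pose proof (slack_lip sg p q t t' (e/3) (e/3) Hsg ltac:(lra) HE Ht).
  apply Rabs_def1; lra.
Qed.

Lemma fib_cts : cts (addc c) OD (fun z => fib (fst z) (snd z)).
Proof.
  unfold fib.
  assert (P : forall sg, sg = 1 \/ sg = -1 -> forall z, OD z -> slack sg (fst z) (snd z) <> 0).
  { intros sg Hsg z [H1 H2]. pose proof (slack_pos sg _ _ Hsg H1 H2). lra. }
  apply cts_minus; [apply cts_plus|].
  - apply (cts_coord _ _ (addc c) OD None).
  - apply cts_inv; auto. apply slack_cts; auto.
  - apply cts_inv; auto. apply slack_cts; auto.
Qed.

(** The Lipschitz bound with arbitrarily small r gives equal slacks. This later makes the stage-n
    construction depend on the first n guesses alone. *)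
Lemma fib_indep p q t : (forall s, 0 < s -> E s p q) -> fib p t = fib q t.
Proof.
  intros H. assert (Hs : forall sg, sg = 1 \/ sg = -1 -> slack sg p t = slack sg q t).
  { intros sg Hsg.
    assert (A : forall e, 0 < e -> slack sg p t <= slack sg q t + e /\ slack sg q t <= slack sg p t + e).
    { intros e He. split.
      - replace e with (e + 0) by ring. rewrite <- Rplus_assoc. apply slack_lip; auto; try lra.
        rewrite Rminus_diag, Rabs_R0. lra.
      - replace e with (e + 0) by ring. rewrite <- Rplus_assoc. apply slack_lip; auto; try lra.
        rewrite Rminus_diag, Rabs_R0. lra. }
    apply Rle_antisym; apply le_epsilon; intros e He; apply A; exact He. }
  unfold fib. rewrite !Hs; auto.
Qed.

(** If [fib p] stayed below y, the fibre would be bounded above by y + b; but near its supremum u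
    the upward slack is at most u - t, whose reciprocal is too large. *)
Lemma fib_above p y : D p -> exists t, O p t /\ y < fib p t.
Proof.
  intros Dp. destruct (O_ne p Dp) as (t0 & O0). apply NNPP. intros N.
  assert (N' : forall t, O p t -> fib p t <= y).
  { intros t Ot. destruct (Rle_dec (fib p t) y); auto. exfalso. apply N. exists t. split; auto. lra. }
  set (b := / slack (-1) p t0).
  assert (B : forall t, t0 <= t -> O p t -> t + / slack 1 p t <= y + b).
  { intros t Ht Ot. pose proof (N' t Ot) as H. unfold fib in H.
    assert (/ slack (-1) p t <= b).
    { apply Rinv_le_contravar; [apply slack_pos; auto|apply slack_mono; lra]. } lra. }
  assert (P : forall t, O p t -> 0 < / slack 1 p t).
  { intros t Ot. apply Rinv_0_lt_compat, slack_pos; auto. }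
  destruct (completeness (O p)) as (u & Hub & Hlub).
  { exists (Rmax t0 (y + b)). intros t Ot. destruct (Rle_dec t0 t) as [L|L].
    - pose proof (B t L Ot). pose proof (P t Ot). pose proof (Rmax_r t0 (y+b)). lra.
    - pose proof (Rmax_l t0 (y+b)). lra. }
  { exists t0. exact O0. }
  (* Chosen so that 1/w exceeds y + b - t0, and hence y + b - t for every t >= t0. *)
  set (w := / (Rabs (y + b - t0) + 1)).
  assert (Hw0 : 0 < Rabs (y + b - t0) + 1) by (pose proof (Rabs_pos (y + b - t0)); lra).
  assert (Hw : 0 < w) by (apply Rinv_0_lt_compat; exact Hw0).
  assert (Ex : exists t, O p t /\ t0 <= t /\ u - w < t).
  { destruct (Rlt_dec (u - w) t0) as [L|L].
    - exists t0. repeat split; auto. lra.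
    - apply NNPP. intros N2. assert (u <= u - w); [|lra].
      apply Hlub. intros t Ot. destruct (Rle_dec t (u - w)); auto. exfalso.
      apply N2. exists t. repeat split; auto; lra. }
  destruct Ex as (t & Ot & Ht0 & Htu).
  assert (S : slack 1 p t <= w).
  { apply slack_bound; auto; [lra|]. intros d Od. pose proof (Hub d Od). lra. }
  assert (/ w <= / slack 1 p t) by (apply Rinv_le_contravar; auto; apply slack_pos; auto).
  unfold w in H. rewrite Rinv_inv in H. pose proof (B t Ht0 Ot).
  pose proof (Rle_abs (y + b - t0)). lra.
Qed.

Lemma fib_below p y : D p -> exists t, O p t /\ fib p t < y.
Proof.
  intros Dp. destruct (O_ne p Dp) as (t0 & O0). apply NNPP. intros N.
  assert (N' : forall t, O p t -> y <= fib p t).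
  { intros t Ot. destruct (Rle_dec y (fib p t)); auto. exfalso. apply N. exists t. split; auto. lra. }
  set (b := / slack 1 p t0).
  assert (B : forall t, t <= t0 -> O p t -> y - b <= t - / slack (-1) p t).
  { intros t Ht Ot. pose proof (N' t Ot) as H. unfold fib in H.
    assert (/ slack 1 p t <= b).
    { apply Rinv_le_contravar; [apply slack_pos; auto|apply slack_mono; lra]. } lra. }
  assert (P : forall t, O p t -> 0 < / slack (-1) p t).
  { intros t Ot. apply Rinv_0_lt_compat, slack_pos; auto. }
  (* The infimum of the fibre, taken as the supremum of its mirror image. *)
  destruct (completeness (fun t => O p (- t))) as (u & Hub & Hlub).
  { exists (Rmax (-t0) (b - y)). intros t Ot. destruct (Rle_dec (-t) t0) as [L|L].
    - pose proof (B (-t) L Ot). pose proof (P _ Ot). pose proof (Rmax_r (-t0) (b-y)). lra.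
    - pose proof (Rmax_l (-t0) (b-y)). lra. }
  { exists (-t0). rewrite Ropp_involutive. exact O0. }
  set (w := / (Rabs (t0 - (y - b)) + 1)).
  assert (Hw0 : 0 < Rabs (t0 - (y - b)) + 1) by (pose proof (Rabs_pos (t0 - (y - b))); lra).
  assert (Hw : 0 < w) by (apply Rinv_0_lt_compat; exact Hw0).
  assert (Ex : exists t, O p t /\ t <= t0 /\ u - w < - t).
  { destruct (Rlt_dec (u - w) (-t0)) as [L|L].
    - exists t0. repeat split; auto. lra.
    - apply NNPP. intros N2. assert (u <= u - w); [|lra].
      apply Hlub. intros t Ot. destruct (Rle_dec t (u - w)); auto. exfalso.
      apply N2. exists (-t). repeat split; auto; lra. }
  destruct Ex as (t & Ot & Ht0 & Htu).
  assert (S : slack (-1) p t <= w).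
  { apply slack_bound; auto; [lra|]. intros d Od.
    assert (-d <= u) by (apply Hub; rewrite Ropp_involutive; exact Od). lra. }
  assert (/ w <= / slack (-1) p t) by (apply Rinv_le_contravar; auto; apply slack_pos; auto).
  unfold w in H. rewrite Rinv_inv in H. pose proof (B t Ht0 Ot).
  pose proof (Rle_abs (t0 - (y - b))). lra.
Qed.

Lemma fib_surj p y : D p -> exists t, O p t /\ fib p t = y.
Proof.
  intros Dp. destruct (fib_below p y Dp) as (t1 & O1 & H1).
  destruct (fib_above p y Dp) as (t2 & O2 & H2).
  assert (L : t1 < t2).
  { destruct (Rtotal_order t1 t2) as [L|[L|L]]; auto; [subst; lra|].
    pose proof (fib_lt p t2 t1 Dp O2 O1 L). lra. }
  destruct (IVT_interv (fun t => fib p t - y) t1 t2) as (t & Ht & Ht'); try lra.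
  - intros t Ht. assert (Ot : O p t) by (apply O_conv with t1 t2; auto).
    intros e He. destruct (fib_cts (p, t) (conj Dp Ot) e He) as (F & d & Hd & H).
    destruct (O_open p t Dp Ot) as (F' & d' & Hd' & H').
    assert (Cl : forall G r, 0 < r -> close c G r p p).
    { intros G r Hr k _. rewrite Rminus_diag, Rabs_R0. exact Hr. }
    exists (Rmin d d'). split; [apply Rmin_glb_lt; auto|].
    intros t' [_ Hd2]. simpl in *. unfold Rdist in *.
    replace (fib p t' - y - (fib p t - y)) with (fib p t' - fib p t) by ring.
    apply (H (p, t')).
    + split; auto. simpl. apply H'; auto. pose proof (Rmin_r d d'). lra.
    + intros [k|] _; simpl; [rewrite Rminus_diag, Rabs_R0; auto|]. pose proof (Rmin_l d d'). lra.
  - exists t. split; [apply O_conv with t1 t2; auto|]. lra.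
Qed.

Definition fibinv (p : Z) (y : R) : R := epsilon (inhabits 0) (fun t => O p t /\ fib p t = y).

Lemma fibinv_spec p y : D p -> O p (fibinv p y) /\ fib p (fibinv p y) = y.
Proof. intros Dp. unfold fibinv. apply epsilon_spec, fib_surj. exact Dp. Qed.

Lemma fibinv_fib p t : D p -> O p t -> fibinv p (fib p t) = t.
Proof.
  intros Dp Ot. destruct (fibinv_spec p (fib p t) Dp) as [H1 H2].
  apply (fib_inj p); auto.
Qed.

(** Only the heights t - h and t + h need control: for q near p the values of [fib q] there still
    enclose the target, and monotonicity traps the solution between them. *)
Lemma fibinv_cts : cts (addc c) (fun z => D (fst z)) (fun z => fibinv (fst z) (snd z)).
Proof.
  intros [p y] Dp e He. simpl in *. destruct (fibinv_spec p y Dp) as [Ot Hy].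
  set (t := fibinv p y) in *.
  destruct (O_open p t Dp Ot) as (F & d & Hd & HO).
  set (h := Rmin (d/2) (e/2)).
  assert (Hh : 0 < h) by (apply Rmin_glb_lt; lra).
  assert (h <= d/2 /\ h <= e/2) as [Hh1 Hh2] by (split; [apply Rmin_l|apply Rmin_r]).
  assert (Cl : forall G r, 0 < r -> close c G r p p).
  { intros G r Hr k _. rewrite Rminus_diag, Rabs_R0. exact Hr. }
  assert (Om : O p (t - h)) by (apply HO; auto; apply Rabs_def1; lra).
  assert (Op : O p (t + h)) by (apply HO; auto; apply Rabs_def1; lra).
  pose proof (fib_lt p (t - h) t Dp Om Ot ltac:(lra)) as L1.
  pose proof (fib_lt p t (t + h) Dp Ot Op ltac:(lra)) as L2.
  set (w := Rmin (y - fib p (t - h)) (fib p (t + h) - y) / 2).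
  assert (Hw : 0 < w) by (unfold w; apply Rdiv_lt_0_compat; [apply Rmin_glb_lt; lra|lra]).
  assert (w <= (y - fib p (t - h))/2 /\ w <= (fib p (t + h) - y)/2) as [Hw1 Hw2].
  { unfold w. pose proof (Rmin_l (y - fib p (t - h)) (fib p (t + h) - y)).
    pose proof (Rmin_r (y - fib p (t - h)) (fib p (t + h) - y)). lra. }
  destruct (fib_cts (p, t - h) (conj Dp Om) w Hw) as (F1 & d1 & Hd1 & C1).
  destruct (fib_cts (p, t + h) (conj Dp Op) w Hw) as (F2 & d2 & Hd2 & C2).
  set (G := None :: map Some F ++ F1 ++ F2).
  set (m := Rmin (Rmin d w) (Rmin d1 d2)).
  assert (Hm : 0 < m) by (repeat apply Rmin_glb_lt; auto).
  assert (m <= d /\ m <= w /\ m <= d1 /\ m <= d2) as (M1 & M2 & M3 & M4).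
  { unfold m. pose proof (Rmin_l (Rmin d w) (Rmin d1 d2)).
    pose proof (Rmin_r (Rmin d w) (Rmin d1 d2)).
    pose proof (Rmin_l d w). pose proof (Rmin_r d w).
    pose proof (Rmin_l d1 d2). pose proof (Rmin_r d1 d2). repeat split; lra. }
  exists G, m. split; auto. intros [q z] Dq HC. simpl in *.
  assert (Hz : Rabs (z - y) < m) by (apply (HC None); left; reflexivity).
  assert (Cq : close c F d p q).
  { intros k Hk. eapply Rlt_le_trans; [apply (HC (Some k))|exact M1].
    right. apply in_or_app. left. apply in_map. exact Hk. }
  assert (Oqm : O q (t - h)) by (apply HO; auto; apply Rabs_def1; lra).
  assert (Oqp : O q (t + h)) by (apply HO; auto; apply Rabs_def1; lra).
  assert (B1 : Rabs (fib q (t - h) - fib p (t - h)) < w).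
  { apply (C1 (q, t - h)); [split; auto|]. intros [k|] Hk; simpl.
    - eapply Rlt_le_trans; [apply (HC (Some k))|exact M3].
      right. apply in_or_app. right. apply in_or_app. left. exact Hk.
    - rewrite Rminus_diag, Rabs_R0. exact Hd1. }
  assert (B2 : Rabs (fib q (t + h) - fib p (t + h)) < w).
  { apply (C2 (q, t + h)); [split; auto|]. intros [k|] Hk; simpl.
    - eapply Rlt_le_trans; [apply (HC (Some k))|exact M4].
      right. apply in_or_app. right. apply in_or_app. right. exact Hk.
    - rewrite Rminus_diag, Rabs_R0. exact Hd2. }
  apply Rabs_def2 in B1. apply Rabs_def2 in B2. apply Rabs_def2 in Hz.
  destruct (fibinv_spec q z Dq) as [Oi Hi]. set (ti := fibinv q z) in *.
  assert (t - h < ti).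
  { destruct (Rlt_dec (t - h) ti) as [|N]; auto. exfalso.
    destruct (Rle_lt_or_eq_dec ti (t - h)) as [L|L]; [lra| |].
    - pose proof (fib_lt q ti (t - h) Dq Oi Oqm L). lra.
    - rewrite L in Hi. lra. }
  assert (ti < t + h).
  { destruct (Rlt_dec ti (t + h)) as [|N]; auto. exfalso.
    destruct (Rle_lt_or_eq_dec (t + h) ti) as [L|L]; [lra| |].
    - pose proof (fib_lt q (t + h) ti Dq Oqp Oi L). lra.
    - rewrite <- L in Hi. lra. }
  apply Rabs_def1; lra.
Qed.

Lemma fibinv_indep p q y : D p -> (forall t, O p t <-> O q t) ->
  (forall s, 0 < s -> E s p q) -> D q -> fibinv p y = fibinv q y.
Proof.
  intros Dp HO HE Dq. destruct (fibinv_spec p y Dp) as [H1 H2].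
  destruct (fibinv_spec q y Dq) as [H3 H4].
  apply (fib_inj q); auto; [apply HO; auto|].
  rewrite H4, <- (fib_indep p q); auto.
Qed.

End Fibre.

Definition prodc {K T K' T' : Type} (c : K -> T -> R) (c' : K' -> T' -> R)
  (k : K + K') (p : T * T') : R :=
  match k with inl k => c k (fst p) | inr k => c' k (snd p) end.

Definition seqc {K : Type} (k : K) (x : K -> R) : R := x k.

(** * A homeomorphism of the line with the open unit interval *)

Definition squash (y : R) : R := / 2 * (1 + y / (1 + Rabs y)).
Definition unsquash (s : R) : R := (2 * s - 1) / (1 - Rabs (2 * s - 1)).

Lemma squash_bounds y : 0 < squash y < 1.
Proof.
  unfold squash. assert (H : 0 < 1 + Rabs y) by (pose proof (Rabs_pos y); lra).
  assert (-1 < y / (1 + Rabs y) < 1); [|lra].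
  split; [apply Rmult_lt_reg_r with (1 + Rabs y)|apply Rmult_lt_reg_r with (1 + Rabs y)]; auto;
    unfold Rdiv; rewrite Rmult_assoc, Rinv_l by lra;
    pose proof (Rle_abs y); pose proof (Rle_abs (- y)); rewrite Rabs_Ropp in *; lra.
Qed.

Lemma unsquash_squash y : unsquash (squash y) = y.
Proof.
  unfold unsquash, squash. assert (H : 0 < 1 + Rabs y) by (pose proof (Rabs_pos y); lra).
  replace (2 * (/ 2 * (1 + y / (1 + Rabs y))) - 1) with (y / (1 + Rabs y)) by (field; lra).
  replace (1 - Rabs (y / (1 + Rabs y))) with (/ (1 + Rabs y)); [field; lra|].
  unfold Rdiv. rewrite Rabs_mult, Rabs_inv, (Rabs_right (1 + Rabs y)) by lra.
  field. lra.
Qed.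

Lemma squash_unsquash s : 0 < s < 1 -> squash (unsquash s) = s.
Proof.
  intros Hs. unfold unsquash, squash. set (u := 2 * s - 1).
  assert (Hu : 0 < 1 - Rabs u) by (unfold u, Rabs; destruct Rcase_abs; lra).
  replace (1 + Rabs (u / (1 - Rabs u))) with (/ (1 - Rabs u)).
  - replace (u / (1 - Rabs u) / / (1 - Rabs u)) with u by (field; lra). unfold u. field.
  - unfold Rdiv. rewrite Rabs_mult, Rabs_inv, (Rabs_right (1 - Rabs u)) by lra.
    field. lra.
Qed.

Lemma squash_lt y y' : y < y' -> squash y < squash y'.
Proof.
  intros H. unfold squash.
  assert (H1 : 0 < 1 + Rabs y) by (pose proof (Rabs_pos y); lra).
  assert (H2 : 0 < 1 + Rabs y') by (pose proof (Rabs_pos y'); lra).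
  enough (y / (1 + Rabs y) < y' / (1 + Rabs y')) by lra.
  apply Rmult_lt_reg_r with ((1 + Rabs y) * (1 + Rabs y')); [nra|].
  replace (y / (1 + Rabs y) * ((1 + Rabs y) * (1 + Rabs y'))) with (y * (1 + Rabs y')) by (field; lra).
  replace (y' / (1 + Rabs y') * ((1 + Rabs y) * (1 + Rabs y'))) with (y' * (1 + Rabs y)) by (field; lra).
  unfold Rabs in *. destruct (Rcase_abs y), (Rcase_abs y'); nra.
Qed.

Lemma cts_squash {T K : Type} (c : K -> T -> R) D f : cts c D f -> cts c D (fun x => squash (f x)).
Proof.
  intros Hf. unfold squash. apply cts_scal, cts_plus; [apply cts_const|].
  apply cts_div; auto; [apply cts_plus; [apply cts_const|apply cts_abs; auto]|].
  intros x _. pose proof (Rabs_pos (f x)). lra.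
Qed.

Lemma cts_unsquash {T K : Type} (c : K -> T -> R) D f : cts c D f ->
  (forall x, D x -> 0 < f x < 1) -> cts c D (fun x => unsquash (f x)).
Proof.
  intros Hf H. unfold unsquash.
  assert (cts c D (fun x => 2 * f x - 1)) by (apply cts_minus; [apply cts_scal; auto|apply cts_const]).
  apply cts_div; auto; [apply cts_minus; [apply cts_const|apply cts_abs; auto]|].
  intros x Dx. specialize (H x Dx). unfold Rabs. destruct Rcase_abs; lra.
Qed.

Section SeqEntourage.
Variables (Z : Type) (c : nat + nat -> Z -> R).

(** For s >= 0 this says that the distance sup_k min(|c_k p - c_k q|, 1/(k+1)), taken over both
    halves of the family, is at most s: it is the usual metric for countably many coordinates. *)
Definition ent (s : R) (p q : Z) : Prop := forall k, INR (k + 1) * s < 1 ->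
  Rabs (c (inl k) p - c (inl k) q) <= s /\ Rabs (c (inr k) p - c (inr k) q) <= s.

Lemma ent_refl s p : 0 <= s -> ent s p p.
Proof. intros Hs k _. rewrite !Rminus_diag, Rabs_R0. auto. Qed.

Lemma ent_sym s p q : ent s p q -> ent s q p.
Proof.
  intros H k Hk. rewrite (Rabs_minus_sym (c (inl k) q)), (Rabs_minus_sym (c (inr k) q)). auto.
Qed.

Lemma ent_tri r s p q z : 0 <= r -> 0 <= s -> ent r p q -> ent s q z -> ent (r + s) p z.
Proof.
  intros Hr Hs H1 H2 k Hk. pose proof (pos_INR (k + 1)).
  destruct (H1 k) as [A1 A2]; [nra|]. destruct (H2 k) as [B1 B2]; [nra|].
  split; [replace (c (inl k) p - c (inl k) z) with
      ((c (inl k) p - c (inl k) q) + (c (inl k) q - c (inl k) z)) by ring|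
    replace (c (inr k) p - c (inr k) z) with
      ((c (inr k) p - c (inr k) q) + (c (inr k) q - c (inr k) z)) by ring];
  eapply Rle_trans; try apply Rabs_triang; lra.
Qed.

Lemma ent_of_close p s : 0 < s -> exists F d, 0 < d /\ forall q, close c F d p q -> ent s p q.
Proof.
  intros Hs. destruct (INR_unbounded (/ s)) as (N & HN).
  exists (map inl (seq 0 N) ++ map inr (seq 0 N)), s. split; auto.
  intros q Hc k Hk. assert (kN : (k < N)%nat).
  { apply Nat.nle_gt. intros L. apply le_INR in L. rewrite plus_INR in Hk. simpl in Hk.
    assert (s * / s = 1) by (apply Rinv_r; lra). nra. }
  rewrite (Rabs_minus_sym (c (inl k) p)), (Rabs_minus_sym (c (inr k) p)).
  split; apply Rlt_le, Hc, in_or_app; [left|right]; apply in_map, in_seq; lia.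
Qed.

Lemma close_of_ent F p d : 0 < d -> exists s, 0 < s /\ forall q, ent s p q -> close c F d p q.
Proof.
  intros Hd. induction F as [|k F (s & Hs & IH)].
  { exists 1. split; [lra|]. intros q _ k []. }
  set (n := match k with inl k => k | inr k => k end).
  set (r := Rmin (Rmin s (d/2)) (/ (INR (n + 1) + 1))).
  pose proof (pos_INR (n + 1)) as Hn.
  assert (Hi : 0 < / (INR (n + 1) + 1)) by (apply Rinv_0_lt_compat; lra).
  assert (Hr : 0 < r) by (repeat apply Rmin_glb_lt; lra).
  assert (r <= s /\ r <= d/2 /\ r <= / (INR (n + 1) + 1)) as (R1 & R2 & R3).
  { unfold r. pose proof (Rmin_l (Rmin s (d/2)) (/ (INR (n + 1) + 1))).
    pose proof (Rmin_r (Rmin s (d/2)) (/ (INR (n + 1) + 1))).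
    pose proof (Rmin_l s (d/2)). pose proof (Rmin_r s (d/2)). repeat split; lra. }
  exists r. split; auto. intros q Hq j [<-|Hj].
  - assert (L : INR (n + 1) * r < 1).
    { assert ((INR (n + 1) + 1) * / (INR (n + 1) + 1) = 1) by (apply Rinv_r; lra). nra. }
    destruct (Hq n L). rewrite Rabs_minus_sym. destruct k; unfold n in *; lra.
  - apply IH; auto. replace s with (r + (s - r)) by ring.
    apply ent_tri with q; auto; try lra. apply ent_refl. lra.
Qed.
End SeqEntourage.

(** * Trivializing a map with connected fibres *)

Definition box := nat -> R * R.

(* A guess [x] below [t = phi k A] replaces the bounds [a < t < b] by
   [x < t < x + min (x - a, b - x) / 2]: their closure lies inside the old
   bounds, so that strict inequalities survive in the limit. *)
Definition refine (b : box) (k : nat) (x : R) : box := fun j =>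
  if Nat.eqb j k then (x, x + Rmin (x - fst (b k)) (snd (b k) - x) / 2) else b j.

(** Every index recurs infinitely often, so that each functional is located ever more precisely. *)
Definition schedule (n : nat) : nat := fst (Cantor.of_nat n).

Lemma schedule_unbounded k N : exists n, (N <= n)%nat /\ schedule n = k.
Proof.
  exists (Cantor.to_nat (k, N)). split.
  - pose proof (Cantor.to_nat_non_decreasing k N). lia.
  - unfold schedule. rewrite Cantor.cancel_of_to. reflexivity.
Qed.

Fixpoint state (x : nat -> R) (n : nat) : box :=
  match n with
  | O => fun _ => (0, 1)
  | S n => refine (state x n) (schedule n) (x n)
  end.

Lemma state_ext x x' n : (forall k, (k < n)%nat -> x k = x' k) -> state x n = state x' n.
Proof.
  induction n as [|n IH]; intros H; simpl; auto.
  rewrite IH, (H n); auto.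
Qed.

Lemma refine_same b k x : refine b k x k = (x, x + Rmin (x - fst (b k)) (snd (b k) - x) / 2).
Proof. unfold refine. rewrite Nat.eqb_refl. reflexivity. Qed.

Lemma refine_other b k x j : j <> k -> refine b k x j = b j.
Proof. intros H. unfold refine. apply Nat.eqb_neq in H. rewrite H. reflexivity. Qed.

Definition width (b : box) (k : nat) : R := snd (b k) - fst (b k).

(** The minimum of the two distances to the ends is at most half the old width, and the new interval
    has half that length. *)
Lemma width_refine b k x : width (refine b k x) k <= width b k / 4.
Proof.
  unfold width. rewrite refine_same. simpl. unfold Rmin. destruct Rle_dec; lra.
Qed.

(** That N is independent of the guesses turns pointwise approximation into uniform approximation in
    [bwdA_cts]. *)
Lemma width_small k e : 0 < e -> exists N, forall x n, (N <= n)%nat -> width (state x n) k < e.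
Proof.
  intros He.
  assert (H : forall m, exists N, forall x n, (N <= n)%nat -> width (state x n) k <= (/ 4) ^ m).
  { assert (step : forall b j y v, 0 < v -> width b k <= v -> width (refine b j y) k <= v).
    { intros b j y v Hv H. destruct (Nat.eq_dec k j) as [<-|N].
      - pose proof (width_refine b k y). lra.
      - unfold width in *. rewrite refine_other; auto. }
    assert (P : forall m, 0 < (/ 4) ^ m) by (intros; apply pow_lt; lra).
    induction m as [|m (N & IH)].
    - exists O. intros x n _. induction n as [|n IH].
      + unfold width. simpl. lra.
      + simpl. apply (step _ _ _ 1); [lra|exact IH].
    - destruct (schedule_unbounded k N) as (n0 & L & Hk). exists (S n0).
      intros x n Hn. induction Hn as [|n Hn IHn].
      + simpl. rewrite Hk. pose proof (width_refine (state x n0) k (x n0)).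
        pose proof (IH x n0 L). simpl in *. lra.
      + apply step; auto. }
  destruct (pow_lt_1_zero (/ 4)) with (y := e) as (m & Hm); auto.
  { rewrite Rabs_right; lra. }
  destruct (H m) as (N & HN). exists N. intros x n Hn.
  eapply Rle_lt_trans; [apply HN; auto|]. specialize (Hm m (le_n _)).
  apply Rabs_def2 in Hm. lra.
Qed.

(** For a true value t in (a, b), the refinement condition t < x + min(x - a, b - x)/2 amounts to x
    > (2t + a)/3 and x > 2t - b; the admissible guesses form the interval from [low t (a, b)] to
    t. *)
Definition low (t : R) (ab : R * R) : R := Rmax ((2 * t + fst ab) / 3) (2 * t - snd ab).

Lemma low_lt t ab : fst ab < t < snd ab -> low t ab < t.
Proof. intros H. unfold low. apply Rmax_lub_lt; lra. Qed.

Lemma step_iff t ab x : fst ab < t < snd ab ->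
  (x < t < x + Rmin (x - fst ab) (snd ab - x) / 2 <-> low t ab < x < t).
Proof.
  intros H. unfold low. split.
  - intros H1. split; [|lra]. pose proof (Rmin_l (x - fst ab) (snd ab - x)).
    pose proof (Rmin_r (x - fst ab) (snd ab - x)). apply Rmax_lub_lt; lra.
  - intros H1. pose proof (Rmax_l ((2 * t + fst ab) / 3) (2 * t - snd ab)).
    pose proof (Rmax_r ((2 * t + fst ab) / 3) (2 * t - snd ab)). split; [lra|].
    unfold Rmin. destruct Rle_dec; lra.
Qed.

Lemma step_in t a b x : x < t < x + Rmin (x - a) (b - x) / 2 ->
  a < x /\ x + Rmin (x - a) (b - x) / 2 < b.
Proof. intros H. pose proof (Rmin_l (x - a) (b - x)). pose proof (Rmin_r (x - a) (b - x)). lra. Qed.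

Section Local.
Variables (T : Type) (XQ XP : T -> Prop) (rho : T -> T) (phi : nat -> T -> R).
Hypothesis XPQ : forall B, XP B -> XQ B.
Hypothesis rhoP : forall A, XQ A -> XP (rho A).
Hypothesis rho_id : forall B, XP B -> rho B = B.
Hypothesis phi01 : forall k A, 0 < phi k A < 1.
Hypothesis phi_sep : forall A A', XQ A -> XQ A' ->
  (forall k, phi k A = phi k A') -> A = A'.
Hypothesis rho_cts : forall k, cts phi XQ (fun A => phi k (rho A)).
Hypothesis rho_open : forall A, XQ A -> forall F d, 0 < d ->
  ev phi XP (rho A) (fun B => exists A', XQ A' /\ rho A' = B /\ close phi F d A A').
(** Connectedness of fibres in the form needed: the intermediate set stays between the two given
    ones in every functional, hence inside every box that contains both. *)
Hypothesis phi_conn : forall A A' k r, XQ A -> XQ A' -> rho A = rho A' ->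
  phi k A <= r <= phi k A' ->
  exists A'', XQ A'' /\ rho A'' = rho A /\ phi k A'' = r /\
    forall j, Rmin (phi j A) (phi j A') <= phi j A'' <= Rmax (phi j A) (phi j A').
Hypothesis phi_lim : forall B (As : nat -> T) (t : nat -> R), XP B ->
  (forall n, XQ (As n) /\ rho (As n) = B) -> (forall k, 0 < t k < 1) ->
  (forall k, Un_cv (fun n => phi k (As n)) (t k)) ->
  exists A, XQ A /\ rho A = B /\ forall k, phi k A = t k.

Definition inbox (A : T) (b : box) : Prop := forall k, fst (b k) < phi k A < snd (b k).

Lemma inbox_refine A b k x : inbox A (refine b k x) <->
  inbox A b /\ x < phi k A < x + Rmin (x - fst (b k)) (snd (b k) - x) / 2.
Proof.
  split.
  - intros H. pose proof (H k) as Hk. rewrite refine_same in Hk. simpl in Hk.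
    split; auto. intros j. destruct (Nat.eq_dec j k) as [->|N].
    + destruct (step_in _ _ _ _ Hk). lra.
    + specialize (H j). rewrite refine_other in H; auto.
  - intros [H Hk] j. destruct (Nat.eq_dec j k) as [->|N].
    + rewrite refine_same. exact Hk.
    + rewrite refine_other; auto.
Qed.

Definition valid (n : nat) (B : T) (x : nat -> R) : Prop :=
  exists A, XQ A /\ rho A = B /\ inbox A (state x n).

Definition Dom (n : nat) (z : T * (nat -> R)) : Prop :=
  XP (fst z) /\ valid n (fst z) (snd z).

(** The open set with interval fibres, over the base [Dom n], to which the fibrewise stretching is
    applied at stage n. *)
Definition Nxt (n : nat) (z : T * (nat -> R)) (t : R) : Prop :=
  exists A, XQ A /\ rho A = fst z /\ inbox A (refine (state (snd z) n) (schedule n) t).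

(** Later guesses are masked by 0, so points that agree on the first n guesses are at distance 0 at
    stage n. *)
Definition cn (n : nat) (k : nat + nat) (z : T * (nat -> R)) : R :=
  match k with
  | inl k => phi k (fst z)
  | inr k => if Nat.ltb k n then snd z k else 0
  end.

Lemma cn_coord n k : (k < n)%nat -> cts (cn n) (fun _ => True) (fun z => snd z k).
Proof.
  intros H. apply cts_ext with (cn n (inr k)); [|apply cts_coord].
  intros z _. simpl. apply Nat.ltb_lt in H. rewrite H. reflexivity.
Qed.

Lemma cts_state {S K : Type} (c : K -> S -> R) D (f : S -> nat -> R) n k :
  (forall m, (m < n)%nat -> cts c D (fun s => f s m)) ->
  cts c D (fun s => fst (state (f s) n k)) /\ cts c D (fun s => snd (state (f s) n k)).
Proof.
  revert k. induction n as [|n IH]; intros k H.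
  - simpl. split; apply cts_const.
  - simpl. unfold refine. assert (H' : forall m, (m < n)%nat -> cts c D (fun s => f s m)) by auto.
    destruct (Nat.eqb k (schedule n)); [|apply IH; auto].
    destruct (IH (schedule n) H') as [I1 I2]. simpl. pose proof (H n (Nat.lt_succ_diag_r n)) as Hn.
    split; auto. apply cts_plus; auto.
    apply (cts_ext _ _ c D (fun s => / 2 * Rmin (f s n - fst (state (f s) n (schedule n)))
       (snd (state (f s) n (schedule n)) - f s n))); [intros; field|].
    apply cts_scal, cts_min; apply cts_minus; auto.
Qed.

Lemma state_unasked x n k : (forall m, (m < n)%nat -> schedule m <> k) -> state x n k = (0, 1).
Proof.
  induction n as [|n IH]; intros H; simpl; auto.
  rewrite refine_other; [apply IH; auto|]. intros E. apply (H n); auto.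
Qed.

(** Openness of the restriction lifts a witness A to a nearby set over the base point of q, and
    strict inequalities leave room for the change. Finitely many indices are concerned: those not
    scheduled up to stage n keep the initial interval (0, 1). *)
Lemma Nxt_open n p t : Dom n p -> Nxt n p t -> exists F d, 0 < d /\
  forall q t', Dom n q -> close (cn n) F d p q -> Rabs (t' - t) < d -> Nxt n q t'.
Proof.
  intros [Pp _] (A & QA & rA & HA).
  set (st := fun z : (T * (nat -> R)) * R =>
    refine (state (snd (fst z)) n) (schedule n) (snd z)).
  set (D1 := fun _ : (T * (nat -> R)) * R => True).
  assert (Cst : forall k, cts (addc (cn n)) D1 (fun z => fst (st z k)) /\
                     cts (addc (cn n)) D1 (fun z => snd (st z k))).
  { assert (C0 : forall k, cts (addc (cn n)) D1 (fun z => fst (state (snd (fst z)) n k)) /\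
                      cts (addc (cn n)) D1 (fun z => snd (state (snd (fst z)) n k))).
    { intros k. apply cts_state. intros m Hm.
      apply (cts_comp (addc (cn n)) D1 (cn n) (fun _ => True) fst (fun z => snd z m)); unfold D1; auto.
      - apply cn_coord; auto.
      - intros j. apply (cts_coord _ _ (addc (cn n)) _ (Some j)). }
    assert (Ct : cts (addc (cn n)) D1 (fun z => snd z)) by apply (cts_coord _ _ (addc (cn n)) _ None).
    intros k. unfold st, refine. destruct (Nat.eqb k (schedule n)); [|apply C0].
    destruct (C0 (schedule n)) as [I1 I2]. simpl. split; auto. apply cts_plus; auto.
    apply (cts_ext _ _ _ D1 (fun z => / 2 * Rmin (snd z - fst (state (snd (fst z)) n (schedule n)))
       (snd (state (snd (fst z)) n (schedule n)) - snd z))); [intros; field|].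
    apply cts_scal, cts_min; apply cts_minus; auto. }
  set (ks := map schedule (seq 0 (S n))).
  (* One r pays for the change of the functional, the other for the change of the box. *)
  assert (Hmar : exists r, 0 < r /\ forall k, In k ks ->
    fst (st (p, t) k) + 2 * r < phi k A < snd (st (p, t) k) - 2 * r).
  { clearbody ks. induction ks as [|k ks (r & Hr & IH)].
    - exists 1. split; [lra|]. intros k [].
    - specialize (HA k). change (refine (state (snd p) n) (schedule n) t k) with (st (p, t) k) in HA.
      set (a := fst (st (p, t) k)) in *. set (b := snd (st (p, t) k)) in *.
      set (r' := Rmin (phi k A - a) (b - phi k A) / 3).
      assert (0 < r') by (unfold r'; apply Rdiv_lt_0_compat; [apply Rmin_glb_lt; lra|lra]).
      assert (r' <= (phi k A - a) / 3 /\ r' <= (b - phi k A) / 3).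
      { unfold r'. pose proof (Rmin_l (phi k A - a) (b - phi k A)).
        pose proof (Rmin_r (phi k A - a) (b - phi k A)). lra. }
      exists (Rmin r r'). split; [apply Rmin_glb_lt; auto|].
      pose proof (Rmin_l r r'). pose proof (Rmin_r r r').
      intros j [<-|Hj]; [fold a b; lra|]. specialize (IH j Hj). lra. }
  destruct Hmar as (r & Hr & Hmar).
  pose proof (rho_open A QA ks r Hr) as (F1 & d1 & Hd1 & HO).
  assert (He : ev (addc (cn n)) D1 (p, t) (fun z => forall k, In k ks ->
    Rabs (fst (st z k) - fst (st (p, t) k)) < r /\ Rabs (snd (st z k) - snd (st (p, t) k)) < r)).
  { apply ev_list. intros k _. destruct (Cst k) as [C1 C2].
    apply ev_and; [apply (C1 (p, t) I)|apply (C2 (p, t) I)]; auto. }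
  destruct He as (F2 & d2 & Hd2 & H2).
  exists (map inl F1 ++ flat_map (fun o => match o with Some k => k :: nil | None => nil end) F2),
    (Rmin d1 d2).
  split; [apply Rmin_glb_lt; auto|]. intros q t' [Pq Vq] Hc Ht.
  pose proof (Rmin_l d1 d2). pose proof (Rmin_r d1 d2).
  destruct (HO (fst q) Pq) as (A' & QA' & rA' & HA').
  { rewrite rA. intros k Hk. eapply Rlt_le_trans; [apply (Hc (inl k))|]; auto.
    apply in_or_app. left. apply in_map. exact Hk. }
  assert (H3 : forall k, In k ks -> Rabs (fst (st (q, t') k) - fst (st (p, t) k)) < r /\
    Rabs (snd (st (q, t') k) - snd (st (p, t) k)) < r).
  { apply (H2 (q, t') I). intros [j|] Hj; simpl; [|lra].
    eapply Rlt_le_trans; [apply (Hc j)|auto]. apply in_or_app. right.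
    apply in_flat_map. exists (Some j). split; auto. left. reflexivity. }
  exists A'. split; [|split]; auto. intros k. change (refine _ _ _) with (st (q, t')).
  destruct (classic (In k ks)) as [Hk|Hk].
  - destruct (H3 k Hk) as [B1 B2]. specialize (HA' k Hk). specialize (Hmar k Hk).
    apply Rabs_def2 in HA', B1, B2. lra.
  - unfold st. rewrite refine_other, state_unasked; [apply phi01| |].
    + intros m Hm E. apply Hk, in_map_iff. exists m. split; auto. apply in_seq. lia.
    + intros E. apply Hk, in_map_iff. exists n. split; auto. apply in_seq. lia.
Qed.

Lemma Nxt_intro n p A t : XQ A -> rho A = fst p -> inbox A (state (snd p) n) ->
  low (phi (schedule n) A) (state (snd p) n (schedule n)) < t < phi (schedule n) A -> Nxt n p t.
Proof.
  intros QA rA IA Ht. exists A. split; [|split]; auto.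
  apply inbox_refine. split; auto. apply step_iff; auto.
Qed.

(** If the first set has its value above t, it serves for t as well, since its lower bound is below
    t1 <= t. Otherwise t separates the values of the two sets, and connectedness yields a set whose
    value is just above t. *)
Lemma Nxt_conv n p t1 t2 t : Dom n p -> Nxt n p t1 -> Nxt n p t2 -> t1 <= t <= t2 -> Nxt n p t.
Proof.
  intros [Pp _] (A1 & Q1 & r1 & I1) (A2 & Q2 & r2 & I2) Ht.
  set (b := state (snd p) n) in *. set (k := schedule n) in *.
  apply inbox_refine in I1. apply inbox_refine in I2.
  destruct I1 as [J1 K1]. destruct I2 as [J2 K2].
  pose proof (J1 k) as B1. pose proof (J2 k) as B2.
  apply (step_iff _ (b k)) in K1; auto. apply (step_iff _ (b k)) in K2; auto.
  destruct (Rlt_dec t (phi k A1)) as [L|L].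
  { apply (Nxt_intro n p A1); auto. fold b k. lra. }
  destruct (Req_dec t t2) as [->|N].
  { apply (Nxt_intro n p A2); auto. }
  set (a0 := fst (b k)) in *. set (b0 := snd (b k)) in *.
  (* The factor 1/3 ensures that t + h does not exceed the value at [A2] and that [low] at t + h is
     below t, which requires 2h < t - a0 and 2h < b0 - t. *)
  set (h := Rmin (Rmin (t - a0) (b0 - t)) (phi k A2 - t) / 3).
  assert (h <= (t - a0) / 3 /\ h <= (b0 - t) / 3 /\ h <= (phi k A2 - t) / 3 /\ 0 < h) as (h1 & h2 & h3 & h4).
  { unfold h. pose proof (Rmin_l (Rmin (t - a0) (b0 - t)) (phi k A2 - t)).
    pose proof (Rmin_r (Rmin (t - a0) (b0 - t)) (phi k A2 - t)).
    pose proof (Rmin_l (t - a0) (b0 - t)). pose proof (Rmin_r (t - a0) (b0 - t)).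
    repeat split; try lra. apply Rdiv_lt_0_compat; [|lra]. repeat apply Rmin_glb_lt; lra. }
  destruct (phi_conn A1 A2 k (t + h)) as (A & QA & rA & EA & HA); auto; [congruence|lra|].
  assert (JA : inbox A b).
  { intros j. specialize (HA j). specialize (J1 j). specialize (J2 j).
    revert HA. unfold Rmin, Rmax. repeat destruct Rle_dec; lra. }
  apply (Nxt_intro n p A); auto; [congruence|]. fold b k.
  rewrite EA. unfold low. fold a0 b0. split; [apply Rmax_lub_lt|]; lra.
Qed.

Lemma Nxt_ne n p : Dom n p -> exists t, Nxt n p t.
Proof.
  intros [Pp (A & QA & rA & IA)]. set (b := state (snd p) n) in *. set (k := schedule n) in *.
  pose proof (low_lt _ _ (IA k)) as L.
  exists ((low (phi k A) (b k) + phi k A) / 2).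
  apply (Nxt_intro n p A); auto. fold b k. lra.
Qed.

Definition fibn (n : nat) := fib (T * (nat -> R)) (ent _ (cn n)) (Dom n) (Nxt n).
Definition fibninv (n : nat) := fibinv (T * (nat -> R)) (ent _ (cn n)) (Dom n) (Nxt n).

Lemma fibn_inv_spec n p y : Dom n p -> Nxt n p (fibninv n p y) /\ fibn n p (fibninv n p y) = y.
Proof.
  apply (fibinv_spec _ _ (cn n)); intros;
  eauto using ent_refl, ent_sym, ent_tri, ent_of_close, close_of_ent, Nxt_open, Nxt_conv, Nxt_ne.
Qed.

Lemma fibn_inv_fibn n p t : Dom n p -> Nxt n p t -> fibninv n p (fibn n p t) = t.
Proof.
  apply (fibinv_fib _ _ (cn n)); intros;
  eauto using ent_refl, ent_sym, ent_tri, ent_of_close, close_of_ent, Nxt_open, Nxt_conv, Nxt_ne.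
Qed.

Lemma fibn_cts n : cts (addc (cn n)) (OD _ (Dom n) (Nxt n)) (fun z => fibn n (fst z) (snd z)).
Proof.
  apply fib_cts; intros;
  eauto using ent_refl, ent_sym, ent_tri, ent_of_close, close_of_ent, Nxt_open, Nxt_conv, Nxt_ne.
Qed.

Lemma fibninv_cts n : cts (addc (cn n)) (fun z => Dom n (fst z)) (fun z => fibninv n (fst z) (snd z)).
Proof.
  apply fibinv_cts; intros;
  eauto using ent_refl, ent_sym, ent_tri, ent_of_close, close_of_ent, Nxt_open, Nxt_conv, Nxt_ne.
Qed.

Lemma fibninv_ext n B x x' y : Dom n (B, x) -> (forall k, (k < n)%nat -> x k = x' k) ->
  fibninv n (B, x) y = fibninv n (B, x') y.
Proof.
  intros HD Hx. pose proof (state_ext _ _ _ Hx) as E.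
  apply (fibinv_indep _ _ (cn n)); intros;
  eauto using ent_refl, ent_sym, ent_tri, ent_of_close, close_of_ent, Nxt_open, Nxt_conv, Nxt_ne.
  - unfold Nxt. simpl. rewrite E. tauto.
  - intros k _. simpl. destruct (Nat.ltb_spec k n); [rewrite Hx by auto|];
      rewrite !Rminus_diag, Rabs_R0; lra.
  - destruct HD as [H1 H2]. split; auto. unfold valid in *. simpl in *. rewrite <- E. exact H2.
Qed.

(** The boxes are carried along to make the recursion structural; the result is [state (enc A y)].
    The free real [y n] fixes the relative position of the n-th guess in its admissible interval. *)
Fixpoint encst (A : T) (y : nat -> R) (n : nat) : box :=
  match n with
  | O => fun _ => (0, 1)
  | S n => let b := encst A y n in let t := phi (schedule n) A in
           let l := low t (b (schedule n)) in
           refine b (schedule n) (l + (t - l) * squash (y n))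
  end.

Definition enc (A : T) (y : nat -> R) (n : nat) : R :=
  let t := phi (schedule n) A in let l := low t (encst A y n (schedule n)) in
  l + (t - l) * squash (y n).

Definition dec (A : T) (x : nat -> R) (n : nat) : R :=
  let t := phi (schedule n) A in let l := low t (state x n (schedule n)) in
  unsquash ((x n - l) / (t - l)).

Lemma state_enc A y n : state (enc A y) n = encst A y n.
Proof. induction n as [|n IH]; simpl; auto. rewrite IH. reflexivity. Qed.

Lemma enc_low A y n : enc A y n = let t := phi (schedule n) A in
  let l := low t (state (enc A y) n (schedule n)) in l + (t - l) * squash (y n).
Proof. rewrite state_enc. reflexivity. Qed.

Lemma inbox_init A : inbox A (fun _ => (0, 1)).
Proof. intros k. apply phi01. Qed.

Lemma inbox_enc A y n : inbox A (state (enc A y) n).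
Proof.
  induction n as [|n IH]; [apply inbox_init|]. simpl. apply inbox_refine. split; auto.
  apply step_iff; [apply IH|]. rewrite enc_low. cbv zeta.
  pose proof (low_lt _ _ (IH (schedule n))). pose proof (squash_bounds (y n)).
  set (l := low _ _) in *. set (t := phi _ _) in *. split; nra.
Qed.

Lemma inbox_step A x n : inbox A (state x n) -> inbox A (state x (S n)) ->
  low (phi (schedule n) A) (state x n (schedule n)) < x n < phi (schedule n) A.
Proof.
  intros H1 H2. simpl in H2. apply inbox_refine in H2. destruct H2 as [_ H2].
  apply step_iff in H2; auto.
Qed.

Lemma dec_enc A y : dec A (enc A y) = y.
Proof.
  apply functional_extensionality. intros n. unfold dec. cbv zeta.
  rewrite (enc_low A y n). cbv zeta. pose proof (low_lt _ _ (inbox_enc A y n (schedule n))).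
  set (l := low _ _) in *. set (t := phi _ _) in *.
  replace ((l + (t - l) * squash (y n) - l) / (t - l)) with (squash (y n)) by (field; lra).
  apply unsquash_squash.
Qed.

Lemma enc_dec A x : (forall n, inbox A (state x n)) -> enc A (dec A x) = x.
Proof.
  intros H. assert (E : forall n, encst A (dec A x) n = state x n /\ enc A (dec A x) n = x n).
  { assert (S1 : forall n, encst A (dec A x) n = state x n -> enc A (dec A x) n = x n).
    { intros n IH. unfold enc. rewrite IH. unfold dec. cbv zeta.
      pose proof (inbox_step A x n (H n) (H (S n))) as L.
      set (l := low _ _) in *. set (t := phi _ _) in *. rewrite squash_unsquash; [field; lra|].
      split; [apply Rdiv_lt_0_compat; lra|].
      apply Rmult_lt_reg_r with (t - l); [lra|]. unfold Rdiv.
      rewrite Rmult_assoc, Rinv_l by lra. lra. }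
    induction n as [|n [IH1 IH2]]; [split; auto|].
    assert (encst A (dec A x) (S n) = state x (S n)); [|split; auto].
    simpl. rewrite IH1. unfold enc in IH2. rewrite IH1 in IH2. cbv zeta in IH2.
    rewrite IH2. reflexivity. }
  apply functional_extensionality. intros n. apply E.
Qed.

Definition pc := prodc phi (@seqc nat).

Lemma enc_cts n : cts pc (fun p => XQ (fst p)) (fun p => enc (fst p) (snd p) n).
Proof.
  induction n as [n IH] using lt_wf_ind.
  destruct (cts_state pc (fun p => XQ (fst p)) (fun p => enc (fst p) (snd p)) n (schedule n) IH) as [C1 C2].
  assert (Ct : cts pc (fun p => XQ (fst p)) (fun p => phi (schedule n) (fst p)))
    by apply (cts_coord _ _ pc _ (inl (schedule n))).
  apply cts_ext with (fun p => let t := phi (schedule n) (fst p) in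
    let l := low t (state (enc (fst p) (snd p)) n (schedule n)) in l + (t - l) * squash (snd p n)).
  { intros p _. rewrite (enc_low (fst p)). reflexivity. }
  cbv zeta.
  assert (Cl : cts pc (fun p => XQ (fst p)) (fun p => low (phi (schedule n) (fst p)) (state (enc (fst p) (snd p)) n (schedule n)))).
  { unfold low. apply cts_max; [|apply cts_minus; auto; apply cts_scal; auto].
    apply (cts_ext _ _ pc _ (fun p => / 3 * (2 * phi (schedule n) (fst p) +
       fst (state (enc (fst p) (snd p)) n (schedule n))))); [intros; field|].
    apply cts_scal, cts_plus; auto. apply cts_scal; auto. }
  apply cts_plus; auto. apply cts_mult; [apply cts_minus; auto|].
  apply cts_squash. apply (cts_coord _ _ pc _ (inr n)).
Qed.

(** [enc] places the guesses relative to A; [fibn] then reads them against all sets over [rho A].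
    The resulting numbers are unconstrained, and together with [rho A] they determine A. *)
Definition fwd (A : T) (y : nat -> R) (n : nat) : R := fibn n (rho A, enc A y) (enc A y n).

Lemma Dom_enc A y n : XQ A -> Dom n (rho A, enc A y).
Proof.
  intros QA. split; [apply rhoP; auto|]. exists A. split; [|split]; auto; apply inbox_enc.
Qed.

Lemma Nxt_enc A y n : XQ A -> Nxt n (rho A, enc A y) (enc A y n).
Proof. intros QA. exists A. split; [|split]; auto; apply (inbox_enc A y (S n)). Qed.

Lemma fwd_cts n : cts pc (fun p => XQ (fst p)) (fun p => fwd (fst p) (snd p) n).
Proof.
  unfold fwd.
  apply (cts_comp pc (fun p => XQ (fst p)) (addc (cn n)) (OD _ (Dom n) (Nxt n))
    (fun p => ((rho (fst p), enc (fst p) (snd p)), enc (fst p) (snd p) n))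
    (fun z => fibn n (fst z) (snd z))).
  - apply fibn_cts.
  - intros p Qp. split; simpl; [apply Dom_enc|apply Nxt_enc]; auto.
  - intros [[k|k]|]; simpl.
    + apply (cts_comp pc _ phi XQ fst (fun A => phi k (rho A))); auto.
      intros j. apply (cts_coord _ _ pc _ (inl j)).
    + destruct (Nat.ltb k n); [apply enc_cts|apply cts_const].
    + apply enc_cts.
Qed.

(** * Recovering the guesses, and then the set, from the trivialized data *)

Fixpoint pre (B : T) (z : nat -> R) (n : nat) : nat -> R :=
  match n with
  | O => fun _ => 0
  | S n => fun k => if Nat.eqb k n then fibninv n (B, pre B z n) (z n) else pre B z n k
  end.

Definition xs (B : T) (z : nat -> R) (n : nat) : R := fibninv n (B, pre B z n) (z n).

Lemma pre_xs B z n k : (k < n)%nat -> pre B z n k = xs B z k.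
Proof.
  induction n as [|n IH]; intros H; [lia|]. simpl. destruct (Nat.eqb_spec k n) as [->|N].
  - reflexivity.
  - apply IH. lia.
Qed.

Lemma Dom_xs B z n : XP B -> Dom n (B, xs B z).
Proof.
  intros PB. split; auto. simpl. induction n as [|n (A & QA & rA & IA)].
  - exists B. split; [|split]; auto; intros k; apply phi01.
  - destruct (fibn_inv_spec n (B, pre B z n) (z n)) as [(A' & QA' & rA' & IA') _].
    + split; auto. exists A. rewrite (state_ext _ (xs B z)) by apply pre_xs. auto.
    + exists A'. simpl in *. rewrite (state_ext _ (xs B z)) in IA' by apply pre_xs. auto.
Qed.

(** [pre] puts 0 for guesses not yet made. As [fibninv n] sees the first n guesses alone, the
    finished sequence can be substituted, which gives the recursion used for continuity. *)
Lemma xs_eq B z n : XP B -> xs B z n = fibninv n (B, xs B z) (z n).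
Proof.
  intros PB. unfold xs at 1. symmetry. apply fibninv_ext; [apply Dom_xs; auto|].
  intros k Hk. symmetry. apply pre_xs. auto.
Qed.

Lemma xs_cts n : cts pc (fun p => XP (fst p)) (fun p => xs (fst p) (snd p) n).
Proof.
  induction n as [n IH] using lt_wf_ind.
  apply cts_ext with (fun p => fibninv n (fst p, xs (fst p) (snd p)) (snd p n)).
  { intros p Pp. symmetry. apply xs_eq. auto. }
  apply (cts_comp pc (fun p => XP (fst p)) (addc (cn n)) (fun z => Dom n (fst z))
    (fun p => ((fst p, xs (fst p) (snd p)), snd p n))
    (fun z => fibninv n (fst z) (snd z))).
  - apply fibninv_cts.
  - intros p Pp. apply Dom_xs. auto.
  - intros [[k|k]|]; simpl.
    + apply (cts_coord _ _ pc _ (inl k)).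
    + destruct (Nat.ltb_spec k n); [apply IH; auto|apply cts_const].
    + apply (cts_coord _ _ pc _ (inr n)).
Qed.

Lemma state_nested x n m A k : (n <= m)%nat -> inbox A (state x m) ->
  fst (state x n k) <= fst (state x m k) /\ snd (state x m k) <= snd (state x n k).
Proof.
  intros L. induction L as [|m L IH]; intros H; [lra|]. simpl in *.
  pose proof H as H'. apply inbox_refine in H'. destruct H' as [H1 H2].
  destruct (IH H1) as [I1 I2]. destruct (Nat.eq_dec k (schedule m)) as [->|N].
  - rewrite refine_same. simpl. apply step_in in H2. lra.
  - rewrite refine_other; auto.
Qed.

(** The witnesses of the successive stages are different sets. Nested boxes of vanishing width make
    every functional converge along them, and [phi_lim] supplies a limit in the same fibre. *)
Lemma limit_exists B x : XP B -> (forall n, valid n B x) ->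
  exists A, XQ A /\ rho A = B /\ forall n, inbox A (state x n).
Proof.
  intros PB H. apply choice in H. destruct H as (As & HAs).
  assert (Nest : forall k n m, (n <= m)%nat ->
    fst (state x n k) < phi k (As m) < snd (state x n k)).
  { intros k n m L. destruct (HAs m) as (_ & _ & I).
    destruct (state_nested x n m (As m) k L I). specialize (I k). lra. }
  assert (Cau : forall k, Cauchy_crit (fun n => phi k (As n))).
  { intros k e He. destruct (width_small k e He) as (N & HN). exists N.
    intros n m Hn Hm. pose proof (Nest k N n Hn). pose proof (Nest k N m Hm).
    specialize (HN x N (le_n N)). unfold width in HN. apply Rabs_def1; lra. }
  assert (Lim : forall k, exists l, Un_cv (fun n => phi k (As n)) l).
  { intros k. destruct (R_complete _ (Cau k)) as (l & Hl). exists l. exact Hl. }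
  apply choice in Lim. destruct Lim as (t & Ht).
  assert (Bd : forall k n, fst (state x n k) <= t k <= snd (state x n k)).
  { intros k n. split.
    - apply Rnot_lt_le. intros L. destruct (Ht k (fst (state x n k) - t k)) as (N & HN); [lra|].
      specialize (HN (max N n) (Nat.le_max_l _ _)). pose proof (Nest k n (max N n) (Nat.le_max_r _ _)).
      unfold Rdist in HN. apply Rabs_def2 in HN. lra.
    - apply Rnot_lt_le. intros L. destruct (Ht k (t k - snd (state x n k))) as (N & HN); [lra|].
      specialize (HN (max N n) (Nat.le_max_l _ _)). pose proof (Nest k n (max N n) (Nat.le_max_r _ _)).
      unfold Rdist in HN. apply Rabs_def2 in HN. lra. }
  (* Index k is refined again at some stage m >= n; the limit lies in the closure of that refined
     interval, which is inside the earlier open one. *)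
  assert (St : forall k n, fst (state x n k) < t k < snd (state x n k)).
  { intros k n. destruct (schedule_unbounded k n) as (m & L & E).
    destruct (HAs (S m)) as (_ & _ & I). pose proof I as I'. simpl in I'.
    apply inbox_refine in I'. destruct I' as [_ I']. rewrite E in I'.
    apply step_in in I'. destruct (state_nested x n (S m) _ k ltac:(lia) I) as [N1 N2].
    pose proof (Bd k (S m)) as B1. simpl in B1. rewrite E, refine_same in B1. simpl in B1.
    assert (Im : inbox (As (S m)) (state x m)) by (simpl in I; apply inbox_refine in I; apply I).
    destruct (state_nested x n m _ k L Im). lra. }
  destruct (phi_lim B As t PB) as (A & QA & rA & EA); auto.
  - intros n. destruct (HAs n) as (? & ? & _). auto.
  - intros k. apply (St k O).
  - exists A. split; [|split]; auto; intros n k; rewrite EA; apply St.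
Qed.

Definition bwdA (B : T) (z : nat -> R) : T :=
  epsilon (inhabits B) (fun A => XQ A /\ rho A = B /\ forall n, inbox A (state (xs B z) n)).

Lemma bwdA_spec B z : XP B -> XQ (bwdA B z) /\ rho (bwdA B z) = B /\
  forall n, inbox (bwdA B z) (state (xs B z) n).
Proof.
  intros PB. unfold bwdA. apply epsilon_spec. apply limit_exists; auto.
  intros n. apply (Dom_xs B z n PB).
Qed.

Definition bwdy (B : T) (z : nat -> R) : nat -> R := dec (bwdA B z) (xs B z).

Lemma inbox_unique A A' x : XQ A -> XQ A' -> (forall n, inbox A (state x n)) ->
  (forall n, inbox A' (state x n)) -> A = A'.
Proof.
  intros QA QA' H H'. apply phi_sep; auto. intros k.
  apply cond_eq. intros e He. destruct (width_small k e He) as (N & HN).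
  specialize (HN x N (le_n N)). unfold width in HN.
  specialize (H N k). specialize (H' N k). apply Rabs_def1; lra.
Qed.

Lemma xs_fwd A y : XQ A -> xs (rho A) (fwd A y) = enc A y.
Proof.
  intros QA. assert (E : forall n, forall k, (k < n)%nat -> xs (rho A) (fwd A y) k = enc A y k).
  { induction n as [|n IH]; intros k Hk; [lia|].
    destruct (Nat.eq_dec k n) as [->|N]; [|apply IH; lia].
    rewrite xs_eq by (apply rhoP; auto).
    rewrite (fibninv_ext n (rho A) _ (enc A y)); auto.
    - unfold fwd. apply fibn_inv_fibn; [apply Dom_enc|apply Nxt_enc]; auto.
    - apply Dom_xs, rhoP. auto. }
  apply functional_extensionality. intros k. apply (E (S k)). lia.
Qed.

Lemma bwdA_fwd A y : XQ A -> bwdA (rho A) (fwd A y) = A.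
Proof.
  intros QA. destruct (bwdA_spec (rho A) (fwd A y) (rhoP A QA)) as (Q & r & I).
  rewrite xs_fwd in I by auto. apply inbox_unique with (enc A y); auto. apply inbox_enc.
Qed.

Lemma bwdy_fwd A y : XQ A -> bwdy (rho A) (fwd A y) = y.
Proof. intros QA. unfold bwdy. rewrite bwdA_fwd, xs_fwd by auto. apply dec_enc. Qed.

Lemma fwd_bwd B z : XP B -> fwd (bwdA B z) (bwdy B z) = z.
Proof.
  intros PB. destruct (bwdA_spec B z PB) as (Q & r & I).
  apply functional_extensionality. intros n. unfold fwd, bwdy.
  rewrite enc_dec, r by auto. rewrite (xs_eq B z n PB).
  apply fibn_inv_spec, Dom_xs. auto.
Qed.

(** The lower ends of the N-th boxes are continuous and approximate the functional uniformly. *)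
Lemma bwdA_cts k : cts pc (fun p => XP (fst p)) (fun p => phi k (bwdA (fst p) (snd p))).
Proof.
  apply cts_unif. intros e He. destruct (width_small k e He) as (N & HN).
  exists (fun p => fst (state (xs (fst p) (snd p)) N k)). split.
  - apply cts_state. intros. apply xs_cts.
  - intros [B z] PB. simpl in *. destruct (bwdA_spec B z PB) as (_ & _ & I).
    specialize (I N k). specialize (HN (xs B z) N (le_n N)). unfold width in HN.
    apply Rlt_le, Rabs_def1; lra.
Qed.

Lemma bwdy_cts n : cts pc (fun p => XP (fst p)) (fun p => bwdy (fst p) (snd p) n).
Proof.
  unfold bwdy, dec. cbv zeta.
  destruct (cts_state pc (fun p => XP (fst p)) (fun p => xs (fst p) (snd p)) n (schedule n)
    (fun m _ => xs_cts m)) as [C1 C2].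
  pose proof (bwdA_cts (schedule n)) as Ct.
  assert (Cl : cts pc (fun p => XP (fst p)) (fun p => low (phi (schedule n) (bwdA (fst p) (snd p)))
    (state (xs (fst p) (snd p)) n (schedule n)))).
  { unfold low. apply cts_max; [|apply cts_minus; auto; apply cts_scal; auto].
    apply (cts_ext _ _ pc _ (fun p => / 3 * (2 * phi (schedule n) (bwdA (fst p) (snd p)) +
       fst (state (xs (fst p) (snd p)) n (schedule n))))); [intros; field|].
    apply cts_scal, cts_plus; auto. apply cts_scal; auto. }
  assert (Hb : forall p, XP (fst p) -> let A := bwdA (fst p) (snd p) in let x := xs (fst p) (snd p) in
    low (phi (schedule n) A) (state x n (schedule n)) < x n < phi (schedule n) A).
  { intros p Pp. destruct (bwdA_spec (fst p) (snd p) Pp) as (_ & _ & I).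
    apply inbox_step; apply I. }
  apply cts_unsquash.
  - apply cts_div; [apply cts_minus; auto; apply xs_cts|apply cts_minus; auto|].
    intros p Pp. specialize (Hb p Pp). simpl in Hb. lra.
  - intros p Pp. specialize (Hb p Pp). simpl in Hb. split; [apply Rdiv_lt_0_compat; lra|].
    set (l := low _ _) in *. set (t := phi _ _) in *.
    apply Rmult_lt_reg_r with (t - l); [lra|]. unfold Rdiv. rewrite Rmult_assoc, Rinv_l by lra. lra.
Qed.

End Local.

(** * Compact sets of points and max-plus functionals *)

Lemma exists_ultrafilter {X : Type} (F : (X -> Prop) -> Prop) :
  F (fun _ => True) -> (forall P Q : X -> Prop, F P -> F Q -> F (fun x => P x /\ Q x)) ->
  (forall P Q : X -> Prop, (forall x, P x -> Q x) -> F P -> F Q) ->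
  ~ F (fun _ => False) ->
  exists G : (X -> Prop) -> Prop, (forall P, F P -> G P) /\
    (forall P Q : X -> Prop, G P -> G Q -> G (fun x => P x /\ Q x)) /\
    (forall P Q : X -> Prop, (forall x, P x -> Q x) -> G P -> G Q) /\
    ~ G (fun _ => False) /\ (forall P, G P \/ G (fun x => ~ P x)).
Proof.
  intros HT HI HS H0.
  assert (FF : filter.ProperFilter F).
  { exact (@filter.Build_ProperFilter X F H0 (@filter.Build_Filter X F HT HI HS)). }
  destruct (@filter.ultraFilterLemma X F FF) as (G & UG & HFG).
  exists G. pose proof (@filter.filter_filter _ _ (@filter.ultra_proper _ _ UG)) as GF.
  split; [exact HFG|]. split; [exact (@filter.filterI _ _ GF)|].
  split; [exact (@filter.filterS _ _ GF)|].
  split; [exact (@filter.filter_not_empty _ _ (@filter.ultra_proper _ _ UG))|].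
  intros P. exact (@filter.in_ultra_setVsetC _ _ P UG).
Qed.

Lemma list_max_exists {X : Type} (g : X -> R) (l : list X) x0 : In x0 l ->
  exists m, In m l /\ forall x, In x l -> g x <= g m.
Proof.
  revert x0. induction l as [|y l IH]; intros x0 H; [destruct H|].
  destruct l as [|z l].
  - exists y. split; [left; auto|]. intros x [<-|[]]. lra.
  - destruct (IH z) as (m & Hm & HM); [left; auto|].
    destruct (Rle_dec (g m) (g y)) as [L|L].
    + exists y. split; [left; auto|]. intros x [<-|Hx]; [lra|]. specialize (HM x Hx). lra.
    + exists m. split; [right; auto|]. intros x [<-|Hx]; [lra|]. apply HM; auto.
Qed.

Section Points.
Variable I : Type.
Notation pt := (I -> R).

Definition ball (F : list I) (e : R) (c y : pt) : Prop :=
  forall i, In i F -> Rabs (y i - c i) < e.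

Lemma ball_open F e c : prod_open I (ball F e c).
Proof.
  intros x Hx. exists F. induction F as [|i F IH].
  - exists 1. split; [lra|]. intros y _ i [].
  - destruct IH as (d & Hd & H). { intros j Hj. apply Hx. right. auto. }
    assert (Hi : Rabs (x i - c i) < e) by (apply Hx; left; auto).
    exists (Rmin d (e - Rabs (x i - c i))). split; [apply Rmin_glb_lt; lra|].
    pose proof (Rmin_l d (e - Rabs (x i - c i))). pose proof (Rmin_r d (e - Rabs (x i - c i))).
    intros y Hy j [<-|Hj].
    + pose proof (Hy i (or_introl eq_refl)).
      replace (y i - c i) with ((y i - x i) + (x i - c i)) by ring.
      eapply Rle_lt_trans; [apply Rabs_triang|]. lra.
    + apply H; auto. intros k Hk. pose proof (Hy k (or_intror Hk)). lra.
Qed.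

Definition pclosed (A : pt -> Prop) : Prop :=
  forall z, (forall F e, 0 < e -> exists a, A a /\ ball F e z a) -> A z.

Definition pbounded (A : pt -> Prop) : Prop :=
  forall i, exists M, forall a, A a -> Rabs (a i) <= M.

Lemma ball_self F e c : 0 < e -> ball F e c c.
Proof. intros He i _. rewrite Rminus_diag, Rabs_R0. exact He. Qed.

Lemma pclosed_compl_open A : pclosed A -> prod_open I (fun z => ~ A z).
Proof.
  intros HA z Nz. apply NNPP. intros N. apply Nz, HA. intros F e He.
  apply NNPP. intros N2. apply N. exists F, e. split; auto.
  intros y Hy Ay. apply N2. exists y. auto.
Qed.

Lemma pclosed_and A B : pclosed A -> pclosed B -> pclosed (fun z => A z /\ B z).
Proof.
  intros HA HB z H. split; [apply HA|apply HB]; intros F e He;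
  destruct (H F e He) as (a & [? ?] & ?); eauto.
Qed.

Lemma pclosed_all {J : Type} (C : J -> pt -> Prop) :
  (forall j, pclosed (C j)) -> pclosed (fun z => forall j, C j z).
Proof.
  intros HC z H j. apply HC. intros F e He. destruct (H F e He) as (a & ? & ?). eauto.
Qed.

Lemma compact_bounded A : compact_in (prod_open I) A -> pbounded A.
Proof.
  intros HA i. destruct (HA R (fun M y => Rabs (y i) < M)) as (F & HF).
  - intros M x Hx. exists (i :: nil), (M - Rabs (x i)). split; [lra|].
    intros y Hy. pose proof (Hy i (or_introl eq_refl)).
    replace (y i) with ((y i - x i) + x i) by ring.
    eapply Rle_lt_trans; [apply Rabs_triang|]. lra.
  - intros x _. exists (Rabs (x i) + 1). lra.
  - destruct F as [|M0 F].
    + exists 0. intros a Ha. destruct (HF a Ha) as (? & [] & _).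
    + destruct (list_max_exists (fun r => r) (M0 :: F) M0) as (M & _ & HM); [left; auto|].
      exists M. intros a Ha. destruct (HF a Ha) as (m & Hm & L). specialize (HM m Hm). simpl in HM. lra.
Qed.

Lemma compact_closed A : compact_in (prod_open I) A -> pclosed A.
Proof.
  intros HA z Hz. apply NNPP. intros Nz.
  destruct (HA (I * R)%type (fun ir y => 0 < snd ir /\ snd ir < Rabs (y (fst ir) - z (fst ir)))) as (F & HF).
  - intros [i r] x [Hr Hx]. simpl in *. exists (i :: nil), (Rabs (x i - z i) - r).
    split; [lra|]. intros y Hy. split; auto. pose proof (Hy i (or_introl eq_refl)) as H.
    pose proof (Rabs_triang (x i - y i) (y i - z i)) as T.
    replace (x i - y i + (y i - z i)) with (x i - z i) in T by ring.
    rewrite Rabs_minus_sym in H. lra.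
  - intros x Ax. assert (N : exists i, x i <> z i).
    { apply NNPP. intros N. apply Nz. replace z with x; auto.
      apply functional_extensionality. intros i. apply NNPP. intros N'. apply N. exists i. auto. }
    destruct N as (i & Hi). assert (0 < Rabs (x i - z i)) by (apply Rabs_pos_lt; lra).
    exists (i, Rabs (x i - z i) / 2). simpl. lra.
  - assert (He : exists e, 0 < e /\ forall ir, In ir F -> 0 < snd ir -> e <= snd ir).
    { clear HF. induction F as [|[i r] F (e & He & IH)].
      - exists 1. split; [lra|]. intros ? [].
      - destruct (Rlt_dec 0 r) as [L|L].
        + exists (Rmin e r). split; [apply Rmin_glb_lt; auto|]. intros ir [<-|H] Hp.
          * apply Rmin_r.
          * specialize (IH ir H Hp). pose proof (Rmin_l e r). lra.
        + exists e. split; auto. intros ir [<-|H] Hp; [simpl in Hp; lra|auto]. }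
    destruct He as (e & He & HeF). destruct (Hz (map fst F) e He) as (a & Aa & Ha).
    destruct (HF a Aa) as ([i r] & Hin & Hr & Hlt). simpl in *.
    specialize (HeF _ Hin Hr). simpl in HeF.
    assert (In i (map fst F)) by (apply in_map_iff; exists (i, r); auto).
    specialize (Ha i H). lra.
Qed.

Lemma ultra_limit (G : (pt -> Prop) -> Prop) i M :
  (forall P Q : pt -> Prop, G P -> G Q -> G (fun x => P x /\ Q x)) ->
  (forall P Q : pt -> Prop, (forall x, P x -> Q x) -> G P -> G Q) ->
  ~ G (fun _ => False) -> (forall P, G P \/ G (fun x => ~ P x)) ->
  G (fun a => Rabs (a i) <= M) ->
  exists l, forall e, 0 < e -> G (fun a => Rabs (a i - l) < e).
Proof.
  intros GI GS G0 GU GM.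
  destruct (completeness (fun t => G (fun a => t <= a i))) as (l & Hub & Hlub).
  - exists M. intros t Ht. apply NNPP. intros N. apply G0.
    apply (GS (fun a => t <= a i /\ Rabs (a i) <= M)); auto.
    intros a [H1 H2]. pose proof (Rle_abs (a i)). lra.
  - exists (- M). apply (GS (fun a => Rabs (a i) <= M)); auto.
    intros a H. pose proof (Rle_abs (- a i)). rewrite Rabs_Ropp in H0. lra.
  - exists l. intros e He.
    assert (H1 : G (fun a => l - e / 2 <= a i)).
    { apply NNPP. intros N. enough (l <= l - e/2) by lra. apply Hlub. intros t Ht.
      apply Rnot_lt_le. intros L. apply N. apply (GS (fun a => t <= a i)); auto.
      intros a Ha. lra. }
    assert (H2 : G (fun a => ~ l + e / 2 <= a i)).
    { destruct (GU (fun a => l + e / 2 <= a i)) as [H|H]; auto.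
      apply Hub in H. lra. }
    apply (GS (fun a => l - e/2 <= a i /\ ~ l + e/2 <= a i)); auto.
    intros a [L1 L2]. apply Rabs_def1; lra.
Qed.

(** Tychonoff's theorem by ultrafilters: without a finite subcover, the sets containing A minus
    finitely many members of the cover form a proper filter. A finer ultrafilter converges in every
    bounded coordinate, its limit lies in the closed set A, and the member of the cover around that
    limit gives the contradiction. *)
Lemma closed_bounded_compact A : pclosed A -> pbounded A -> compact_in (prod_open I) A.
Proof.
  intros HC HB J U HU Hcov. apply NNPP. intros N.
  set (F := fun P : pt -> Prop => exists js : list J,
    forall a, A a -> (forall j, In j js -> ~ U j a) -> P a).
  destruct (exists_ultrafilter F) as (G & HF & GI & GS & G0 & GU).
  - exists nil. auto.
  - intros P Q (l & Hl) (l' & Hl'). exists (l ++ l'). intros a Aa Ha.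
    split; [apply Hl|apply Hl']; auto; intros j Hj; apply Ha, in_or_app; auto.
  - intros P Q HPQ (l & Hl). exists l. auto.
  - intros (l & Hl). apply N. exists l. intros a Aa. apply NNPP. intros N2.
    apply (Hl a Aa). intros j Hj Uj. apply N2. exists j. auto.
  - assert (GA : G A) by (apply HF; exists nil; auto).
    assert (L : forall i, exists l, forall e, 0 < e -> G (fun a => Rabs (a i - l) < e)).
    { intros i. destruct (HB i) as (M & HM). apply (ultra_limit G i M); auto.
      apply (GS A); auto. }
    apply choice in L. destruct L as (c & Hc).
    assert (Gb : forall F e, 0 < e -> G (ball F e c)).
    { intros F' e He. induction F' as [|i F' IH].
      - apply (GS A); auto. intros x _ i [].
      - apply (GS (fun a => Rabs (a i - c i) < e /\ ball F' e c a)); auto.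
        intros x [H1 H2] j [<-|Hj]; auto. }
    assert (Ac : A c).
    { apply HC. intros F' e He. apply NNPP. intros N2. apply G0.
      apply (GS (fun a => A a /\ ball F' e c a)); auto.
      intros x Hx. apply N2. exists x. auto. }
    destruct (Hcov c Ac) as (j & Hj). destruct (HU j c Hj) as (F' & e & He & Hb).
    apply G0. apply (GS (fun a => (~ U j a) /\ ball F' e c a)).
    + intros x [H1 H2]. apply H1, Hb. exact H2.
    + apply GI; auto. apply HF. exists (j :: nil). intros a _ H. apply H. left. auto.
Qed.

Lemma compact_fip A (J : Type) (C : J -> pt -> Prop) :
  compact_in (prod_open I) A -> (forall j, pclosed (C j)) ->
  (forall js : list J, exists a, A a /\ forall j, In j js -> C j a) ->
  exists a, A a /\ forall j, C j a.
Proof.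
  intros HA HC Hf. apply NNPP. intros N.
  destruct (HA J (fun j z => ~ C j z)) as (js & Hjs).
  - intros j. apply pclosed_compl_open. auto.
  - intros x Ax. apply NNPP. intros N2. apply N. exists x. split; auto.
    intros j. apply NNPP. intros N3. apply N2. exists j. auto.
  - destruct (Hf js) as (a & Aa & Ha). destruct (Hjs a Aa) as (j & Hj & Nj). auto.
Qed.

Lemma totally_bounded A F d : compact_in (prod_open I) A -> 0 < d ->
  exists cs : list pt, forall a, A a -> exists c, In c cs /\ A c /\ ball F d c a.
Proof.
  intros HA Hd. destruct (HA pt (fun c y => A c /\ ball F d c y)) as (cs & H).
  - intros c x [Ac Hx]. destruct (ball_open F d c x Hx) as (G & e & He & HG).
    exists G, e. split; auto.
  - intros x Ax. exists x. split; auto. apply ball_self; auto.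
  - exists cs. intros a Aa. destruct (H a Aa) as (c & ? & ? & ?). eauto.
Qed.

Definition hat (a : pt) (o : option I) : R := match o with Some i => a i | None => 0 end.

Definition code : Type := option I * option I * list (option I * R).

(* [w (k, j, [(j1,q1);...;(jn,qn)]) a] is the minimum of [a_k - a_j] and of the
   [a_k - a_jl + ql], with the convention [a_None = 0]: the functionals that
   separate points from max-plus convex sets. *)
Definition w (f : code) (a : pt) : R :=
  fold_right (fun jq m => Rmin (hat a (fst (fst f)) - hat a (fst jq) + snd jq) m)
    (hat a (fst (fst f)) - hat a (snd (fst f))) (snd f).

Definition idx (f : code) : list (option I) := fst (fst f) :: snd (fst f) :: map fst (snd f).

Lemma w_ge f a r : r <= hat a (fst (fst f)) - hat a (snd (fst f)) ->
  (forall jq, In jq (snd f) -> r <= hat a (fst (fst f)) - hat a (fst jq) + snd jq) -> r <= w f a.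
Proof.
  destruct f as [[k j] l]. unfold w. simpl. intros H0 H. induction l as [|o l IH]; simpl; auto.
  apply Rmin_glb; [apply H; left; reflexivity|]. apply IH. intros jq Hj. apply H. right. exact Hj.
Qed.

Lemma w_le_base f a : w f a <= hat a (fst (fst f)) - hat a (snd (fst f)).
Proof.
  destruct f as [[k j] l]. unfold w. simpl. induction l as [|o l IH]; simpl; [lra|].
  eapply Rle_trans; [apply Rmin_r|exact IH].
Qed.

Lemma w_le_elem f a jq : In jq (snd f) -> w f a <= hat a (fst (fst f)) - hat a (fst jq) + snd jq.
Proof.
  destruct f as [[k j] l]. unfold w. simpl. induction l as [|o l IH]; simpl; [tauto|].
  intros [->|H]; [apply Rmin_l|]. eapply Rle_trans; [apply Rmin_r|auto].
Qed.

Lemma w_shift f a b e :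
  (forall o, In o (idx f) -> hat b (fst (fst f)) - hat b o <= hat a (fst (fst f)) - hat a o + e) ->
  w f b <= w f a + e.
Proof.
  intros H. enough (w f b - e <= w f a) by lra. apply w_ge.
  - pose proof (w_le_base f b). pose proof (H (snd (fst f)) (or_intror (or_introl eq_refl))). lra.
  - intros jq Hj. pose proof (w_le_elem f b jq Hj).
    assert (Hi : In (fst jq) (idx f)) by (right; right; apply in_map; exact Hj).
    specialize (H _ Hi). lra.
Qed.

Definition comb1 (al : Rmaxplus) (x : R) (be : Rmaxplus) (y : R) : R :=
  match al, be with
  | Some s, Some t => Rmax (s + x) (t + y)
  | Some s, None => s + x
  | None, Some t => t + y
  | None, None => 0
  end.

(** The normalisation max(al, be) = 0 says exactly that the extra coordinate 0 is preserved by
    combinations. *)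
Lemma hat_comb al a be b o : rmp_max al be = Some 0 ->
  hat (mp_comb al a be b) o = comb1 al (hat a o) be (hat b o).
Proof.
  intros H. destruct o as [i|]; [reflexivity|]. simpl.
  destruct al as [s|], be as [t|]; simpl in *; try discriminate; injection H; intros E; try lra.
  rewrite !Rplus_0_r. symmetry. exact E.
Qed.

(** If the maximum at the leading coordinate k comes from a, all differences of the combination with
    leading index k are bounded by those of a, and likewise for b. Consequently sublevel sets of
    [w f] are max-plus convex. *)
Lemma w_comb f al a be b : rmp_max al be = Some 0 ->
  w f (mp_comb al a be b) <= Rmax (w f a) (w f b).
Proof.
  intros H. assert (HC : w f (mp_comb al a be b) <= w f a + 0 \/ w f (mp_comb al a be b) <= w f b + 0).
  { assert (HH := fun o => hat_comb al a be b o H).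
    destruct al as [s|], be as [t|]; simpl in H; try discriminate.
    - destruct (Rle_dec (t + hat b (fst (fst f))) (s + hat a (fst (fst f)))) as [L|L]; [left|right];
      apply w_shift; intros o _; rewrite !HH; simpl;
      pose proof (Rmax_l (s + hat a o) (t + hat b o)); pose proof (Rmax_r (s + hat a o) (t + hat b o)).
      + rewrite (Rmax_left (s + hat a (fst (fst f)))); lra.
      + rewrite (Rmax_right (s + hat a (fst (fst f)))); lra.
    - left. apply w_shift. intros o _. rewrite !HH. simpl. lra.
    - right. apply w_shift. intros o _. rewrite !HH. simpl. lra. }
  pose proof (Rmax_l (w f a) (w f b)). pose proof (Rmax_r (w f a) (w f b)). lra.
Qed.

Definition supp (f : code) : list I :=
  flat_map (fun o => match o with Some i => i :: nil | None => nil end) (idx f).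

Lemma in_supp f i : In (Some i) (idx f) -> In i (supp f).
Proof. intros H. apply in_flat_map. exists (Some i). split; auto. left. auto. Qed.

Lemma w_lip f a b e : 0 <= e -> (forall i, In i (supp f) -> Rabs (a i - b i) <= e) ->
  w f b <= w f a + 2 * e.
Proof.
  intros He H. apply w_shift.
  assert (Ho : forall o, In o (idx f) -> -e <= hat a o - hat b o <= e).
  { intros [i|] Ho; simpl; [|lra]. specialize (H i (in_supp f i Ho)).
    pose proof (Rle_abs (a i - b i)). pose proof (Rle_abs (- (a i - b i))).
    rewrite Rabs_Ropp in H1. lra. }
  intros o Io. pose proof (Ho o Io). pose proof (Ho (fst (fst f)) (or_introl eq_refl)). lra.
Qed.

Lemma w_ball f e c : 0 < e -> forall y, ball (supp f) (e/4) c y -> Rabs (w f y - w f c) < e.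
Proof.
  intros He y Hy.
  assert (L1 : w f y <= w f c + 2 * (e/4)).
  { apply w_lip; [lra|]. intros i Hi. rewrite Rabs_minus_sym. apply Rlt_le, Hy, Hi. }
  assert (L2 : w f c <= w f y + 2 * (e/4)).
  { apply w_lip; [lra|]. intros i Hi. apply Rlt_le, Hy, Hi. }
  apply Rabs_def1; lra.
Qed.

Lemma w_le_closed f r : pclosed (fun z => w f z <= r).
Proof.
  intros z H. apply le_epsilon. intros e He.
  destruct (H (supp f) (e/4)) as (a & Ha & Hb); [lra|].
  pose proof (w_ball f e z He a Hb) as L. apply Rabs_def2 in L. lra.
Qed.

Lemma w_ge_closed f r : pclosed (fun z => r <= w f z).
Proof.
  intros z H. apply le_epsilon. intros e He.
  destruct (H (supp f) (e/4)) as (a & Ha & Hb); [lra|].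
  pose proof (w_ball f e z He a Hb) as L. apply Rabs_def2 in L. lra.
Qed.

Lemma w_max_exists f A : compact_in (prod_open I) A -> (exists a, A a) ->
  exists m, A m /\ forall a, A a -> w f a <= w f m.
Proof.
  intros HA (a0 & Ha0). apply NNPP. intros N.
  destruct (HA pt (fun b z => A b /\ w f z < w f b)) as (bs & Hbs).
  - intros b x [Ab L]. exists (supp f), ((w f b - w f x)/4). split; [lra|].
    intros y Hy. split; auto. pose proof (w_ball f (w f b - w f x) x ltac:(lra) y Hy) as H.
    apply Rabs_def2 in H. lra.
  - intros x Ax. apply NNPP. intros N2. apply N. exists x. split; auto. intros a Aa.
    apply Rnot_lt_le. intros L. apply N2. exists a. auto.
  - destruct (Hbs a0 Ha0) as (b0 & Hb0 & _).
    (* Entries outside A receive the value at [a0]. Some listed point of A lies strictly above it,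
       so the maximising entry belongs to A. *)
    destruct (list_max_exists (fun b => if excluded_middle_informative (A b) then w f b else w f a0) bs b0 Hb0)
      as (m & Hm & HM).
    destruct (Hbs a0 Ha0) as (b1 & Hb1 & Ab1 & L1).
    assert (Am : A m).
    { apply NNPP. intros Nm. specialize (HM b1 Hb1).
      destruct (excluded_middle_informative (A b1)); [|tauto].
      destruct (excluded_middle_informative (A m)); [tauto|]. lra. }
    destruct (Hbs m Am) as (b2 & Hb2 & Ab2 & L2). specialize (HM b2 Hb2).
    destruct (excluded_middle_informative (A b2)); [|tauto].
    destruct (excluded_middle_informative (A m)); [|tauto]. lra.
Qed.

End Points.
Arguments hat {I}. Arguments w {I}. Arguments ball {I}. Arguments pclosed {I}.
Arguments pbounded {I}. Arguments idx {I}. Arguments supp {I}.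

(** * The hyperspace *)

(** All rationals, as (a - b)/(c + 1), so that codes with rational constants can be enumerated. *)
Definition rq (t : nat * nat * nat) : R :=
  (INR (fst (fst t)) - INR (snd (fst t))) / INR (snd t + 1).

Lemma rq_dense x e : 0 < e -> exists t, Rabs (rq t - x) < e.
Proof.
  intros He. destruct (INR_unbounded (/ e)) as (c & Hc).
  set (m := INR (c + 1)). assert (Hm : / e < m) by (unfold m; rewrite plus_INR; simpl; lra).
  assert (Hi : 0 < / e) by (apply Rinv_0_lt_compat; auto).
  destruct (archimed (x * m)) as [A1 A2]. set (z := up (x * m)) in *.
  exists (Z.to_nat z, Z.to_nat (- z), c). unfold rq. simpl fst. simpl snd. fold m.
  replace (INR (Z.to_nat z) - INR (Z.to_nat (- z))) with (IZR z).
  - assert (E : e * m > 1).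
    { apply Rmult_lt_reg_l with (/ e); auto. rewrite <- Rmult_assoc, Rinv_l by lra. lra. }
    replace (IZR z / m - x) with ((IZR z - x * m) / m) by (field; lra).
    rewrite Rabs_right.
    + apply Rmult_lt_reg_r with m; [lra|]. unfold Rdiv. rewrite Rmult_assoc, Rinv_l by lra. lra.
    + apply Rle_ge, Rle_mult_inv_pos; lra.
  - rewrite !INR_IZR_INZ, <- minus_IZR. f_equal. lia.
Qed.

Section Hyper.
Variable I : Type.
Notation pt := (I -> R).
Notation X := (mpcc I).

Definition el (A : X) : pt -> Prop := proj1_sig A.

Lemma mpcc_eq (A B : X) : (forall a, el A a <-> el B a) -> A = B.
Proof.
  intros H. destruct A as [A HA], B as [B HB]. unfold el in H. simpl in H.
  assert (E : A = B) by (apply functional_extensionality; intros a; apply propositional_extensionality; auto).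
  subst B. f_equal. apply proof_irrelevance.
Qed.

Lemma el_ne A : exists a, el A a.
Proof. exact (proj1 (proj2_sig A)). Qed.

Lemma el_compact A : compact_in (prod_open I) (el A).
Proof. exact (proj1 (proj2 (proj2_sig A))). Qed.

Lemma el_convex A : mp_convex (el A).
Proof. exact (proj2 (proj2 (proj2_sig A))). Qed.

Lemma el_closed A : pclosed (el A).
Proof. apply compact_closed, el_compact. Qed.

Lemma el_bounded A : pbounded (el A).
Proof. apply compact_bounded, el_compact. Qed.

Lemma mpcc_of (S : pt -> Prop) : (exists a, S a) -> pclosed S -> pbounded S ->
  mp_convex S -> exists A : X, el A = S.
Proof.
  intros H1 H2 H3 H4.
  exists (exist _ S (conj H1 (conj (closed_bounded_compact I S H2 H3) H4))). reflexivity.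
Qed.

Definition argw (f : code I) (A : X) : pt :=
  epsilon (inhabits (fun _ => 0)) (fun m => el A m /\ forall a, el A a -> w f a <= w f m).

Definition phi (f : code I) (A : X) : R := w f (argw f A).

Lemma argw_spec f A : el A (argw f A) /\ forall a, el A a -> w f a <= phi f A.
Proof. unfold phi, argw. apply epsilon_spec, w_max_exists; [apply el_compact|apply el_ne]. Qed.

Lemma phi_ge f A a : el A a -> w f a <= phi f A.
Proof. apply argw_spec. Qed.

Lemma phi_le f A r : (forall a, el A a -> w f a <= r) -> phi f A <= r.
Proof. intros H. apply H, argw_spec. Qed.

(** The Hausdorff uniformity seen through finitely many coordinates; [vietoris_iff] identifies its
    topology with the Vietoris one. *)
Definition near (F : list I) (e : R) (A B : X) : Prop :=
  (forall a, el A a -> exists b, el B b /\ ball F e a b) /\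
  (forall b, el B b -> exists a, el A a /\ ball F e a b).

Lemma ball_weaken F G e e' (c y : pt) : incl F G -> e <= e' -> ball G e c y -> ball F e' c y.
Proof. intros H L HB i Hi. specialize (HB i (H i Hi)). lra. Qed.

Lemma ball_sym F e (c y : pt) : ball F e c y -> ball F e y c.
Proof. intros H i Hi. rewrite Rabs_minus_sym. auto. Qed.

Lemma ball_tri F e e' (x y z : pt) : ball F e x y -> ball F e' y z -> ball F (e + e') x z.
Proof.
  intros H H' i Hi. replace (z i - x i) with ((z i - y i) + (y i - x i)) by ring.
  eapply Rle_lt_trans; [apply Rabs_triang|]. specialize (H i Hi). specialize (H' i Hi). lra.
Qed.

Lemma near_weaken F G e e' A B : incl F G -> e <= e' -> near G e A B -> near F e' A B.
Proof.
  intros H L [H1 H2]. split.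
  - intros a Aa. destruct (H1 a Aa) as (b & Bb & Hb). exists b. split; auto.
    eapply ball_weaken; eauto.
  - intros b Bb. destruct (H2 b Bb) as (a & Aa & Ha). exists a. split; auto.
    eapply ball_weaken; eauto.
Qed.

Lemma near_refl F e A : 0 < e -> near F e A A.
Proof. intros He. split; intros a Ha; exists a; split; auto; apply ball_self; auto. Qed.

Lemma near_eq A B : (forall F e, 0 < e -> near F e A B) -> A = B.
Proof.
  intros H. apply mpcc_eq. intros a. split; intros Ha; apply el_closed; intros F e He.
  - destruct (H F e He) as [H1 _]. apply H1. exact Ha.
  - destruct (H F e He) as [_ H2]. destruct (H2 a Ha) as (b & ? & ?). exists b.
    split; auto. apply ball_sym. auto.
Qed.

Lemma phi_near f e A B : 0 < e -> near (supp f) e A B -> Rabs (phi f A - phi f B) <= 2 * e.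
Proof.
  intros He [H1 H2]. apply Rabs_le. split.
  - enough (phi f B <= phi f A + 2 * e) by lra. apply phi_le. intros b Bb.
    destruct (H2 b Bb) as (a & Aa & Ha). eapply Rle_trans; [apply (w_lip I f a b e)|]; [lra| |].
    + intros i Hi. rewrite Rabs_minus_sym. apply Rlt_le, Ha, Hi.
    + pose proof (phi_ge f A a Aa). lra.
  - enough (phi f A <= phi f B + 2 * e) by lra. apply phi_le. intros a Aa.
    destruct (H1 a Aa) as (b & Bb & Hb). eapply Rle_trans; [apply (w_lip I f b a e)|]; [lra| |].
    + intros i Hi. apply Rlt_le, Hb, Hi.
    + pose proof (phi_ge f B b Bb). lra.
Qed.

Definition ratcode (F : list I) (f : code I) : Prop :=
  (forall i, In (Some i) (idx f) -> In i F) /\ (forall jq, In jq (snd f) -> exists t, snd jq = rq t).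

Lemma comb_chain (A : X) (F G : list I) (c : pt) (d : R) :
  incl G F -> (exists a, el A a /\ forall j, In j F -> a j <= c j + 3 * d) ->
  (forall k, In k G -> exists a, el A a /\ c k - 2 * d <= a k /\
     forall j, In j F -> c k - 2 * d - a k + a j <= c j + 3 * d) ->
  exists a, el A a /\ (forall j, In j F -> a j <= c j + 3 * d) /\
    forall k, In k G -> c k - 2 * d <= a k.
Proof.
  induction G as [|k G IH]; intros HG H0 Hk.
  - destruct H0 as (a & ? & ?). exists a. repeat split; auto. intros k [].
  - destruct IH as (a & Aa & Hle & Hge); auto.
    { intros x Hx. apply HG. right. auto. } { intros x Hx. apply Hk. right. auto. }
    destruct (Hk k (or_introl eq_refl)) as (b & Bb & Hb1 & Hb2).
    (* The translation that puts the k-th coordinate of b at exactly c_k - 2d; it is downward, hence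
       an admissible coefficient. *)
    set (s := c k - 2 * d - b k) in *.
    exists (mp_comb (Some 0) a (Some s) b). split.
    { apply el_convex; auto. simpl. f_equal. apply Rmax_left. unfold s. lra. }
    split.
    + intros j Hj. simpl. specialize (Hle j Hj). specialize (Hb2 j Hj).
      apply Rmax_lub; lra.
    + intros x [<-|Hx]; simpl.
      * eapply Rle_trans; [|apply Rmax_r]. unfold s. lra.
      * eapply Rle_trans; [|apply Rmax_l]. specialize (Hge x Hx). lra.
Qed.

(* Quantitative separation: finitely many functionals detect that [A] comes
   close to [c].  Take a point of [A] below [c] and, for each coordinate [k],
   a point of [A] reaching [c_k] after a downward translation below [c]; the
   maximum of all of these is the wanted point. *)
Lemma local_codes (F : list I) (d : R) (c : pt) : 0 < d -> exists L : list (code I),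
  (forall f, In f L -> ratcode F f) /\
  forall A : X, (forall f, In f L -> w f c - d <= phi f A) ->
    exists a, el A a /\ ball F (4 * d) c a.
Proof.
  intros Hd.
  destruct (choice (fun i t => Rabs (rq t - c i) < d) (fun i => rq_dense (c i) d Hd)) as (q & Hq).
  assert (Hq' : forall i, c i - d <= rq (q i) <= c i + d).
  { intros i. specialize (Hq i). apply Rabs_def2 in Hq. lra. }
  set (l := map (fun j => (Some j, rq (q j))) F).
  assert (Hl : forall jq, In jq l -> exists j, In j F /\ jq = (Some j, rq (q j))).
  { intros jq H. apply in_map_iff in H. destruct H as (j & E & Hj). eauto. }
  (* The first code is min(0, q_j - a_j): a value near 0 forces a below c up to 3d. The code for k
     is min(a_k, a_k - a_j + q_j): a value near c_k says that a reaches c_k and stays below c once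
     lowered to that height. *)
  exists ((None, None, l) :: map (fun k => (Some k, None, l)) F). split.
  - assert (Hi : forall i, In (Some i) (map fst l) -> In i F).
    { intros i Hi. apply in_map_iff in Hi. destruct Hi as (jq & E & Hj).
      destruct (Hl jq Hj) as (j & Hj' & ->). simpl in E. injection E as ->. auto. }
    intros f [<-|Hf].
    + split; [intros i [H|[H|H]]; simpl in *; try discriminate; auto|].
      intros jq H. destruct (Hl jq H) as (j & _ & ->). exists (q j). reflexivity.
    + apply in_map_iff in Hf. destruct Hf as (k & <- & Hk).
      split; [intros i [H|[H|H]]; simpl in *; try discriminate; auto|].
      * injection H as <-. exact Hk.
      * intros jq H. destruct (Hl jq H) as (j & _ & ->). exists (q j). reflexivity.
  - intros A HA.
    destruct (comb_chain A F F c d) as (a & Aa & Hle & Hge).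
    + apply incl_refl.
    + pose proof (HA _ (or_introl eq_refl)) as H.
      assert (Hw : - d <= w (None, None, l) c).
      { apply w_ge; simpl; [lra|]. intros jq Hj. destruct (Hl jq Hj) as (j & _ & ->).
        simpl. specialize (Hq' j). lra. }
      exists (argw (None, None, l) A). split; [apply argw_spec|]. intros j Hj.
      assert (Hin : In (Some j, rq (q j)) l) by (apply in_map_iff; exists j; auto).
      pose proof (w_le_elem I (None, None, l) (argw (None, None, l) A) _ Hin) as H2.
      unfold phi in H. simpl in H2. specialize (Hq' j). lra.
    + intros k Hk.
      set (f := (Some k, None, l) : code I).
      assert (H : w f c - d <= phi f A).
      { apply HA. right. apply in_map_iff. exists k. auto. }
      assert (Hw : c k - d <= w f c).
      { apply w_ge; simpl; [lra|]. intros jq Hj. destruct (Hl jq Hj) as (j & _ & ->).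
        simpl. specialize (Hq' j). lra. }
      exists (argw f A). split; [apply argw_spec|]. unfold phi in H.
      pose proof (w_le_base I f (argw f A)) as H1. simpl in H1. split; [lra|].
      intros j Hj.
      assert (Hin : In (Some j, rq (q j)) l) by (apply in_map_iff; exists j; auto).
      pose proof (w_le_elem I f (argw f A) _ Hin) as H2. simpl in H2. specialize (Hq' j). lra.
    + exists a. split; auto. intros i Hi. specialize (Hle i Hi). specialize (Hge i Hi).
      apply Rabs_def1; lra.
Qed.

(** Max-plus counterpart of Hahn-Banach separation: [local_codes] at every scale gives points of A
    arbitrarily near z, and A is closed. *)
Lemma mpcc_sep A z : (forall f, w f z <= phi f A) -> el A z.
Proof.
  intros H. apply el_closed. intros F e He.
  destruct (local_codes F (e/4) z) as (L & _ & HL); [lra|].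
  destruct (HL A) as (a & Aa & Ha).
  - intros f _. specialize (H f). lra.
  - exists a. split; auto. replace e with (4 * (e/4)) by field. exact Ha.
Qed.

Definition cup (i : I) : code I := (Some i, None, nil).
Definition cdn (i : I) : code I := (None, Some i, nil).

Lemma w_cup i a : w (cup i) a = a i.
Proof. unfold w. simpl. ring. Qed.

Lemma w_cdn i a : w (cdn i) a = - a i.
Proof. unfold w. simpl. ring. Qed.

(** Codes are collected for a finite net of A, which brings B close to A, and for a net of a compact
    box [K] capturing all competing B, which brings A close to B. In the second case the errors are
    d for the functionals and 2d for the net, whence the tolerance 3d; the final distance is 13d,
    below e. *)
Lemma near_phi A F e : 0 < e -> exists L : list (code I),
  (forall f, In f L -> ratcode F f) /\ exists d, 0 < d /\
  forall B : X, (forall f, In f L -> Rabs (phi f B - phi f A) < d) -> near F e A B.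
Proof.
  intros He. set (d := Rmin (e / 30) 1). assert (Hd : 0 < d) by (apply Rmin_glb_lt; lra).
  assert (d <= e / 30 /\ d <= 1) as [d1 d2] by (split; [apply Rmin_l|apply Rmin_r]).
  destruct (choice (fun c (L : list (code I)) => (forall f, In f L -> ratcode F f) /\
    forall A : X, (forall f, In f L -> w f c - (3 * d) <= phi f A) ->
    exists a, el A a /\ ball F (4 * (3 * d)) c a)) as (Lc & HL).
  { intros c. apply local_codes. lra. }
  destruct (totally_bounded I (el A) F d (el_compact A) Hd) as (cs & Hcs).
  destruct (choice (fun i M => forall a, el A a -> Rabs (a i) <= M) (el_bounded A)) as (M & HM).
  (* Zero off F, and one unit larger than A on F: since d <= 1, the codes [cup] and [cdn] force
     every competing B, truncated to F, into this box. *)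
  set (K := fun z : pt => (forall i, In i F -> Rabs (z i) <= M i + 1) /\ (forall i, ~ In i F -> z i = 0)).
  assert (KM : forall i z, K z -> Rabs (z i) <= Rabs (M i) + 1).
  { intros i z [K1 K2]. destruct (classic (In i F)) as [Hi|Hi].
    - specialize (K1 i Hi). pose proof (Rle_abs (M i)). lra.
    - rewrite (K2 i Hi), Rabs_R0. pose proof (Rabs_pos (M i)). lra. }
  assert (HK : compact_in (prod_open I) K).
  { apply closed_bounded_compact.
    - intros z Hz. split; intros i Hi; [apply le_epsilon; intros r Hr|apply cond_eq; intros r Hr];
      destruct (Hz (i :: nil) r Hr) as (a & [Ka1 Ka2] & Ha);
      specialize (Ha i (or_introl eq_refl)).
      + specialize (Ka1 i Hi). pose proof (Rabs_triang (z i - a i) (a i)) as T.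
        replace (z i - a i + a i) with (z i) in T by ring. rewrite Rabs_minus_sym in Ha. lra.
      + rewrite (Ka2 i Hi) in Ha. rewrite Rabs_minus_sym. exact Ha.
    - intros i. exists (Rabs (M i) + 1). intros a Ka. apply KM. exact Ka. }
  destruct (totally_bounded I K F d HK Hd) as (ks & Hks).
  exists (flat_map Lc (cs ++ ks) ++ map cup F ++ map cdn F). split.
  { intros f Hf. apply in_app_or in Hf. destruct Hf as [Hf|Hf].
    - apply in_flat_map in Hf. destruct Hf as (c & _ & Hf). apply (HL c). exact Hf.
    - apply in_app_or in Hf. destruct Hf as [Hf|Hf]; apply in_map_iff in Hf; destruct Hf as (i & <- & Hi);
      (split; [intros j [E|[E|[]]]; simpl in E; try discriminate; injection E as <-; auto|intros ? []]). }
  exists d. split; auto. intros B HB. split.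
  - intros a Aa. destruct (Hcs a Aa) as (c & Hc & Ac & Hac).
    destruct (HL c) as [_ HL'].
    destruct (HL' B) as (b & Bb & Hb).
    { intros f Hf. assert (Hf' : In f (flat_map Lc (cs ++ ks) ++ map cup F ++ map cdn F)).
      { apply in_or_app. left. apply in_flat_map. exists c. split; auto. apply in_or_app. auto. }
      specialize (HB f Hf'). apply Rabs_def2 in HB. pose proof (phi_ge f A c Ac). lra. }
    exists b. split; auto. apply (ball_weaken F F (d + 4 * (3 * d))); [apply incl_refl|lra|].
    apply ball_tri with c; auto. apply ball_sym. auto.
  - intros b Bb. set (z := fun i => if excluded_middle_informative (In i F) then b i else 0).
    assert (zb : forall i, In i F -> z i = b i).
    { intros i Hi. unfold z. destruct excluded_middle_informative; tauto. }
    assert (Kz : K z).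
    { split; [intros i Hi|intros i Hi; unfold z; destruct excluded_middle_informative; tauto].
      rewrite zb by auto. apply Rabs_le. 
      assert (H1 : In (cup i) (flat_map Lc (cs ++ ks) ++ map cup F ++ map cdn F)).
      { apply in_or_app. right. apply in_or_app. left. apply in_map. auto. }
      assert (H2 : In (cdn i) (flat_map Lc (cs ++ ks) ++ map cup F ++ map cdn F)).
      { apply in_or_app. right. apply in_or_app. right. apply in_map. auto. }
      apply HB in H1. apply HB in H2. apply Rabs_def2 in H1. apply Rabs_def2 in H2.
      pose proof (phi_ge (cup i) B b Bb) as P1. pose proof (phi_ge (cdn i) B b Bb) as P2.
      rewrite w_cup in P1. rewrite w_cdn in P2.
      assert (phi (cup i) A <= M i).
      { apply phi_le. intros a Aa. rewrite w_cup. pose proof (Rle_abs (a i)). pose proof (HM i a Aa). lra. }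
      assert (phi (cdn i) A <= M i).
      { apply phi_le. intros a Aa. rewrite w_cdn. pose proof (Rle_abs (- a i)).
        rewrite Rabs_Ropp in *. pose proof (HM i a Aa). lra. }
      lra. }
    destruct (Hks z Kz) as (c & Hc & Kc & Hzc).
    assert (Hbc : ball F d c b).
    { intros i Hi. rewrite <- zb by auto. apply Hzc; auto. }
    destruct (HL c) as [HR HL']. destruct (HL' A) as (a & Aa & Ha).
    { intros f Hf. assert (Hf' : In f (flat_map Lc (cs ++ ks) ++ map cup F ++ map cdn F)).
      { apply in_or_app. left. apply in_flat_map. exists c. split; auto. apply in_or_app. auto. }
      specialize (HB f Hf'). apply Rabs_def2 in HB. pose proof (phi_ge f B b Bb).
      assert (w f c <= w f b + 2 * d); [|lra].
      apply w_lip; [lra|]. intros i Hi. apply Rlt_le, Hbc. apply (HR f Hf).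
      unfold supp in Hi. apply in_flat_map in Hi. destruct Hi as ([j|] & Ho & E); [|destruct E].
      destruct E as [<-|[]]. exact Ho. }
    exists a. split; auto. apply (ball_weaken F F (4 * (3 * d) + d)); [apply incl_refl|lra|].
    apply ball_tri with c; auto. apply ball_sym. auto.
Qed.

(** From Vietoris to [near] by a Lebesgue number: finitely many balls cover A whose doubles lie in
    members of the basic set. Conversely, balls around a finite net of A form a basic
    neighbourhood. *)
Lemma vietoris_iff (W : X -> Prop) : vietoris_open I W <->
  forall A, W A -> exists F e, 0 < e /\ forall B, near F e A B -> W B.
Proof.
  split.
  - intros HW A WA. destruct (HW A WA) as (Us & HU & [Hcov Hmeet] & HB).
    assert (Hrad : forall a, exists Fe : list I * R, 0 < snd Fe /\ (el A a ->
      exists U, In U Us /\ forall y, ball (fst Fe) (2 * snd Fe) a y -> U y)).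
    { intros a. destruct (classic (el A a)) as [Aa|Na].
      - destruct (Hcov a Aa) as (U & HinU & Ua). destruct (HU U HinU a Ua) as (F & e & He & H).
        exists (F, e/2). simpl. split; [lra|]. intros _. exists U. split; auto.
        intros y Hy. apply H. intros i Hi. specialize (Hy i Hi). lra.
      - exists (nil, 1). simpl. split; [lra|tauto]. }
    apply choice in Hrad. destruct Hrad as (r & Hr).
    destruct (el_compact A pt (fun c y => el A c /\ ball (fst (r c)) (snd (r c)) c y)) as (cs & Hcs).
    { intros c x [Ac Hx]. destruct (ball_open I _ _ _ x Hx) as (G & e & He & HG).
      exists G, e. split; auto. }
    { intros x Ax. exists x. split; auto. apply ball_self, Hr. }
    assert (Hm : forall V, incl V Us -> exists Fe : list I * R, 0 < snd Fe /\
      forall U, In U V -> exists a, el A a /\ forall y, ball (fst Fe) (snd Fe) a y -> U y).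
    { induction V as [|U V IH]; intros HV.
      - exists (nil, 1). simpl. split; [lra|]. intros U [].
      - destruct IH as ([F e] & He & IH). { intros x Hx. apply HV. right. auto. }
        simpl in *. assert (HinU : In U Us) by (apply HV; left; auto).
        destruct (Hmeet U HinU) as (a & Aa & Ua).
        destruct (HU U HinU a Ua) as (F' & e' & He' & H').
        exists (F ++ F', Rmin e e'). simpl. split; [apply Rmin_glb_lt; auto|].
        intros U' [<-|HU'].
        + exists a. split; auto. intros y Hy. apply H'.
          apply (ball_weaken F' (F ++ F') (Rmin e e')); auto; [apply incl_appr, incl_refl|apply Rmin_r].
        + destruct (IH U' HU') as (a' & Aa' & H2). exists a'. split; auto. intros y Hy. apply H2.
          apply (ball_weaken F (F ++ F') (Rmin e e')); auto; [apply incl_appl, incl_refl|apply Rmin_l]. }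
    destruct (Hm Us (incl_refl _)) as ([F1 e1] & He1 & H1). simpl in *.
    assert (Hmin : exists e2, 0 < e2 /\ forall c, In c cs -> e2 <= snd (r c)).
    { clear Hcs. induction cs as [|c cs (e2 & He2 & IH)].
      - exists 1. split; [lra|]. intros c [].
      - exists (Rmin e2 (snd (r c))). split; [apply Rmin_glb_lt; auto; apply Hr|].
        intros c' [<-|Hc']; [apply Rmin_r|]. specialize (IH c' Hc').
        pose proof (Rmin_l e2 (snd (r c))). lra. }
    destruct Hmin as (e2 & He2 & Hmin).
    set (F := F1 ++ flat_map (fun c => fst (r c)) cs).
    exists F, (Rmin e1 e2). split; [apply Rmin_glb_lt; auto|].
    intros B [N1 N2]. apply HB. split.
    + intros b Bb. destruct (N2 b Bb) as (a & Aa & Hab).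
      destruct (Hcs a Aa) as (c & Hc & Ac & Hca). destruct (Hr c) as [Hrc H].
      destruct (H Ac) as (U & HinU & HUc). exists U. split; auto. apply HUc.
      replace (2 * snd (r c)) with (snd (r c) + snd (r c)) by ring. apply ball_tri with a; auto.
      apply (ball_weaken _ F (Rmin e1 e2)); auto.
      * intros i Hi. apply in_or_app. right. apply in_flat_map. exists c. auto.
      * pose proof (Rmin_r e1 e2). specialize (Hmin c Hc). lra.
    + intros U HinU. destruct (H1 U HinU) as (a & Aa & Ha). destruct (N1 a Aa) as (b & Bb & Hb).
      exists b. split; auto. apply Ha. apply (ball_weaken _ F (Rmin e1 e2)); auto; [apply incl_appl, incl_refl|apply Rmin_l].
  - intros H A WA. destruct (H A WA) as (F & e & He & HN).
    destruct (totally_bounded I (el A) F (e/2) (el_compact A)) as (cs & Hcs); [lra|].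
    (* Centres outside A are dropped, because A has to meet every member of the list. *)
    set (cs1 := filter (fun c => if excluded_middle_informative (el A c) then true else false) cs).
    assert (Hcs1 : forall c, In c cs1 <-> In c cs /\ el A c).
    { intros c. unfold cs1. rewrite filter_In. destruct excluded_middle_informative; intuition discriminate. }
    exists (map (fun c => ball F (e/2) c) cs1). split; [|split; [split|]].
    + intros U HU. apply in_map_iff in HU. destruct HU as (c & <- & _). apply ball_open.
    + intros a Aa. destruct (Hcs a Aa) as (c & Hc & Ac & Hac).
      exists (ball F (e/2) c). split; auto. apply (in_map (fun c => ball F (e/2) c)), Hcs1. auto.
    + intros U HU. apply in_map_iff in HU. destruct HU as (c & <- & Hc). apply Hcs1 in Hc.
      exists c. split; [apply Hc|]. apply ball_self. lra.
    + intros B [B1 B2]. apply HN. split.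
      * intros a Aa. destruct (Hcs a Aa) as (c & Hc & Ac & Hac).
        destruct (B2 (ball F (e/2) c)) as (b & Bb & Hb).
        { apply (in_map (fun c => ball F (e/2) c)), Hcs1. auto. }
        exists b. split; auto. replace e with (e/2 + e/2) by field.
        apply ball_tri with c; auto. apply ball_sym. auto.
      * intros b Bb. destruct (B1 b Bb) as (U & HU & Ub). apply in_map_iff in HU.
        destruct HU as (c & <- & Hc). apply Hcs1 in Hc. exists c. split; [apply Hc|].
        apply (ball_weaken F F (e/2)); auto; [apply incl_refl|lra].
Qed.

End Hyper.
Arguments el {I}. Arguments phi {I}. Arguments near {I}. Arguments argw {I}.
Arguments ratcode {I}. Arguments cup {I}. Arguments cdn {I}.

Definition ncode : Type := nat * nat * list (nat * (nat * nat * nat)).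

Module Encoding.
Import choice.
Lemma ncode_enum : exists d : nat -> ncode, forall x, exists n, d n = x.
Proof.
  exists (fun n => match unpickle n : option ncode with Some x => x | None => (O, O, nil) end).
  intros x. exists (pickle x). rewrite pickleK. reflexivity.
Qed.
End Encoding.

(** * Restriction to initial segments *)

Definition idc (_ : unit) (y : R) : R := y.

Lemma cts_real (D : R -> Prop) g x e : cts idc D g -> D x -> 0 < e ->
  exists d, 0 < d /\ forall y, D y -> Rabs (y - x) < d -> Rabs (g y - g x) < e.
Proof.
  intros Hg Dx He. destruct (Hg x Dx e He) as (F & d & Hd & H). exists d. split; auto.
  intros y Dy Hy. apply H; auto. intros k _. exact Hy.
Qed.

Lemma cts_id (D : R -> Prop) : cts idc D (fun y => y).
Proof. apply (cts_coord _ _ idc D tt). Qed.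

Lemma squash_cont x e : 0 < e -> exists d, 0 < d /\ forall y, Rabs (y - x) < d -> Rabs (squash y - squash x) < e.
Proof.
  intros He. destruct (cts_real (fun _ => True) squash x e) as (d & Hd & H); auto.
  - apply (cts_squash idc _ (fun y => y)), cts_id.
  - exists d. split; auto.
Qed.

Lemma unsquash_cont x e : 0 < x < 1 -> 0 < e ->
  exists d, 0 < d /\ forall y, 0 < y < 1 -> Rabs (y - x) < d -> Rabs (unsquash y - unsquash x) < e.
Proof.
  intros Hx He. apply (cts_real (fun y => 0 < y < 1) unsquash x e); auto.
  apply (cts_unsquash idc _ (fun y => y)); auto. apply cts_id.
Qed.

Lemma squash_le y y' : y <= y' -> squash y <= squash y'.
Proof. intros [H| ->]; [apply Rlt_le, squash_lt; auto|lra]. Qed.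

Lemma squash_le_inv y y' : squash y <= squash y' -> y <= y'.
Proof. intros H. apply Rnot_lt_le. intros L. apply squash_lt in L. lra. Qed.

Lemma ev_sub {T K : Type} (c : K -> T -> R) (D D' : T -> Prop) x P :
  (forall y, D' y -> D y) -> ev c D x P -> ev c D' x P.
Proof. intros H (F & d & Hd & HP). exists F, d. split; auto. Qed.

Lemma le_of_inv x y : (forall n, x <= y + / INR (n + 1)) -> x <= y.
Proof.
  intros H. apply le_epsilon. intros e He. destruct (INR_unbounded (/ e)) as (n & Hn).
  eapply Rle_trans; [apply (H n)|]. apply Rplus_le_compat_l.
  rewrite <- (Rinv_inv e). apply Rinv_le_contravar.
  - apply Rinv_0_lt_compat. auto.
  - rewrite plus_INR. simpl. lra.
Qed.

Lemma inv_pos n : 0 < / INR (n + 1).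
Proof. apply Rinv_0_lt_compat, lt_0_INR. lia. Qed.

Section Restrict.
Variable I : Type.
Notation pt := (I -> R).
Notation X := (mpcc I).
Implicit Types (P Q : I -> Prop) (A B : X).

Definition restr P (a : pt) : pt := fun i => if excluded_middle_informative (P i) then a i else 0.

Lemma restr_in P a i : P i -> restr P a i = a i.
Proof. intros H. unfold restr. destruct excluded_middle_informative; tauto. Qed.

Lemma restr_out P a i : ~ P i -> restr P a i = 0.
Proof. intros H. unfold restr. destruct excluded_middle_informative; tauto. Qed.

Lemma restr_restr P Q a : (forall i, P i -> Q i) -> restr P (restr Q a) = restr P a.
Proof.
  intros H. apply functional_extensionality. intros i. destruct (classic (P i)) as [Hi|Hi].
  - rewrite !restr_in; auto.
  - rewrite !restr_out; auto.
Qed.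

Lemma restr_restr' P Q a : (forall i, P i -> Q i) -> restr Q (restr P a) = restr P a.
Proof.
  intros H. apply functional_extensionality. intros i. destruct (classic (P i)) as [Hi|Hi].
  - rewrite restr_in; auto.
  - rewrite (restr_out P) by auto. unfold restr. repeat destruct excluded_middle_informative; tauto.
Qed.

Lemma restr_comb P al a be b : rmp_max al be = Some 0 ->
  restr P (mp_comb al a be b) = mp_comb al (restr P a) be (restr P b).
Proof.
  intros H. apply functional_extensionality. intros i.
  destruct (classic (P i)) as [Hi|Hi].
  - unfold mp_comb. rewrite !restr_in by auto. reflexivity.
  - rewrite restr_out by auto. unfold mp_comb. rewrite !restr_out by auto.
    pose proof (hat_comb I al (fun _ => 0) be (fun _ => 0) None H) as E. exact E.
Qed.

Lemma restr_ball P F e c y : 0 < e -> ball F e c y -> ball F e (restr P c) (restr P y).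
Proof.
  intros He H i Hi. unfold restr. destruct excluded_middle_informative; auto.
  rewrite Rminus_diag, Rabs_R0. auto.
Qed.

Lemma pclosed_restr P (S : pt -> Prop) : pclosed S -> pclosed (fun z => S (restr P z)).
Proof.
  intros HS z H. apply HS. intros F e He. destruct (H F e He) as (a & Sa & Ha).
  exists (restr P a). split; auto. apply restr_ball; auto.
Qed.

Lemma pclosed_eq (f g : pt -> pt) :
  (forall i, exists F, forall e, 0 < e -> exists d, 0 < d /\
    forall x y, ball F d x y -> Rabs (f y i - f x i) < e /\ Rabs (g y i - g x i) < e) ->
  pclosed (fun z => f z = g z).
Proof.
  intros H z Hz. apply functional_extensionality. intros i. apply cond_eq. intros e He.
  destruct (H i) as (F & HF). destruct (HF (e/2)) as (d & Hd & Hb); [lra|].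
  destruct (Hz F d Hd) as (a & Ea & Ha). destruct (Hb z a Ha) as [H1 H2].
  rewrite Ea in H1. replace (f z i - g z i) with ((g a i - g z i) - (g a i - f z i)) by ring.
  apply Rabs_def2 in H1. apply Rabs_def2 in H2. apply Rabs_def1; lra.
Qed.

Lemma pclosed_supp Q : pclosed (fun z : pt => z = restr Q z).
Proof.
  apply (pclosed_eq (fun z => z)). intros i. exists (i :: nil). intros e He. exists e. split; auto.
  intros x y H. split; [apply H; left; auto|].
  apply (restr_ball Q (i :: nil)); auto. left. auto.
Qed.

Lemma mrestr_proof P A : let S := fun z => exists a, el A a /\ z = restr P a in
  (exists z, S z) /\ compact_in (prod_open I) S /\ mp_convex S.
Proof.
  intros S. split; [|split].
  - destruct (el_ne I A) as (a & Aa). exists (restr P a), a. auto.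
  - intros J U HU Hcov. destruct (el_compact I A J (fun j z => U j (restr P z))) as (F & HF).
    + intros j x Ux. destruct (HU j _ Ux) as (G & e & He & HG). exists G, e. split; auto.
      intros y Hy. apply HG. apply restr_ball; auto.
    + intros x Ax. apply Hcov. exists x. auto.
    + exists F. intros z (a & Aa & ->). auto.
  - intros a b al be (a' & Aa & ->) (b' & Ab & ->) H. exists (mp_comb al a' be b'). split.
    + apply el_convex; auto.
    + symmetry. apply restr_comb. exact H.
Qed.

Definition mrestr P A : X := exist _ (fun z => exists a, el A a /\ z = restr P a) (mrestr_proof P A).

Definition supported P A : Prop := mrestr P A = A.

Lemma el_mrestr P A a : el A a -> el (mrestr P A) (restr P a).
Proof. intros H. exists a. auto. Qed.

Lemma mrestr_mrestr P Q A : (forall i, P i -> Q i) -> mrestr P (mrestr Q A) = mrestr P A.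
Proof.
  intros H. apply mpcc_eq. intros z. split.
  - intros (y & (a & Aa & ->) & ->). exists a. split; auto. apply restr_restr. auto.
  - intros (a & Aa & ->). exists (restr Q a). split; [apply el_mrestr; auto|]. symmetry. apply restr_restr. auto.
Qed.

Lemma mrestr_mrestr' P Q A : (forall i, P i -> Q i) -> mrestr Q (mrestr P A) = mrestr P A.
Proof.
  intros H. apply mpcc_eq. intros z. split.
  - intros (y & (a & Aa & ->) & ->). exists a. split; auto. apply restr_restr'. auto.
  - intros (a & Aa & ->). exists (restr P a). split; [apply el_mrestr; auto|]. symmetry. apply restr_restr'. auto.
Qed.

Lemma supported_mrestr P A : supported P (mrestr P A).
Proof. apply mrestr_mrestr. auto. Qed.

Lemma supported_sub P Q A : (forall i, P i -> Q i) -> supported P A -> supported Q A.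
Proof. intros H HA. unfold supported in *. rewrite <- HA. apply mrestr_mrestr'. auto. Qed.

Lemma supported_el P A a : supported P A -> el A a -> a = restr P a.
Proof.
  intros HA Aa. unfold supported in HA. rewrite <- HA in Aa. destruct Aa as (b & _ & ->).
  symmetry. apply restr_restr. auto.
Qed.

Lemma supported_intro P A : (forall a, el A a -> a = restr P a) -> supported P A.
Proof.
  intros H. apply mpcc_eq. intros z. split.
  - intros (a & Aa & ->). rewrite <- H; auto.
  - intros Az. exists z. auto.
Qed.

Lemma near_mrestr P F e A B : 0 < e -> near F e A B -> near F e (mrestr P A) (mrestr P B).
Proof.
  intros He [H1 H2]. split.
  - intros z (a & Aa & ->). destruct (H1 a Aa) as (b & Bb & Hb). exists (restr P b).
    split; [apply el_mrestr; auto|apply restr_ball; auto].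
  - intros z (b & Bb & ->). destruct (H2 b Bb) as (a & Aa & Ha). exists (restr P a).
    split; [apply el_mrestr; auto|apply restr_ball; auto].
Qed.

Lemma near_of_mrestr P F e A B : (forall i, In i F -> P i) -> near F e (mrestr P A) (mrestr P B) -> near F e A B.
Proof.
  intros HF [H1 H2].
  assert (Hb : forall a b, ball F e (restr P a) (restr P b) -> ball F e a b).
  { intros a b H i Hi. specialize (H i Hi). rewrite !restr_in in H; auto. }
  split.
  - intros a Aa. destruct (H1 _ (el_mrestr P A a Aa)) as (z & (b & Bb & ->) & Hz). eauto.
  - intros b Bb. destruct (H2 _ (el_mrestr P B b Bb)) as (z & (a & Aa & ->) & Hz). eauto.
Qed.

Lemma near_filter Q F e A B : 0 < e -> supported Q A -> supported Q B ->
  near (filter (fun i => if excluded_middle_informative (Q i) then true else false) F) e A B ->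
  near F e A B.
Proof.
  intros He HA HB [H1 H2].
  assert (Hb : forall a b, el A a -> el B b ->
    ball (filter (fun i => if excluded_middle_informative (Q i) then true else false) F) e a b ->
    ball F e a b).
  { intros a b Aa Bb H i Hi. destruct (classic (Q i)) as [Qi|Qi].
    - apply H, filter_In. split; auto. destruct excluded_middle_informative; tauto.
    - rewrite (supported_el Q A a), (supported_el Q B b), !restr_out, Rminus_diag, Rabs_R0; auto. }
  split.
  - intros a Aa. destruct (H1 a Aa) as (b & Bb & Hz). eauto.
  - intros b Bb. destruct (H2 b Bb) as (a & Aa & Hz). eauto.
Qed.

(** * Pulling functionals back along restriction, and max-plus segments *)

Definition ropt P (o : option I) : option I :=
  match o with Some i => if excluded_middle_informative (P i) then Some i else None | None => None end.

(** Coordinates outside P become 0 under restriction, so they are redirected to the extra coordinate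
    [None]; the family of functionals is thus stable under pullback. *)
Definition rcode P (f : code I) : code I :=
  (ropt P (fst (fst f)), ropt P (snd (fst f)), map (fun jq => (ropt P (fst jq), snd jq)) (snd f)).

Lemma hat_restr P a o : hat (restr P a) o = hat a (ropt P o).
Proof. destruct o as [i|]; simpl; auto. unfold restr. destruct excluded_middle_informative; auto. Qed.

Lemma w_rcode P f a : w f (restr P a) = w (rcode P f) a.
Proof.
  destruct f as [[k j] l]. unfold w, rcode. simpl. induction l as [|[o q] l IH]; simpl.
  - rewrite !hat_restr. reflexivity.
  - rewrite IH, !hat_restr. reflexivity.
Qed.

Lemma phi_rcode P f A : phi f (mrestr P A) = phi (rcode P f) A.
Proof.
  apply Rle_antisym.
  - apply phi_le. intros z (a & Aa & ->). rewrite w_rcode. apply phi_ge. auto.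
  - apply phi_le. intros a Aa. rewrite <- w_rcode. apply phi_ge, el_mrestr. auto.
Qed.

Lemma cts_w {T K : Type} (c : K -> T -> R) D (f : code I) (z : T -> pt) :
  (forall o, cts c D (fun s => hat (z s) o)) -> cts c D (fun s => w f (z s)).
Proof.
  intros H. destruct f as [[k j] l]. unfold w. simpl.
  induction l as [|[o q] l IH]; simpl.
  - apply cts_minus; apply H.
  - apply cts_min; auto. apply cts_plus; [apply cts_minus; apply H|apply cts_const].
Qed.

(** The max-plus segment from a to b, parametrised by the line: b is lowered for negative s, a for
    positive s. On finitely many coordinates the ends are reached at finite s. *)
Definition path (a b : pt) (s : R) : pt :=
  mp_comb (Some (Rmin 0 (- s))) a (Some (Rmin 0 s)) b.

Lemma path_coef s : rmp_max (Some (Rmin 0 (- s))) (Some (Rmin 0 s)) = Some 0.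
Proof. simpl. f_equal. unfold Rmax, Rmin. repeat destruct Rle_dec; lra. Qed.

Lemma path_level f a b r : w f a <= r <= w f b -> exists s, w f (path a b s) = r.
Proof.
  intros Hr.
  assert (Hh : forall s o, hat (path a b s) o = Rmax (Rmin 0 (- s) + hat a o) (Rmin 0 s + hat b o)).
  { intros s o. unfold path. rewrite hat_comb by apply path_coef. reflexivity. }
  assert (HM : exists M, 0 < M /\ forall o, In o (idx f) -> Rabs (hat a o - hat b o) <= M).
  { induction (idx f) as [|o l (M & HM0 & HM)].
    - exists 1. split; [lra|]. intros o [].
    - exists (Rmax M (Rabs (hat a o - hat b o))). split.
      + eapply Rlt_le_trans; [exact HM0|apply Rmax_l].
      + intros o' [<-|Ho]; [apply Rmax_r|]. eapply Rle_trans; [apply HM; auto|apply Rmax_l]. }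
  destruct HM as (M & HM0 & HM).
  assert (HM' : forall o, In o (idx f) -> - M <= hat a o - hat b o <= M).
  { intros o Ho. specialize (HM o Ho). pose proof (Rle_abs (hat a o - hat b o)).
    pose proof (Rle_abs (- (hat a o - hat b o))). rewrite Rabs_Ropp in *. lra. }
  assert (Heq : forall x y : pt, (forall o, In o (idx f) -> hat x o = hat y o) -> w f x = w f y).
  { intros x y H. assert (Hk := H (fst (fst f)) (or_introl eq_refl)).
    apply Rle_antisym; [replace (w f y) with (w f y + 0) by ring|replace (w f x) with (w f x + 0) by ring];
    apply w_shift; intros o Ho; rewrite (H o Ho), Hk; lra. }
  assert (E1 : w f (path a b (- M)) = w f a).
  { apply Heq. intros o Ho. rewrite Hh. specialize (HM' o Ho).
    rewrite (Rmin_left 0 (- - M)), (Rmin_right 0 (- M)) by lra. rewrite Rmax_left; lra. }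
  assert (E2 : w f (path a b M) = w f b).
  { apply Heq. intros o Ho. rewrite Hh. specialize (HM' o Ho).
    rewrite (Rmin_right 0 (- M)), (Rmin_left 0 M) by lra. rewrite Rmax_right; lra. }
  destruct (Req_dec r (w f a)) as [->|N1]; [exists (- M); auto|].
  destruct (Req_dec r (w f b)) as [->|N2]; [exists M; auto|].
  assert (C : cts idc (fun _ => True) (fun s => w f (path a b s))).
  { apply cts_w. intros o. apply (cts_ext _ _ _ _ (fun s => Rmax (Rmin 0 (- s) + hat a o) (Rmin 0 s + hat b o))).
    - intros s _. symmetry. apply Hh.
    - apply cts_max; (apply cts_plus; [apply cts_min|]); try apply cts_const;
      [apply cts_opp|]; apply cts_id. }
  destruct (IVT_interv (fun s => w f (path a b s) - r) (- M) M) as (s & _ & Hs); try lra.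
  - intros s _ e He. destruct (cts_real _ _ s e C Logic.I He) as (d & Hd & H).
    exists d. split; auto. intros y [_ Hy]. simpl in *. unfold Rdist in *.
    replace (w f (path a b y) - r - (w f (path a b s) - r)) with (w f (path a b y) - w f (path a b s)) by ring.
    apply H; auto.
  - exists s. lra.
Qed.

(* Applied to [P = {j < i}] and [Q = {j <= i}]; the index [None] stands for the
   extra coordinate that is constantly 0. *)
Section Step.
Variables (P Q : I -> Prop) (i : I) (enm : nat -> option I) (dcd : nat -> ncode).
Hypothesis PQ : forall j, P j -> Q j.
Hypothesis QP : forall j, Q j -> j <> i -> P j.
Hypothesis Qi : Q i.
Hypothesis Pi : ~ P i.
Hypothesis enm_none : exists n, enm n = None.
Hypothesis enm_some : forall j, Q j -> exists n, enm n = Some j.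

Hypothesis dcd_surj : forall x, exists n, dcd n = x.

Definition codes (n : nat) : code I :=
  let '(k, j, l) := dcd n in (enm k, enm j, map (fun p => (enm (fst p), rq (snd p))) l).

Lemma codes_surj F f : (forall j, In j F -> Q j) -> ratcode F f -> exists n, codes n = f.
Proof.
  intros HF [H1 H2].
  assert (He : forall o, In o (idx f) -> exists n, enm n = o).
  { intros [j|] Ho; auto. }
  destruct f as [[k j] l]. simpl in *.
  destruct (He k) as (nk & Ek); [left; auto|]. destruct (He j) as (nj & Ej); [right; left; auto|].
  assert (Hl : exists l', map (fun p => (enm (fst p), rq (snd p))) l' = l).
  { assert (He' : forall o, In o (map fst l) -> exists n, enm n = o).
    { intros o Ho. apply He. right. right. exact Ho. }
    clear H1 He. induction l as [|[o q] l IH].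
    - exists nil. reflexivity.
    - destruct IH as (l' & El).
      { intros jq Hj. apply H2. right. auto. } { intros o' Ho. apply He'. right. auto. }
      destruct (He' o) as (n & En); [left; auto|]. destruct (H2 (o, q)) as (t & Et); [left; auto|].
      simpl in Et. exists ((n, t) :: l'). simpl. rewrite El, En, Et. reflexivity. }
  destruct Hl as (l' & El). destruct (dcd_surj (nk, nj, l')) as (n & En). exists n.
  unfold codes. rewrite En, Ek, Ej, El. reflexivity.
Qed.

Definition psi (n : nat) (A : X) : R := squash (phi (codes n) A).

Lemma psi01 n A : 0 < psi n A < 1.
Proof. apply squash_bounds. Qed.

Lemma phi_cts_psi n D : cts psi D (fun A => phi (codes n) A).
Proof.
  apply cts_ext with (fun A => unsquash (psi n A)).
  - intros A _. unfold psi. apply unsquash_squash.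
  - apply cts_unsquash; [apply cts_coord|]. intros A _. apply psi01.
Qed.

(** Metrizability of X_Q: coordinates outside Q are constant, and rational codes with coordinates in
    Q are all enumerated by [codes]. *)
Lemma ev_psi_near A F e : supported Q A -> 0 < e -> ev psi (supported Q) A (fun B => near F e A B).
Proof.
  intros QA He. set (F' := filter (fun i => if excluded_middle_informative (Q i) then true else false) F).
  destruct (near_phi I A F' e He) as (L & HL & d & Hd & HN).
  eapply ev_mono.
  - apply (ev_list _ _ psi (supported Q) A (fun f B => Rabs (phi f B - phi f A) < d) L).
    intros f Hf. destruct (codes_surj F' f) as (n & <-); auto.
    + intros j Hj. apply filter_In in Hj. destruct Hj as [_ Hj]. destruct excluded_middle_informative; [auto|discriminate].
    + apply (phi_cts_psi n (supported Q) A QA d Hd).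
  - intros B QB HB. apply (near_filter Q); auto.
Qed.

Lemma near_psi A n e : 0 < e -> exists F d, 0 < d /\ forall B, near F d A B -> Rabs (psi n B - psi n A) < e.
Proof.
  intros He. destruct (squash_cont (phi (codes n) A) e He) as (d & Hd & H).
  exists (supp (codes n)), (d/4). split; [lra|]. intros B HB. apply H.
  rewrite Rabs_minus_sym. pose proof (phi_near I (codes n) (d/4) A B ltac:(lra) HB). lra.
Qed.

Lemma near_psi_list A l e : 0 < e -> exists F d, 0 < d /\ forall B, near F d A B -> close psi l e A B.
Proof.
  intros He. induction l as [|n l (F & d & Hd & IH)].
  - exists nil, 1. split; [lra|]. intros B _ k [].
  - destruct (near_psi A n e He) as (F' & d' & Hd' & H').
    exists (F ++ F'), (Rmin d d'). split; [apply Rmin_glb_lt; auto|].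
    intros B HB k [<-|Hk].
    + apply H'. eapply near_weaken; [| |exact HB]; [apply incl_appr, incl_refl|apply Rmin_r].
    + apply IH; auto. eapply near_weaken; [| |exact HB]; [apply incl_appl, incl_refl|apply Rmin_l].
Qed.

Lemma psi_sep A A' : supported Q A -> supported Q A' -> (forall k, psi k A = psi k A') -> A = A'.
Proof.
  intros QA QA' H. apply near_eq. intros F e He.
  destruct (ev_psi_near A F e QA He) as (l & d & Hd & HN). apply HN; auto.
  intros k _. rewrite H, Rminus_diag, Rabs_R0. exact Hd.
Qed.

Lemma psi_rho_cts k : cts psi (supported Q) (fun A => psi k (mrestr P A)).
Proof.
  intros A QA e He. destruct (near_psi (mrestr P A) k e He) as (F & d & Hd & H).
  eapply ev_mono; [apply (ev_psi_near A F d QA Hd)|]. intros B QB HB.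
  apply H, near_mrestr; auto.
Qed.

(** A' consists of the points over B whose new coordinate is borrowed from some a in A that is
    e-close on F and P. As max is nonexpansive, this closeness survives combining both sides with
    the same coefficients, which gives convexity. Since i is the only new coordinate, gluing a_i
    onto a point of B near the restriction of a produces a point of A'. *)
Lemma lift_exists A B F e : supported Q A -> supported P B -> 0 < e -> near F e (mrestr P A) B ->
  exists A', supported Q A' /\ mrestr P A' = B /\ near F (2 * e) A A'.
Proof.
  intros QA PB He [N1 N2].
  set (S := fun z : pt => z = restr Q z /\ el B (restr P z) /\
    exists a, el A a /\ a i = z i /\ forall j, In j F -> P j -> Rabs (a j - z j) <= e).
  set (mixp := fun (b a : pt) j => if excluded_middle_informative (j = i) then a i else b j).
  assert (mix_i : forall b a, mixp b a i = a i).
  { intros b a. unfold mixp. destruct excluded_middle_informative; tauto. }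
  assert (mix_j : forall b a j, j <> i -> mixp b a j = b j).
  { intros b a j H. unfold mixp. destruct excluded_middle_informative; tauto. }
  assert (mix_S : forall b a, el B b -> el A a -> ball F e (restr P a) b ->
    S (mixp b a) /\ restr P (mixp b a) = b).
  { intros b a Bb Aa Hab.
    assert (E : restr P (mixp b a) = b).
    { rewrite (supported_el P B b) at 2; auto. apply functional_extensionality. intros j.
      destruct (classic (P j)) as [Pj|Pj]; [|rewrite !restr_out; auto].
      rewrite !restr_in; auto. apply mix_j. intros ->. auto. }
    split; auto. split; [|split].
    - apply functional_extensionality. intros j. destruct (classic (Q j)) as [Qj|Qj].
      + rewrite restr_in; auto.
      + rewrite restr_out; auto. rewrite mix_j by (intros ->; auto).
        rewrite (supported_el P B b), restr_out; auto.
    - rewrite E. exact Bb.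
    - exists a. split; [|split]; auto. intros j Hj Pj. specialize (Hab j Hj).
      rewrite restr_in in Hab; auto. rewrite mix_j by (intros ->; auto).
      rewrite Rabs_minus_sym. lra. }
  destruct (mpcc_of I S) as (A' & EA').
  - destruct (el_ne I B) as (b & Bb). destruct (N2 b Bb) as (z & (a & Aa & ->) & Hz).
    exists (mixp b a). apply mix_S; auto.
  - apply pclosed_and; [apply pclosed_supp|].
    apply pclosed_and; [apply pclosed_restr, el_closed|].
    intros z Hz.
    (* For closedness: the witnesses a vary with the approximating points, and compactness of A
       extracts one that meets all tolerances 1/(n+1). *)
    destruct (compact_fip I (el A) nat (fun n a => Rabs (a i - z i) <= / INR (n + 1) /\
      forall j, In j F -> P j -> Rabs (a j - z j) <= e + / INR (n + 1))) as (a & Aa & Ha).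
    + apply el_compact.
    + intros n a Ha.
      assert (Cj : forall j r, (forall r', 0 < r' -> exists b : pt, Rabs (b j - z j) <= r /\ Rabs (b j - a j) < r') ->
        Rabs (a j - z j) <= r).
      { intros j r H. apply le_epsilon. intros r' Hr'. destruct (H r' Hr') as (b & H1 & H2).
        replace (a j - z j) with ((b j - z j) - (b j - a j)) by ring.
        eapply Rle_trans; [apply Rabs_triang|]. rewrite Rabs_Ropp. lra. }
      split; [|intros j Hj Pj]; apply Cj; intros r' Hr'.
      * destruct (Ha (i :: nil) r' Hr') as (b & [H1 _] & H2). exists b. split; auto. apply H2. left. auto.
      * destruct (Ha (j :: nil) r' Hr') as (b & [_ H1] & H2). exists b. split; auto. apply H2. left. auto.
    + intros js. 
      assert (HN : exists N, forall j, In j js -> (j <= N)%nat).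
      { exists (list_max js). intros j Hj. pose proof (proj1 (list_max_le js (list_max js)) (le_n _)) as H.
        rewrite Forall_forall in H. auto. }
      destruct HN as (N & HN). destruct (Hz (i :: F) (/ INR (N + 1)) (inv_pos N)) as (z' & (a & Aa & E & Ha) & Hb).
      exists a. split; auto. intros n Hn.
      assert (L : / INR (N + 1) <= / INR (n + 1)).
      { apply Rinv_le_contravar; [apply lt_0_INR; lia|]. apply le_INR. specialize (HN n Hn). lia. }
      split.
      * rewrite E. pose proof (Hb i (or_introl eq_refl)). lra.
      * intros j Hj Pj. specialize (Ha j Hj Pj). pose proof (Hb j (or_intror Hj)).
        replace (a j - z j) with ((a j - z' j) + (z' j - z j)) by ring.
        eapply Rle_trans; [apply Rabs_triang|]. lra.
    + exists a. split; [|split]; auto.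
      * apply cond_eq. intros r Hr.
        assert (Rabs (a i - z i) <= 0); [|lra]. apply le_of_inv. intros n.
        destruct (Ha n). lra.
      * intros j Hj Pj. apply le_of_inv. intros n. apply (Ha n); auto.
  - intros j. destruct (el_bounded I A j) as (M & HM). destruct (el_bounded I B j) as (M' & HM').
    exists (Rmax (Rmax M M') 0). intros z (E & Bz & a & Aa & Ei & _).
    pose proof (Rmax_l (Rmax M M') 0). pose proof (Rmax_r (Rmax M M') 0).
    pose proof (Rmax_l M M'). pose proof (Rmax_r M M').
    destruct (classic (j = i)) as [->|Nj]; [rewrite <- Ei; specialize (HM a Aa); lra|].
    destruct (classic (P j)) as [Pj|Pj].
    + specialize (HM' _ Bz). rewrite restr_in in HM'; auto. lra.
    + rewrite E, restr_out, Rabs_R0; [lra|]. intros Qj. apply Pj, QP; auto.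
  - intros z z' al be (E & Bz & a & Aa & Ei & Ha) (E' & Bz' & a' & Aa' & Ei' & Ha') H.
    split; [|split].
    + rewrite restr_comb, <- E, <- E'; auto.
    + rewrite restr_comb; auto. apply el_convex; auto.
    + exists (mp_comb al a be a'). split; [apply el_convex; auto|]. split.
      * unfold mp_comb. rewrite Ei, Ei'. reflexivity.
      * intros j Hj Pj. specialize (Ha j Hj Pj). specialize (Ha' j Hj Pj).
        unfold mp_comb. destruct al as [s|], be as [t|]; simpl in H; try discriminate.
        -- assert (Hr : forall r, Rabs r <= e -> - e <= r <= e).
           { intros r Hr. pose proof (Rle_abs r). pose proof (Rle_abs (- r)). rewrite Rabs_Ropp in *. lra. }
           apply Hr in Ha, Ha'. apply Rabs_le. unfold Rmax. repeat destruct Rle_dec; lra.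
        -- replace (s + a j - (s + z j)) with (a j - z j) by ring. exact Ha.
        -- replace (t + a' j - (t + z' j)) with (a' j - z' j) by ring. exact Ha'.
  - exists A'. split; [|split].
    + apply supported_intro. rewrite EA'. intros z (E & _). exact E.
    + apply mpcc_eq. intros b. split.
      * intros (z & Az & ->). rewrite EA' in Az. apply Az.
      * intros Bb. destruct (N2 b Bb) as (z & (a & Aa & ->) & Hz).
        destruct (mix_S b a Bb Aa Hz) as [Sm Em]. exists (mixp b a). rewrite EA'. auto.
    + assert (Cl : forall a z, el A a -> S z -> a i = z i ->
        (forall j, In j F -> P j -> Rabs (a j - z j) <= e) -> ball F (2 * e) a z).
      { intros a z Aa (E & _) Ei Ha j Hj. destruct (classic (j = i)) as [->|Nj].
        - rewrite Ei, Rminus_diag, Rabs_R0. lra.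
        - destruct (classic (P j)) as [Pj|Pj].
          + rewrite Rabs_minus_sym. specialize (Ha j Hj Pj). lra.
          + rewrite E, (supported_el Q A a), !restr_out, Rminus_diag, Rabs_R0; auto; lra. }
      split.
      * intros a Aa. destruct (N1 (restr P a) (el_mrestr P A a Aa)) as (b & Bb & Hb).
        destruct (mix_S b a Bb Aa Hb) as [Sm Em]. exists (mixp b a). rewrite EA'. split; auto.
        apply Cl; auto. intros j Hj Pj. specialize (Hb j Hj). rewrite restr_in in Hb; auto.
        rewrite mix_j by (intros ->; auto). rewrite Rabs_minus_sym. lra.
      * rewrite EA'. intros z Sz. pose proof Sz as (E & Bz & a & Aa & Ei & Ha). exists a. auto.
Qed.

Lemma psi_rho_open A : supported Q A -> forall F d, 0 < d ->
  ev psi (supported P) (mrestr P A) (fun B => exists A', supported Q A' /\ mrestr P A' = B /\ close psi F d A A').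
Proof.
  intros QA l d Hd. destruct (near_psi_list A l d Hd) as (F & e & He & H).
  eapply ev_mono.
  - apply (ev_sub psi (supported Q)); [intros B; apply supported_sub; auto|].
    apply (ev_psi_near (mrestr P A) F (e/2)); [apply (supported_sub P); auto; apply supported_mrestr|lra].
  - intros B PB HB. destruct (lift_exists A B F (e/2) QA PB ltac:(lra) HB) as (A' & QA' & rA' & N).
    exists A'. split; [|split]; auto. apply H. replace e with (2 * (e/2)) by field. exact N.
Qed.

(* [A''] is a sublevel set of [w (codes k)] in the max-plus convex hull of the
   union of [A] and [A'], the hull being described by the functionals [w]. *)
Lemma psi_conn A A' k r : supported Q A -> supported Q A' -> mrestr P A = mrestr P A' ->
  psi k A <= r <= psi k A' ->
  exists A'', supported Q A'' /\ mrestr P A'' = mrestr P A /\ psi k A'' = r /\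
    forall j, Rmin (psi j A) (psi j A') <= psi j A'' <= Rmax (psi j A) (psi j A').
Proof.
  intros QA QA' Er Hr. pose proof (psi01 k A). pose proof (psi01 k A').
  assert (Hsr : squash (unsquash r) = r) by (apply squash_unsquash; lra).
  set (c := unsquash r) in *.
  assert (Hc1 : phi (codes k) A <= c) by (apply squash_le_inv; rewrite Hsr; apply Hr).
  assert (Hc2 : c <= phi (codes k) A') by (apply squash_le_inv; rewrite Hsr; apply Hr).
  set (S := fun z : pt => (forall f, w f z <= Rmax (phi f A) (phi f A')) /\ w (codes k) z <= c).
  assert (SA : forall a, el A a -> S a).
  { intros a Aa. split.
    - intros f. pose proof (phi_ge I f A a Aa). pose proof (Rmax_l (phi f A) (phi f A')). lra.
    - pose proof (phi_ge I (codes k) A a Aa). lra. }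
  destruct (mpcc_of I S) as (A'' & EA).
  - destruct (el_ne I A) as (a & Aa). exists a. auto.
  - apply pclosed_and; [|apply w_le_closed]. apply pclosed_all. intros f. apply w_le_closed.
  - intros j. exists (Rmax (Rmax (phi (cup j) A) (phi (cup j) A')) (Rmax (phi (cdn j) A) (phi (cdn j) A'))).
    intros z [Hz _]. pose proof (Hz (cup j)) as H1. pose proof (Hz (cdn j)) as H2.
    rewrite w_cup in H1. rewrite w_cdn in H2.
    set (x := Rmax (phi (cup j) A) _) in *. set (y := Rmax (phi (cdn j) A) _) in *.
    pose proof (Rmax_l x y). pose proof (Rmax_r x y). apply Rabs_le. lra.
  - intros a b al be [Ha1 Ha2] [Hb1 Hb2] H1. split.
    + intros f. eapply Rle_trans; [apply w_comb; auto|]. apply Rmax_lub; auto.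
    + eapply Rle_trans; [apply w_comb; auto|]. apply Rmax_lub; auto.
  - assert (Hlow : forall f, phi f A <= phi f A'').
    { intros f. apply phi_le. intros a Aa. apply phi_ge. rewrite EA. auto. }
    assert (Hup : forall f, phi f A'' <= Rmax (phi f A) (phi f A')).
    { intros f. apply phi_le. rewrite EA. intros z [Hz _]. apply Hz. }
    assert (Hx : forall j, ~ Q j -> phi (cup j) A <= 0 /\ phi (cup j) A' <= 0 /\
       phi (cdn j) A <= 0 /\ phi (cdn j) A' <= 0).
    { intros j Qj. repeat split; apply phi_le; intros a Aa; rewrite ?w_cup, ?w_cdn;
      [rewrite (supported_el Q A a)|rewrite (supported_el Q A' a)|rewrite (supported_el Q A a)|rewrite (supported_el Q A' a)];
      rewrite ?restr_out; auto; lra. }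
    exists A''. split; [|split; [|split]].
    + apply supported_intro. rewrite EA. intros z [Hz _]. apply functional_extensionality. intros j.
      destruct (classic (Q j)) as [Qj|Qj]; [rewrite restr_in; auto|rewrite restr_out; auto].
      destruct (Hx j Qj) as (H1 & H2 & H3 & H4).
      pose proof (Hz (cup j)) as U. pose proof (Hz (cdn j)) as V. rewrite w_cup in U. rewrite w_cdn in V.
      assert (Rmax (phi (cup j) A) (phi (cup j) A') <= 0) by (apply Rmax_lub; auto).
      assert (Rmax (phi (cdn j) A) (phi (cdn j) A') <= 0) by (apply Rmax_lub; auto). lra.
    + apply mpcc_eq. intros b. split.
      * intros (z & Az & ->). rewrite EA in Az. destruct Az as [Hz _]. apply mpcc_sep. intros f.
        (* By [Er] both sets have equal values on functionals pulled back from P, so the bound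
           defining the hull collapses and no new point appears over P. *)
        rewrite w_rcode. specialize (Hz (rcode P f)). rewrite <- !phi_rcode, <- Er in Hz.
        rewrite Rmax_left in Hz by lra. exact Hz.
      * intros (a & Aa & ->). apply el_mrestr. rewrite EA. auto.
    + unfold psi. rewrite <- Hsr. f_equal. apply Rle_antisym.
      * apply phi_le. rewrite EA. intros z [_ Hz]. exact Hz.
      (* The level c is attained on the segment joining a maximiser for A to one for A'; the segment
         stays in the hull. *)
      * destruct (argw_spec I (codes k) A) as [Aa _]. destruct (argw_spec I (codes k) A') as [Aa' _].
        set (a := argw (codes k) A) in *. set (a' := argw (codes k) A') in *.
        destruct (path_level (codes k) a a' c) as (s & Hs); [split; auto|].
        rewrite <- Hs. apply phi_ge. rewrite EA. split; [|lra]. intros f.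
        eapply Rle_trans; [apply w_comb, path_coef|].
        apply Rmax_lub; [eapply Rle_trans; [|apply Rmax_l]|eapply Rle_trans; [|apply Rmax_r]];
        apply phi_ge; auto.
    + intros j. split.
      * eapply Rle_trans; [apply Rmin_l|]. apply squash_le, Hlow.
      * unfold psi. specialize (Hup (codes j)). apply Rmax_case_strong; intros L; apply squash_le;
        apply squash_le_inv in L; (eapply Rle_trans; [exact Hup|]); apply Rmax_lub; lra.
Qed.

(** The sets [As m] live over the compact B and have their new coordinate eventually bounded, so
    points chosen in them accumulate. The decreasing closed conditions [T n] prescribe what the
    accumulation point must satisfy. *)
Lemma lim_point B (As : nat -> X) (tau : nat -> R) (T : nat -> pt -> Prop) : supported P B ->
  (forall n, supported Q (As n) /\ mrestr P (As n) = B) ->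
  (forall k, Un_cv (fun n => phi (codes k) (As n)) (tau k)) ->
  (forall n, pclosed (T n)) -> (forall n m z, (n <= m)%nat -> T m z -> T n z) ->
  (forall n N, exists m, (N <= m)%nat /\ exists z, el (As m) z /\ T n z) ->
  exists z, z = restr Q z /\ el B (restr P z) /\ (forall k, w (codes k) z <= tau k) /\ forall n, T n z.
Proof.
  intros PB HAs Hcv Tc Tm Tne.
  destruct (codes_surj (i :: nil) (cup i)) as (k1 & E1).
  { intros j [<-|[]]. auto. } { split; [intros j [E|[E|[]]]; [injection E as <-; left; auto|discriminate]|intros ? []]. }
  destruct (codes_surj (i :: nil) (cdn i)) as (k2 & E2).
  { intros j [<-|[]]. auto. } { split; [intros j [E|[E|[]]]; [discriminate|injection E as <-; left; auto]|intros ? []]. }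
  (* Eventually both extreme values of coordinate i are within 1 of their limits. *)
  set (M := Rmax (tau k1) (tau k2) + 1).
  set (K := fun z : pt => z = restr Q z /\ el B (restr P z) /\ Rabs (z i) <= M).
  assert (HK : compact_in (prod_open I) K).
  { apply closed_bounded_compact.
    - apply pclosed_and; [apply pclosed_supp|]. apply pclosed_and; [apply pclosed_restr, el_closed|].
      intros z Hz. apply le_epsilon. intros e He. destruct (Hz (i :: nil) e He) as (a & H1 & H2).
      specialize (H2 i (or_introl eq_refl)). replace (z i) with (a i - (a i - z i)) by ring.
      eapply Rle_trans; [apply Rabs_triang|]. rewrite Rabs_Ropp. lra.
    - intros j. destruct (el_bounded I B j) as (M' & HM'). exists (Rmax (Rmax M M') 0).
      intros z (E & Bz & Hi).
      pose proof (Rmax_l (Rmax M M') 0). pose proof (Rmax_r (Rmax M M') 0).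
      pose proof (Rmax_l M M'). pose proof (Rmax_r M M').
      destruct (classic (j = i)) as [->|Nj]; [lra|].
      destruct (classic (P j)) as [Pj|Pj].
      + specialize (HM' _ Bz). rewrite restr_in in HM'; auto. lra.
      + rewrite E, restr_out, Rabs_R0; [lra|]. intros Qj. apply Pj, QP; auto. }
  destruct (compact_fip I K ((nat * nat) + nat) (fun x z => match x with
     | inl (k, n) => w (codes k) z <= tau k + / INR (n + 1) | inr n => T n z end) HK) as (z & (Ez & Bz & _) & Hz).
  - intros [[k n]|n]; auto. apply w_le_closed.
  - intros js.
    assert (Hev : exists N, forall m, (N <= m)%nat -> forall x, In x js ->
      match x with inl (k, n) => phi (codes k) (As m) <= tau k + / INR (n + 1) | inr _ => True end).
    { induction js as [|x js (N & HN)].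
      - exists O. intros m _ x [].
      - assert (Hx : exists N', forall m, (N' <= m)%nat -> match x with
          inl (k, n) => phi (codes k) (As m) <= tau k + / INR (n + 1) | inr _ => True end).
        { destruct x as [[k n]|n]; [|exists O; auto].
          destruct (Hcv k (/ INR (n + 1)) (inv_pos n)) as (N' & HN'). exists N'. intros m Hm.
          specialize (HN' m Hm). unfold Rdist in HN'. apply Rabs_def2 in HN'. lra. }
        destruct Hx as (N' & HN'). exists (max N N'). intros m Hm x' [<-|Hx'].
        + apply HN'. lia.
        + apply HN; auto. lia. }
    destruct Hev as (N & HN).
    destruct (Hcv k1 1 ltac:(lra)) as (N1 & HN1). destruct (Hcv k2 1 ltac:(lra)) as (N2 & HN2).
    set (n0 := list_max (map (fun x : nat * nat + nat => match x with inl _ => O | inr n => n end) js)).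
    destruct (Tne n0 (max N (max N1 N2))) as (m & Hm & z & Az & Tz).
    exists z. split.
    + destruct (HAs m) as [Qm rm]. split; [apply (supported_el Q (As m)); auto|]. split.
      * rewrite <- rm. apply el_mrestr. auto.
      * assert (G1 := HN1 m ltac:(lia)). assert (G2 := HN2 m ltac:(lia)). unfold Rdist in *.
        rewrite E1 in G1. rewrite E2 in G2.
        apply Rabs_def2 in G1. apply Rabs_def2 in G2.
        pose proof (phi_ge I (cup i) _ z Az) as U. pose proof (phi_ge I (cdn i) _ z Az) as V.
        rewrite w_cup in U. rewrite w_cdn in V.
        pose proof (Rmax_l (tau k1) (tau k2)). pose proof (Rmax_r (tau k1) (tau k2)).
        apply Rabs_le. unfold M. lra.
    + intros [[k n]|n] Hx.
      * eapply Rle_trans; [apply phi_ge; exact Az|]. apply (HN m ltac:(lia) _ Hx).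
      * apply (Tm n n0); auto.
        pose proof (proj1 (list_max_le (map (fun x : nat * nat + nat => match x with inl _ => O | inr n => n end) js) n0) (le_n _)) as H.
        rewrite Forall_forall in H. apply H. apply in_map_iff. exists (inr n). auto.
  - exists z. split; [|split; [|split]]; auto.
    + intros k. apply le_of_inv. intros n. apply (Hz (inl (k, n))).
    + intros n. apply (Hz (inr n)).
Qed.

(** The limit set is cut out over B by the limiting bounds. [lim_point] is applied twice: with a
    prescribed projection, to show that it maps onto B, and with w at least tau_k - 1/(n+1), to show
    that each bound is attained. *)
Lemma psi_lim B (As : nat -> X) (t : nat -> R) : supported P B ->
  (forall n, supported Q (As n) /\ mrestr P (As n) = B) -> (forall k, 0 < t k < 1) ->
  (forall k, Un_cv (fun n => psi k (As n)) (t k)) ->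
  exists A, supported Q A /\ mrestr P A = B /\ forall k, psi k A = t k.
Proof.
  intros PB HAs Ht Hcv. set (tau := fun k => unsquash (t k)).
  assert (Hcv' : forall k, Un_cv (fun n => phi (codes k) (As n)) (tau k)).
  { intros k e He. destruct (unsquash_cont (t k) e (Ht k) He) as (d & Hd & H).
    destruct (Hcv k d Hd) as (N & HN). exists N. intros n Hn. specialize (HN n Hn).
    unfold Rdist in *. unfold tau. rewrite <- (unsquash_squash (phi (codes k) (As n))).
    apply H; auto. apply squash_bounds. }
  set (S := fun z : pt => z = restr Q z /\ el B (restr P z) /\ forall k, w (codes k) z <= tau k).
  assert (Hb : forall b, el B b -> exists z, S z /\ restr P z = b).
  { intros b Bb. destruct (lim_point B As tau (fun _ z => restr P z = b) PB HAs Hcv') as (z & Ez & Bz & Hz & Tz).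
    - intros _. apply (pclosed_eq (restr P) (fun _ => b)). intros j. exists (j :: nil). intros e He.
      exists e. split; auto. intros x y H. rewrite Rminus_diag, Rabs_R0. split; auto.
      apply (restr_ball P (j :: nil) e x y); auto. left. auto.
    - auto.
    - intros _ N. exists N. split; auto. destruct (HAs N) as [QN rN]. rewrite <- rN in Bb.
      destruct Bb as (a & Aa & ->). exists a. auto.
    - exists z. split; [split; [|split]|apply (Tz O)]; auto. }
  assert (Hk : forall k, exists z, S z /\ tau k <= w (codes k) z).
  { intros k. destruct (lim_point B As tau (fun n z => tau k - / INR (n + 1) <= w (codes k) z) PB HAs Hcv') as (z & Ez & Bz & Hz & Tz).
    - intros n. apply w_ge_closed.
    - intros n m z L H. assert (/ INR (m + 1) <= / INR (n + 1)); [|lra].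
      apply Rinv_le_contravar; [apply lt_0_INR; lia|apply le_INR; lia].
    - intros n N. destruct (Hcv' k (/ INR (n + 1)) (inv_pos n)) as (N' & HN').
      exists (max N N'). split; [lia|]. exists (argw (codes k) (As (max N N'))). split; [apply argw_spec|].
      assert (G := HN' (max N N') ltac:(lia)). unfold Rdist in G. apply Rabs_def2 in G. unfold phi in G. lra.
    - exists z. split; [split; [|split]; auto|]. apply le_of_inv. intros n. specialize (Tz n). simpl in Tz. lra. }
  destruct (mpcc_of I S) as (A & EA).
  - destruct (el_ne I B) as (b & Bb). destruct (Hb b Bb) as (z & Sz & _). eauto.
  - apply pclosed_and; [apply pclosed_supp|]. apply pclosed_and; [apply pclosed_restr, el_closed|].
    apply pclosed_all. intros k. apply w_le_closed.
  - intros j. destruct (classic (j = i)) as [->|Nj].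
    + destruct (codes_surj (i :: nil) (cup i)) as (k1 & E1).
      { intros j [<-|[]]. auto. } { split; [intros j [E|[E|[]]]; [injection E as <-; left; auto|discriminate]|intros ? []]. }
      destruct (codes_surj (i :: nil) (cdn i)) as (k2 & E2).
      { intros j [<-|[]]. auto. } { split; [intros j [E|[E|[]]]; [discriminate|injection E as <-; left; auto]|intros ? []]. }
      exists (Rmax (tau k1) (tau k2)). intros z (_ & _ & Hz).
      pose proof (Hz k1) as U. pose proof (Hz k2) as V. rewrite E1, w_cup in U. rewrite E2, w_cdn in V.
      pose proof (Rmax_l (tau k1) (tau k2)). pose proof (Rmax_r (tau k1) (tau k2)). apply Rabs_le. lra.
    + destruct (el_bounded I B j) as (M' & HM'). exists (Rmax M' 0).
      pose proof (Rmax_l M' 0). pose proof (Rmax_r M' 0).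
      intros z (E & Bz & _). destruct (classic (P j)) as [Pj|Pj].
      * specialize (HM' _ Bz). rewrite restr_in in HM'; auto. lra.
      * rewrite E, restr_out, Rabs_R0; [lra|]. intros Qj. apply Pj, QP; auto.
  - intros z z' al be (E & Bz & Hz) (E' & Bz' & Hz') H. split; [|split].
    + rewrite restr_comb, <- E, <- E'; auto.
    + rewrite restr_comb; auto. apply el_convex; auto.
    + intros k. eapply Rle_trans; [apply w_comb; auto|]. apply Rmax_lub; auto.
  - exists A. split; [|split].
    + apply supported_intro. rewrite EA. intros z (E & _). exact E.
    + apply mpcc_eq. intros b. split.
      * intros (z & Az & ->). rewrite EA in Az. apply Az.
      * intros Bb. destruct (Hb b Bb) as (z & Sz & <-). apply el_mrestr. rewrite EA. exact Sz.
    + intros k. unfold psi. rewrite <- (squash_unsquash (t k)) by auto. f_equal. apply Rle_antisym.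
      * apply phi_le. rewrite EA. intros z (_ & _ & Hz). apply Hz.
      * destruct (Hk k) as (z & Sz & L). eapply Rle_trans; [exact L|]. apply phi_ge. rewrite EA. exact Sz.
Qed.

End Step.
End Restrict.

(** * Assembling along the well-order *)

Section Global.
Variable I : Type.
Notation pt := (I -> R).
Notation X := (mpcc I).
Implicit Types (P Q : I -> Prop) (A B : X).

Lemma ev_near_of_cts {T K : Type} (c : K -> T -> R) D (B : T -> X) s F e :
  (forall f, cts c D (fun t => phi f (B t))) -> D s -> 0 < e ->
  ev c D s (fun t => near F e (B s) (B t)).
Proof.
  intros H Ds He. destruct (near_phi I (B s) F e He) as (L & _ & d & Hd & HN).
  eapply ev_mono.
  - apply (ev_list _ _ c D s (fun f t => Rabs (phi f (B t) - phi f (B s)) < d) L).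
    intros f _. apply (H f s Ds d Hd).
  - intros t _ Ht. apply HN. exact Ht.
Qed.

Lemma cts_of_ev_near {T K : Type} (c : K -> T -> R) D (B : T -> X) :
  (forall s F e, D s -> 0 < e -> ev c D s (fun t => near F e (B s) (B t))) ->
  forall f, cts c D (fun t => phi f (B t)).
Proof.
  intros H f s Ds e He. eapply ev_mono; [apply (H s (supp f) (e/4) Ds); lra|].
  intros t _ Ht. rewrite Rabs_minus_sym.
  pose proof (phi_near I f (e/4) _ _ ltac:(lra) Ht). lra.
Qed.

Definition xc := prodc (@phi I) (@seqc nat).

Lemma psi_cts_phi enm dcd n D : cts (@phi I) D (fun A => psi I enm dcd n A).
Proof. unfold psi. apply cts_squash. apply (cts_coord _ _ (@phi I) D (codes I enm dcd n)). Qed.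

(** The two directions are packed into one pair so that a single choice selects them for all i. The
    countable family [psi] is exchanged for all functionals, which induce the same topology on
    X_Q. *)
Lemma step_homeo P Q (i : I) (enm : nat -> option I) :
  (forall j, P j -> Q j) -> (forall j, Q j -> j <> i -> P j) -> Q i -> ~ P i ->
  (exists n, enm n = None) -> (forall j, Q j -> exists n, enm n = Some j) ->
  exists hg : (X -> (nat -> R) -> nat -> R) * (X -> (nat -> R) -> X * (nat -> R)),
    (forall A y, supported I Q A -> snd hg (mrestr I P A) (fst hg A y) = (A, y)) /\
    (forall B z, supported I P B -> supported I Q (fst (snd hg B z)) /\ mrestr I P (fst (snd hg B z)) = B /\
      fst hg (fst (snd hg B z)) (snd (snd hg B z)) = z) /\
    (forall n, cts xc (fun p => supported I Q (fst p)) (fun p => fst hg (fst p) (snd p) n)) /\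
    (forall f, cts xc (fun p => supported I P (fst p)) (fun p => phi f (fst (snd hg (fst p) (snd p))))) /\
    (forall n, cts xc (fun p => supported I P (fst p)) (fun p => snd (snd hg (fst p) (snd p)) n)).
Proof.
  intros PQ QP Qi Pi En Es. destruct Encoding.ncode_enum as (dcd & Hdn).
  set (ps := psi I enm dcd).
  set (fw := fwd X (supported I Q) (supported I P) (mrestr I P) ps).
  set (ba := bwdA X (supported I Q) (supported I P) (mrestr I P) ps).
  set (bwy := bwdy X (supported I Q) (supported I P) (mrestr I P) ps).
  assert (H0 : forall B, supported I P B -> supported I Q B) by (intros B; apply supported_sub; auto).
  assert (H1 : forall A, supported I Q A -> supported I P (mrestr I P A)) by (intros A _; apply supported_mrestr).
  assert (H2 : forall B, supported I P B -> mrestr I P B = B) by auto.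
  pose proof (psi01 I enm dcd) as H3.
  pose proof (psi_sep I Q enm dcd En Es Hdn) as H4.
  pose proof (psi_rho_cts I P Q enm dcd En Es Hdn) as H5.
  pose proof (psi_rho_open I P Q i enm dcd PQ QP Qi Pi En Es Hdn) as H6.
  pose proof (psi_conn I P Q enm dcd) as H7.
  pose proof (psi_lim I P Q i enm dcd QP Qi En Es Hdn) as H8.
  assert (Hcv : forall D, (forall k, cts xc D (fun p => pc X ps k p))).
  { intros D [k|k]; simpl.
    - apply (cts_comp xc D (@phi I) (fun _ => True) fst (ps k)); auto; [apply psi_cts_phi|].
      intros f. apply (cts_coord _ _ xc D (inl f)).
    - apply (cts_coord _ _ xc D (inr k)). }
  assert (Hcomp : forall (D : X * (nat -> R) -> Prop) g, cts (pc X ps) D g -> cts xc D g).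
  { intros D g Hg. apply (cts_comp xc D (pc X ps) D (fun p => p) g); auto. }
  exists (fw, fun B z => (ba B z, bwy B z)). simpl. split; [|split; [|split; [|split]]].
  - intros A y QA. f_equal; [apply bwdA_fwd; auto|apply bwdy_fwd; auto].
  - intros B z PB. destruct (bwdA_spec X (supported I Q) (supported I P) (mrestr I P) ps H0 H2 H3 H6 H7 H8 B z PB) as (? & ? & _).
    split; [|split]; auto. apply fwd_bwd; auto.
  - intros n. apply Hcomp. apply fwd_cts; auto.
  - intros f. apply Hcomp.
    apply (cts_comp (pc X ps) _ ps (supported I Q) (fun p => ba (fst p) (snd p)) (phi f)).
    + apply (cts_of_ev_near ps (supported I Q) (fun A => A)). intros A F e QA He.
      apply (ev_psi_near I Q enm dcd En Es Hdn); auto.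
    + intros p Pp. apply (bwdA_spec X (supported I Q) (supported I P) (mrestr I P) ps H0 H2 H3 H6 H7 H8); auto.
    + intros k. apply bwdA_cts; auto.
  - intros n. apply Hcomp. apply bwdy_cts; auto.
Qed.

Section Tower.
Variable lt : I -> I -> Prop.
Hypothesis lt_irr : forall x, ~ lt x x.
Hypothesis lt_tr : forall x y z, lt x y -> lt y z -> lt x z.
Hypothesis lt_tot : forall x y, lt x y \/ x = y \/ lt y x.
Hypothesis lt_wf : well_founded lt.
Hypothesis lt_cnt : forall x, countable_set (fun y => lt y x).

Definition below (i : I) : I -> Prop := fun j => lt j i.
Definition upto (i : I) : I -> Prop := fun j => j = i \/ lt j i.

Definition down P : Prop := forall i j, P i -> lt j i -> P j.

Lemma upto_sub P i : down P -> P i -> forall j, upto i j -> P j.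
Proof. intros HP Pi j [->|Hj]; eauto. Qed.

Lemma down_below i : down (below i).
Proof. intros j k Hj Hk. unfold below in *. eauto. Qed.

Lemma upto_upto i j : upto i j -> forall k, upto j k -> upto i k.
Proof. intros [->|H] k [->|Hk]; unfold upto; eauto. Qed.

Lemma below_upto i j : below i j -> upto i j.
Proof. right. auto. Qed.

Lemma down_max P (F : list I) :
  (forall j, In j F -> ~ P j) \/ exists m, P m /\ forall j, In j F -> P j -> upto m j.
Proof.
  induction F as [|x F IH]; [left; intros j []|].
  destruct (classic (P x)) as [Px|Px].
  - right. destruct IH as [IH|(m & Pm & IH)].
    + exists x. split; auto. intros j [<-|Hj] Pj; [left; auto|]. destruct (IH j Hj Pj).
    + destruct (lt_tot x m) as [L|[L|L]].
      * exists m. split; auto. intros j [<-|Hj] Pj; [right; auto|auto].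
      * subst x. exists m. split; auto. intros j [<-|Hj] Pj; [left; auto|auto].
      * exists x. split; auto. intros j [<-|Hj] Pj; [left; auto|].
        destruct (IH j Hj Pj) as [->|L']; right; eauto.
  - destruct IH as [IH|(m & Pm & IH)].
    + left. intros j [<-|Hj]; auto.
    + right. exists m. split; auto. intros j [<-|Hj] Pj; [tauto|auto].
Qed.

(** The coordinates of F inside P lie at or below the largest of them, m, so a basic neighbourhood
    in X_P is visible on X_(upto m): X_P carries the inverse limit topology. In the first
    alternative F misses P and cannot distinguish the sets. *)
Lemma near_tower P F e : down P -> 0 < e ->
  (forall A B, supported I P A -> supported I P B -> near F e A B) \/
  exists m, P m /\ forall A B, supported I P A -> supported I P B ->
    near F e (mrestr I (upto m) A) (mrestr I (upto m) B) -> near F e A B.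
Proof.
  intros HP He. destruct (down_max P F) as [H|(m & Pm & H)].
  - left. intros A B HA HB. apply (near_filter I P); auto.
    assert (E : forall j, ~ In j (filter (fun i => if excluded_middle_informative (P i) then true else false) F)).
    { intros j Hj. apply filter_In in Hj. destruct Hj as [Hj E].
      destruct excluded_middle_informative; [apply (H j); auto|discriminate]. }
    split.
    + intros a _. destruct (el_ne I B) as (b & Bb). exists b. split; auto. intros j Hj. destruct (E j Hj).
    + intros b _. destruct (el_ne I A) as (a & Aa). exists a. split; auto. intros j Hj. destruct (E j Hj).
  - right. exists m. split; auto. intros A B HA HB HN. apply (near_filter I P); auto.
    apply (near_of_mrestr I (upto m)).
    + intros j Hj. apply filter_In in Hj. destruct Hj as [Hj E].
      destruct excluded_middle_informative; [apply H; auto|discriminate].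
    + eapply near_weaken; [| |exact HN]; [apply incl_filter|lra].
Qed.

Lemma mrestr_upto P m A : down P -> P m -> mrestr I (upto m) (mrestr I P A) = mrestr I (upto m) A.
Proof. intros HP Pm. apply mrestr_mrestr. apply upto_sub; auto. Qed.

Lemma tower_eq P A B : down P -> (forall j, P j -> mrestr I (upto j) A = mrestr I (upto j) B) ->
  mrestr I P A = mrestr I P B.
Proof.
  intros HP H. apply near_eq. intros F e He.
  destruct (near_tower P F e HP He) as [HN|(m & Pm & HN)]; apply HN; try apply supported_mrestr.
  rewrite !mrestr_upto, H; auto. apply near_refl. auto.
Qed.

Lemma tower_cts {T K : Type} (c : K -> T -> R) D (B : T -> X) P : down P ->
  (forall j, P j -> forall f, cts c D (fun s => phi f (mrestr I (upto j) (B s)))) ->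
  forall f, cts c D (fun s => phi f (mrestr I P (B s))).
Proof.
  intros HP H. apply cts_of_ev_near. intros s F e Ds He.
  destruct (near_tower P F e HP He) as [HN|(m & Pm & HN)].
  - apply ev_all. intros t _. apply HN; apply supported_mrestr.
  - eapply ev_mono; [apply (ev_near_of_cts c D (fun s => mrestr I (upto m) (B s)) s F e (H m Pm) Ds He)|].
    intros t _ Ht. apply HN; try apply supported_mrestr. rewrite !mrestr_upto; auto.
Qed.

(** The inverse limit of a compatible family, with coordinate i bounded through [fam i]. Compactness
    is needed to extend a point of one member to a compatible point of all. *)
Lemma tower_limit P (fam : I -> X) : down P ->
  (forall j, P j -> supported I (upto j) (fam j)) ->
  (forall j k, P j -> upto j k -> mrestr I (upto k) (fam j) = fam k) ->
  exists B, supported I P B /\ forall j, P j -> mrestr I (upto j) B = fam j.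
Proof.
  intros HP HX Hc.
  assert (Hb : exists M : I -> R, forall i, P i -> forall a j, P j -> el (fam j) a -> upto j i -> Rabs (a i) <= M i).
  { destruct (choice (fun i M => forall a, el (fam i) a -> Rabs (a i) <= M) (fun i => el_bounded I (fam i) i)) as (M & HM).
    exists M. intros i Pi a j Pj Aa Hij. rewrite <- (restr_in I (upto i) a i) by (left; auto).
    apply HM. rewrite <- (Hc j i); auto. apply el_mrestr. auto. }
  destruct Hb as (M & HM).
  set (S := fun z : pt => z = restr I P z /\ forall j, P j -> el (fam j) (restr I (upto j) z)).
  assert (Sb : pbounded S).
  { intros i. exists (Rmax (M i) 0). intros z [E Hz]. destruct (classic (P i)) as [Pi|Pi].
    - eapply Rle_trans; [|apply Rmax_l]. rewrite <- (restr_in I (upto i) z i) by (left; auto).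
      apply (HM i Pi _ i); auto. left. auto.
    - rewrite E, restr_out, Rabs_R0; auto. apply Rmax_r. }
  assert (Sc : pclosed S).
  { apply pclosed_and; [apply pclosed_supp|]. apply pclosed_all. intros j z Hz Pj.
    apply (pclosed_restr I (upto j) (el (fam j)) (el_closed I (fam j))). intros F e He.
    destruct (Hz F e He) as (a & Ha & Hb). exists a. auto. }
  assert (Sl : forall i b, P i -> el (fam i) b -> exists z, S z /\ restr I (upto i) z = b).
  { intros i b Pi Bb.
    set (K := fun z : pt => z = restr I P z /\ (forall j, Rabs (z j) <= Rmax (M j) 0) /\ restr I (upto i) z = b).
    assert (HK : compact_in (prod_open I) K).
    { apply closed_bounded_compact.
      - apply pclosed_and; [apply pclosed_supp|]. apply pclosed_and.
        + apply pclosed_all. intros j z Hz. apply le_epsilon. intros e He.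
          destruct (Hz (j :: nil) e He) as (a & H1 & H2).
          specialize (H2 j (or_introl eq_refl)). replace (z j) with (a j - (a j - z j)) by ring.
          eapply Rle_trans; [apply Rabs_triang|]. rewrite Rabs_Ropp. lra.
        + apply (pclosed_eq I (restr I (upto i)) (fun _ => b)). intros j. exists (j :: nil). intros e He.
          exists e. split; auto. intros x y H. rewrite Rminus_diag, Rabs_R0. split; auto.
          apply (restr_ball I (upto i) (j :: nil) e x y); auto. left. auto.
      - intros j. exists (Rmax (M j) 0). intros a (_ & H & _). auto. }
    destruct (compact_fip I K I (fun j z => P j -> el (fam j) (restr I (upto j) z)) HK) as (z & (Ez & _ & Ei) & Hz).
    - intros j z Hz Pj. apply (pclosed_restr I (upto j) (el (fam j)) (el_closed I (fam j))). intros F e He.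
      destruct (Hz F e He) as (a & Ha & Hb). exists a. auto.
    (* Finitely many conditions are met by a point of [fam m], for m the largest index involved,
       that restricts to b. *)
    - intros js. destruct (down_max P (i :: js)) as [H|(m & Pm & H)].
      { destruct (H i (or_introl eq_refl) Pi). }
      assert (Him : upto m i) by (apply H; auto; left; auto).
      rewrite <- (Hc m i Pm Him) in Bb. destruct Bb as (z & Az & ->).
      pose proof (supported_el I (upto m) (fam m) z (HX m Pm) Az) as Ez.
      exists z. split; [split; [|split]|].
      + rewrite Ez. symmetry. apply restr_restr'. apply upto_sub; auto.
      + intros j. destruct (classic (upto m j)) as [Hj|Hj].
        * eapply Rle_trans; [|apply Rmax_l]. apply (HM j) with m; auto. apply (upto_sub P m); auto.
        * rewrite Ez, restr_out, Rabs_R0; auto. apply Rmax_r.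
      + auto.
      + intros j Hj Pj. rewrite <- (Hc m j Pm); [apply el_mrestr; auto|]. apply H; auto. right. auto.
    - exists z. split; auto. split; auto. }
  destruct (mpcc_of I S) as (B & EB).
  - destruct (classic (exists i, P i)) as [(i & Pi)|N].
    + destruct (el_ne I (fam i)) as (b & Bb). destruct (Sl i b Pi Bb) as (z & Sz & _). eauto.
    + exists (fun _ => 0). split; [|intros j Pj; destruct N; eauto].
      apply functional_extensionality. intros j. unfold restr. destruct excluded_middle_informative; auto.
  - auto.
  - auto.
  - intros z z' al be [E Hz] [E' Hz'] H. split.
    + rewrite restr_comb, <- E, <- E'; auto.
    + intros j Pj. rewrite restr_comb; auto. apply el_convex; auto.
  - exists B. split.
    + apply supported_intro. rewrite EB. intros z [E _]. exact E.
    + intros j Pj. apply mpcc_eq. intros b. split.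
      * intros (z & Bz & ->). rewrite EB in Bz. apply Bz. auto.
      * intros Bb. destruct (Sl j b Pj Bb) as (z & Sz & <-). apply el_mrestr. rewrite EB. exact Sz.
Qed.

(** Countability of initial segments enters the tower through this enumeration, which makes the
    codes on X_(upto i) countable. *)
Lemma upto_enum i : exists enm : nat -> option I,
  (exists n, enm n = None) /\ forall j, upto i j -> exists n, enm n = Some j.
Proof.
  destruct (lt_cnt i) as (f & Hf).
  destruct (choice (fun (n : nat) (o : option I) => match n with
    | O => o = None | S O => o = Some i
    | S (S n) => forall j, lt j i -> f j = n -> o = Some j end)) as (enm & Hen).
  { intros [|[|n]]; eauto. destruct (classic (exists j, lt j i /\ f j = n)) as [(j & Hj & Ej)|N].
    - exists (Some j). intros k Hk Ek. f_equal. apply Hf; auto. congruence.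
    - exists None. intros j Hj Ej. destruct N. eauto. }
  exists enm. split; [exists O; apply (Hen O)|]. intros j [->|Hj]; [exists 1%nat; apply (Hen 1%nat)|].
  exists (S (S (f j))). apply (Hen (S (S (f j)))); auto.
Qed.

Lemma mpcc_inhabited : exists A : X, True.
Proof.
  destruct (mpcc_of I (fun z => z = restr I (fun _ => False) z)) as (A & _); [| | | |exists A; auto].
  - exists (fun _ => 0). apply functional_extensionality. intros i. rewrite restr_out; auto.
  - apply pclosed_supp.
  - intros i. exists 0. intros z ->. rewrite restr_out, Rabs_R0; auto. lra.
  - intros a b al be Ha Hb H. rewrite restr_comb, <- Ha, <- Hb; auto.
Qed.

Definition yc (k : I * nat) (y : I -> nat -> R) : R := y (fst k) (snd k).

Theorem tower_homeo : exists (H : X * (I -> nat -> R) -> I -> nat -> R)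
  (G : (I -> nat -> R) -> X * (I -> nat -> R)),
  (forall p, G (H p) = p) /\ (forall z, H (G z) = z) /\
  (forall i n, cts (prodc (@phi I) yc) (fun _ => True) (fun p => H p i n)) /\
  (forall f, cts yc (fun _ => True) (fun z => phi f (fst (G z)))) /\
  (forall i n, cts yc (fun _ => True) (fun z => snd (G z) i n)).
Proof.
  assert (Hst : forall i, exists hg : (X -> (nat -> R) -> nat -> R) * (X -> (nat -> R) -> X * (nat -> R)),
    (forall A y, supported I (upto i) A -> snd hg (mrestr I (below i) A) (fst hg A y) = (A, y)) /\
    (forall B z, supported I (below i) B -> supported I (upto i) (fst (snd hg B z)) /\
      mrestr I (below i) (fst (snd hg B z)) = B /\ fst hg (fst (snd hg B z)) (snd (snd hg B z)) = z) /\
    (forall n, cts xc (fun p => supported I (upto i) (fst p)) (fun p => fst hg (fst p) (snd p) n)) /\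
    (forall f, cts xc (fun p => supported I (below i) (fst p)) (fun p => phi f (fst (snd hg (fst p) (snd p))))) /\
    (forall n, cts xc (fun p => supported I (below i) (fst p)) (fun p => snd (snd hg (fst p) (snd p)) n))).
  { intros i. destruct (upto_enum i) as (enm & En & Es). apply (step_homeo _ _ i enm); auto.
    - apply below_upto.
    - intros j [E|L] N; [tauto|exact L].
    - left. reflexivity.
    - apply lt_irr. }
  apply choice in Hst. destruct Hst as (hg & Hhg).
  set (h := fun i => fst (hg i)). set (g := fun i => snd (hg i)).
  assert (gh : forall i A y, supported I (upto i) A -> g i (mrestr I (below i) A) (h i A y) = (A, y)) by (intros i; apply (Hhg i)).
  assert (hgs : forall i B z, supported I (below i) B -> supported I (upto i) (fst (g i B z)) /\
     mrestr I (below i) (fst (g i B z)) = B /\ h i (fst (g i B z)) (snd (g i B z)) = z) by (intros i; apply (Hhg i)).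
  assert (hc : forall i n, cts xc (fun p => supported I (upto i) (fst p)) (fun p => h i (fst p) (snd p) n)) by (intros i; apply (Hhg i)).
  assert (gAc : forall i f, cts xc (fun p => supported I (below i) (fst p)) (fun p => phi f (fst (g i (fst p) (snd p))))) by (intros i; apply (Hhg i)).
  assert (gyc : forall i n, cts xc (fun p => supported I (below i) (fst p)) (fun p => snd (g i (fst p) (snd p)) n)) by (intros i; apply (Hhg i)).
  clearbody h g. clear hg Hhg.
  (* The set A accounts for the i-th datum. Stating the recursion as a relation, with uniqueness and
     existence by well-founded induction, keeps compatibility proofs out of the recursive values. *)
  set (sol := fun (z : I -> nat -> R) A i => exists y, h i (mrestr I (upto i) A) y = z i).
  assert (sol_g : forall z A i, sol z A i -> mrestr I (upto i) A = fst (g i (mrestr I (below i) A) (z i))).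
  { intros z A i (y & Hy). rewrite <- Hy.
    replace (mrestr I (below i) A) with (mrestr I (below i) (mrestr I (upto i) A)) by (apply mrestr_mrestr, below_upto).
    rewrite gh by apply supported_mrestr. reflexivity. }
  assert (uniq : forall z A A' i, (forall j, upto i j -> sol z A j) -> (forall j, upto i j -> sol z A' j) ->
    mrestr I (upto i) A = mrestr I (upto i) A').
  { intros z A A' i. induction (lt_wf i) as [i _ IH]. intros HA HA'.
    rewrite (sol_g z A i), (sol_g z A' i); try (apply HA || apply HA'; left; auto).
    rewrite (tower_eq (below i) A A'); auto; [apply down_below|].
    intros j Hj. apply IH; auto; intros k Hk; [apply HA|apply HA']; apply (upto_upto i j); auto; right; auto. }
  assert (sol_mrestr : forall z A i j, upto i j -> (sol z (mrestr I (upto i) A) j <-> sol z A j)).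
  { intros z A i j Hij. unfold sol. rewrite mrestr_mrestr by (apply upto_upto; auto). tauto. }
  assert (exi : forall z i, exists A, supported I (upto i) A /\ forall j, upto i j -> sol z A j).
  { intros z i. induction (lt_wf i) as [i _ IH].
    assert (IH' : forall j, exists A, lt j i -> supported I (upto j) A /\ forall k, upto j k -> sol z A k).
    { intros j. destruct (classic (lt j i)) as [L|L].
      - destruct (IH j L) as (A & HA). exists A. auto.
      - destruct mpcc_inhabited as (A & _). exists A. tauto. }
    apply choice in IH'. destruct IH' as (fam & Hfam).
    destruct (tower_limit (below i) fam) as (B & PB & HB).
    - apply down_below.
    - intros j Hj. apply Hfam. exact Hj.
    - intros j k Hj Hk. assert (Hki : lt k i) by (apply (upto_sub (below i) j); auto; apply down_below).
      destruct (Hfam j Hj) as [_ Sj]. destruct (Hfam k Hki) as [Xk Sk].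
      rewrite <- Xk. apply (uniq z); auto. intros l Hl. apply Sj. apply (upto_upto j k); auto.
    - destruct (hgs i B (z i) PB) as (QA & EB & Ez). set (A := fst (g i B (z i))) in *.
      exists A. split; auto. intros j [->|Hj].
      + exists (snd (g i B (z i))). rewrite QA. exact Ez.
      + destruct (Hfam j Hj) as [Xj Sj].
        assert (E : mrestr I (upto j) A = fam j).
        { rewrite <- (HB j Hj), <- EB. symmetry. apply mrestr_upto; auto. apply down_below. }
        destruct (Sj j (or_introl eq_refl)) as (y & Hy). exists y. rewrite E, <- Xj. exact Hy. }
  assert (exg : forall z, exists A, forall j, sol z A j).
  { intros z.
    destruct (choice _ (exi z)) as (fam & Hfam).
    destruct (tower_limit (fun _ => True) fam) as (A & _ & HA).
    - intros i j _ _. exact Logic.I.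
    - intros j _. apply Hfam.
    - intros j k _ Hk. destruct (Hfam j) as [_ Sj]. destruct (Hfam k) as [Xk Sk].
      rewrite <- Xk. apply (uniq z); auto. intros l Hl. apply Sj. apply (upto_upto j k); auto.
    - exists A. intros j. destruct (Hfam j) as [Xj Sj]. apply (sol_mrestr z A j j); [left; auto|].
      rewrite HA; auto. apply Sj. left. auto. }
  assert (uniqg : forall z A A', (forall j, sol z A j) -> (forall j, sol z A' j) -> A = A').
  { intros z A A' HA HA'.
    assert (XT : forall A, mrestr I (fun _ => True) A = A).
    { intros B. apply supported_intro. intros b _. apply functional_extensionality. intros i. rewrite restr_in; auto. }
    rewrite <- (XT A), <- (XT A'). apply tower_eq; [intros i j _ _; exact Logic.I|].
    intros j _. apply (uniq z); auto. }
  destruct (choice _ exg) as (GA & HGA).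
  assert (GA_g : forall z i, mrestr I (upto i) (GA z) = fst (g i (mrestr I (below i) (GA z)) (z i))) by auto.
  assert (GAc : forall i f, cts yc (fun _ => True) (fun z => phi f (mrestr I (upto i) (GA z)))).
  (* Continuity follows the same recursion: on [below i] it passes to the inverse limit, and the
     step map then adds coordinate i. *)
  { intros i. induction (lt_wf i) as [i _ IH]. intros f.
    apply cts_ext with (fun z => phi f (fst (g i (mrestr I (below i) (GA z)) (z i)))).
    { intros z _. rewrite <- GA_g. reflexivity. }
    apply (cts_comp yc (fun _ => True) xc (fun p => supported I (below i) (fst p))
      (fun z => (mrestr I (below i) (GA z), z i)) (fun p => phi f (fst (g i (fst p) (snd p))))).
    - apply gAc.
    - intros z _. apply supported_mrestr.
    - intros [f'|n]; simpl.
      + apply tower_cts; [apply down_below|]. intros j Hj. apply IH. exact Hj.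
      + apply (cts_coord _ _ yc (fun _ => True) (i, n)). }
  assert (GAb : forall i f, cts yc (fun _ => True) (fun z => phi f (mrestr I (below i) (GA z)))).
  { intros i. apply tower_cts; [apply down_below|]. auto. }
  exists (fun p i => h i (mrestr I (upto i) (fst p)) (snd p i)),
    (fun z => (GA z, fun i => snd (g i (mrestr I (below i) (GA z)) (z i)))).
  assert (HG : forall z i, h i (mrestr I (upto i) (GA z)) (snd (g i (mrestr I (below i) (GA z)) (z i))) = z i).
  { intros z i. rewrite GA_g. apply hgs, supported_mrestr. }
  split; [|split; [|split; [|split]]].
  - intros [A y]. simpl. set (z := fun i => h i (mrestr I (upto i) A) (y i)).
    assert (EA : GA z = A).
    { apply (uniqg z); auto. intros j. exists (y j). reflexivity. }
    f_equal; auto. apply functional_extensionality. intros i. rewrite EA. unfold z.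
    replace (mrestr I (below i) A) with (mrestr I (below i) (mrestr I (upto i) A)) by (apply mrestr_mrestr, below_upto).
    rewrite gh by apply supported_mrestr. reflexivity.
  - intros z. apply functional_extensionality. intros i. simpl. apply HG.
  - intros i n.
    apply (cts_comp (prodc (@phi I) yc) (fun _ => True) xc (fun p => supported I (upto i) (fst p))
      (fun p => (mrestr I (upto i) (fst p), snd p i)) (fun p => h i (fst p) (snd p) n)); auto.
    + intros p _. apply supported_mrestr.
    + intros [f|m]; simpl.
      * apply cts_ext with (fun p : X * (I -> nat -> R) => phi (rcode I (upto i) f) (fst p)).
        { intros p _. symmetry. apply phi_rcode. }
        apply (cts_coord _ _ (prodc (@phi I) yc) (fun _ => True) (inl (rcode I (upto i) f))).
      * apply (cts_coord _ _ (prodc (@phi I) yc) (fun _ => True) (inr (i, m))).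
  - intros f. simpl.
    assert (XT : forall A, mrestr I (fun _ => True) A = A).
    { intros B. apply supported_intro. intros b _. apply functional_extensionality. intros i. rewrite restr_in; auto. }
    apply cts_ext with (fun z => phi f (mrestr I (fun _ => True) (GA z))).
    { intros z _. rewrite XT. reflexivity. }
    apply tower_cts; [intros i j _ _; exact Logic.I|]. auto.
  - intros i n. simpl.
    apply (cts_comp yc (fun _ => True) xc (fun p => supported I (below i) (fst p))
      (fun z => (mrestr I (below i) (GA z), z i)) (fun p => snd (g i (fst p) (snd p)) n)).
    + apply gyc.
    + intros z _. apply supported_mrestr.
    + intros [f'|m]; simpl.
      * apply GAb.
      * apply (cts_coord _ _ yc (fun _ => True) (i, m)).
Qed.

End Tower.
End Global.

(** * Splitting off the maximum *)

Lemma omega1_no_max (I : Type) (lt : I -> I -> Prop) :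
  (forall x y, lt x y \/ x = y \/ lt y x) ->
  (forall x, countable_set (fun y => lt y x)) -> ~ countable_set (fun _ : I => True) ->
  forall x, exists y, lt x y.
Proof.
  intros Htot Hcnt Hunc x. apply NNPP. intros N. apply Hunc.
  destruct (Hcnt x) as (f & Hf).
  exists (fun y => if excluded_middle_informative (y = x) then O else S (f y)).
  intros y z _ _. 
  assert (L : forall y, y <> x -> lt y x).
  { intros u Hu. destruct (Htot u x) as [L|[L|L]]; auto; [tauto|]. destruct N. eauto. }
  destruct (excluded_middle_informative (y = x)), (excluded_middle_informative (z = x));
    intros E; try discriminate; try congruence.
  injection E as E. apply Hf; auto.
Qed.

(* Every element is uniquely [s^n l] with [s] the successor and [l] not a
   successor, so the bijection [nat ~ nat * nat] on the exponent suffices. *)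
Lemma times_nat_bij (I : Type) (lt : I -> I -> Prop) :
  (forall x, ~ lt x x) -> (forall x y z, lt x y -> lt y z -> lt x z) ->
  (forall x y, lt x y \/ x = y \/ lt y x) -> well_founded lt -> (forall x, exists y, lt x y) ->
  exists (b : I -> I * nat) (b' : I * nat -> I), (forall x, b' (b x) = x) /\ (forall p, b (b' p) = p).
Proof.
  intros Hirr Htr Htot Hwf Hmax.
  assert (Hs : forall x, exists y, lt x y /\ forall z, lt x z -> ~ lt z y).
  { intros x. destruct (Hmax x) as (y & Hy). revert Hy.
    induction (Hwf y) as [y _ IH]. intros Hy.
    destruct (classic (exists z, lt x z /\ lt z y)) as [(z & Hz1 & Hz2)|N].
    - apply (IH z); auto.
    - exists y. split; auto. intros z Hz1 Hz2. apply N. eauto. }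
  apply choice in Hs. destruct Hs as (s & Hs).
  assert (s_inj : forall x y, s x = s y -> x = y).
  { intros x y E. destruct (Hs x) as [X1 X2]. destruct (Hs y) as [Y1 Y2]. rewrite E in *.
    destruct (Htot x y) as [L|[L|L]]; auto; [destruct (X2 y L Y1)|destruct (Y2 x L X1)]. }
  set (it := fun n x => Nat.iter n s x).
  assert (ex : forall x, exists p : I * nat, (forall y, s y <> fst p) /\ it (snd p) (fst p) = x).
  { intros x. induction (Hwf x) as [x _ IH]. destruct (classic (exists y, s y = x)) as [(y & <-)|N].
    - destruct (IH y) as ([l n] & Hl & <-); [apply Hs|]. exists (l, S n). split; auto.
    - exists (x, O). split; [|reflexivity]. intros y E. apply N. eauto. }
  assert (un : forall n m l l', (forall y, s y <> l) -> (forall y, s y <> l') ->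
    it n l = it m l' -> n = m /\ l = l').
  { induction n as [|n IH]; intros [|m] l l' Hl Hl' E.
    - auto.
    - destruct (Hl (it m l')). symmetry. exact E.
    - destruct (Hl' (it n l)). exact E.
    - destruct (IH m l l' Hl Hl' (s_inj _ _ E)). auto. }
  apply choice in ex. destruct ex as (d & Hd).
  assert (dit : forall n l, (forall y, s y <> l) -> d (it n l) = (l, n)).
  { intros n l Hl. destruct (Hd (it n l)) as [H1 H2]. destruct (un _ _ _ _ H1 Hl H2) as [E1 E2].
    destruct (d (it n l)). simpl in *. congruence. }
  exists (fun x => (it (fst (of_nat (snd (d x)))) (fst (d x)), snd (of_nat (snd (d x))))),
    (fun p => it (to_nat (snd (d (fst p)), snd p)) (fst (d (fst p)))).
  split.
  - intros x. destruct (Hd x) as [H1 H2]. cbn [fst snd]. rewrite dit by auto. cbn [fst snd].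
    rewrite <- surjective_pairing, cancel_to_of. exact H2.
  - intros [x m]. destruct (Hd x) as [H1 H2]. cbn [fst snd]. rewrite dit by auto. cbn [fst snd].
    rewrite cancel_of_to. cbn [fst snd]. rewrite H2. reflexivity.
Qed.

(** * Translations and the coordinatewise maximum *)

Section Translate.
Variable I : Type.
Notation pt := (I -> R).
Notation X := (mpcc I).

Definition shift (v z : pt) : pt := fun i => z i - v i.

Lemma shift_ball F e v c y : ball F e c y -> ball F e (shift v c) (shift v y).
Proof.
  intros H i Hi. unfold shift. replace (y i - v i - (c i - v i)) with (y i - c i) by ring. auto.
Qed.

Lemma trans_exists (v : pt) (A : X) : exists B : X, el B = fun z => el A (shift v z).
Proof.
  apply mpcc_of.
  - destruct (el_ne I A) as (a & Aa). exists (fun i => a i + v i).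
    replace (shift v (fun i => a i + v i)) with a; auto.
    apply functional_extensionality. intros i. unfold shift. ring.
  - intros z Hz. apply el_closed. intros F e He. destruct (Hz F e He) as (a & Aa & Ha).
    exists (shift v a). split; auto. apply shift_ball. auto.
  - intros i. destruct (el_bounded I A i) as (M & HM). exists (M + Rabs (v i)). intros z Hz.
    specialize (HM _ Hz). unfold shift in HM. replace (z i) with (z i - v i + v i) by ring.
    eapply Rle_trans; [apply Rabs_triang|]. lra.
  - intros a b al be Ha Hb H.
    replace (shift v (mp_comb al a be b)) with (mp_comb al (shift v a) be (shift v b)).
    + apply el_convex; auto.
    + apply functional_extensionality. intros i. unfold shift, mp_comb.
      destruct al as [s|], be as [t|]; simpl in H; try discriminate; try ring.
      unfold Rmax. repeat destruct Rle_dec; lra.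
Qed.

Definition trans (v : pt) (A : X) : X :=
  epsilon (inhabits A) (fun B => el B = fun z => el A (shift v z)).

Lemma el_trans v A z : el (trans v A) z <-> el A (shift v z).
Proof.
  unfold trans. pose proof (epsilon_spec (inhabits A) _ (trans_exists v A)) as E.
  simpl in E. rewrite E. tauto.
Qed.

Lemma trans_inv v v' A : (forall i, v i + v' i = 0) -> trans v (trans v' A) = A.
Proof.
  intros H. apply mpcc_eq. intros z. rewrite !el_trans.
  replace (shift v' (shift v z)) with z; [tauto|].
  apply functional_extensionality. intros i. unfold shift. specialize (H i). lra.
Qed.

Lemma el_trans_intro v A a : el A a -> el (trans v A) (fun i => a i + v i).
Proof.
  intros H. apply el_trans. replace (shift v (fun i => a i + v i)) with a; auto.
  apply functional_extensionality. intros i. unfold shift. ring.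
Qed.

Definition top (A : X) : pt := fun i => phi (cup i) A.

Lemma top_trans v A i : top (trans v A) i = top A i + v i.
Proof.
  unfold top. apply Rle_antisym.
  - apply phi_le. intros z Hz. apply el_trans in Hz. pose proof (phi_ge I (cup i) A _ Hz) as H.
    rewrite w_cup in *. unfold shift in H. lra.
  - enough (phi (cup i) A <= phi (cup i) (trans v A) - v i) by lra.
    apply phi_le. intros a Aa. pose proof (phi_ge I (cup i) _ _ (el_trans_intro v A a Aa)) as H.
    rewrite w_cup in *. lra.
Qed.

Lemma near_trans F e v v' A A' : ball F e v v' -> near F e A A' ->
  near F (2 * e) (trans v A) (trans v' A').
Proof.
  intros Hv [H1 H2].
  assert (Hb : forall a a', ball F e a a' -> ball F (2 * e) (fun i => a i + v i) (fun i => a' i + v' i)).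
  { intros a a' H i Hi. replace (a' i + v' i - (a i + v i)) with ((a' i - a i) + (v' i - v i)) by ring.
    eapply Rle_lt_trans; [apply Rabs_triang|]. specialize (H i Hi). specialize (Hv i Hi). lra. }
  assert (Hsh : forall u z, z = fun i => shift u z i + u i).
  { intros u z. apply functional_extensionality. intros i. unfold shift. ring. }
  split.
  - intros z Hz. apply el_trans in Hz. destruct (H1 _ Hz) as (a' & Aa' & Ha).
    exists (fun i => a' i + v' i). split; [apply el_trans_intro; auto|].
    rewrite (Hsh v z). auto.
  - intros z Hz. apply el_trans in Hz. destruct (H2 _ Hz) as (a & Aa & Ha).
    exists (fun i => a i + v i). split; [apply el_trans_intro; auto|].
    rewrite (Hsh v' z). auto.
Qed.

Lemma trans_cts {T K : Type} (c : K -> T -> R) D (v : T -> pt) (A : T -> X) :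
  (forall i, cts c D (fun s => v s i)) -> (forall f, cts c D (fun s => phi f (A s))) ->
  forall f, cts c D (fun s => phi f (trans (v s) (A s))).
Proof.
  intros Hv HA. apply cts_of_ev_near. intros s F e Ds He.
  eapply ev_mono.
  - apply ev_and; [apply (ev_near_of_cts I c D A s F (e/2) HA Ds); lra|].
    apply (ev_list _ _ c D s (fun i t => Rabs (v t i - v s i) < e/2) F).
    intros i _. apply (Hv i s Ds). lra.
  - intros t _ [H1 H2]. replace e with (2 * (e/2)) by field. apply near_trans; auto.
Qed.

Variables (b : I -> I * nat) (b' : I * nat -> I).
Hypothesis b'b : forall x, b' (b x) = x.
Hypothesis bb' : forall p, b (b' p) = p.

Definition merge (v : pt) (u : I -> nat -> R) : pt := fun j =>
  match b j with (i, O) => v i | (i, S n) => u i n end.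

Definition split1 (v : pt) : pt := fun i => v (b' (i, O)).
Definition split2 (v : pt) : I -> nat -> R := fun i n => v (b' (i, S n)).

Lemma merge_split v : merge (split1 v) (split2 v) = v.
Proof.
  apply functional_extensionality. intros j. unfold merge.
  rewrite <- (b'b j) at 2. destruct (b j) as [i [|n]]; reflexivity.
Qed.

Lemma split1_merge v u : split1 (merge v u) = v.
Proof. apply functional_extensionality. intros i. unfold split1, merge. rewrite bb'. reflexivity. Qed.

Lemma split2_merge v u : split2 (merge v u) = u.
Proof.
  apply functional_extensionality. intros i. apply functional_extensionality. intros n.
  unfold split2, merge. rewrite bb'. reflexivity.
Qed.

Definition sub (v v' : pt) : pt := fun i => v i - v' i.

(** Translation moves the maximum anywhere, so no subspace of sets with maximum 0 is formed: the set
    keeps as maximum the entries of its old one indexed by (i, 0), and those indexed by (i, n + 1)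
    split off as free reals. *)
Definition absorb (A : X) : X * (I -> nat -> R) :=
  (trans (sub (split1 (top A)) (top A)) A, split2 (top A)).

Definition release (p : X * (I -> nat -> R)) : X :=
  trans (sub (merge (top (fst p)) (snd p)) (top (fst p))) (fst p).

Lemma top_sub v A : top (trans (sub v (top A)) A) = v.
Proof.
  apply functional_extensionality. intros i. rewrite top_trans. unfold sub. ring.
Qed.

Lemma release_absorb A : release (absorb A) = A.
Proof.
  unfold release, absorb. simpl. rewrite top_sub, merge_split.
  apply trans_inv. intros i. unfold sub. ring.
Qed.

Lemma absorb_release p : absorb (release p) = p.
Proof.
  destruct p as [A u]. unfold absorb, release. simpl. rewrite top_sub, split1_merge, split2_merge.
  f_equal. apply trans_inv. intros i. unfold sub. ring.
Qed.

Lemma absorb_cts k : cts (@phi I) (fun _ => True) (fun A => prodc (@phi I) (yc I) k (absorb A)).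
Proof.
  assert (Ht : forall i, cts (@phi I) (fun _ => True) (fun A => top A i)).
  { intros i. apply (cts_coord _ _ (@phi I) (fun _ => True) (cup i)). }
  destruct k as [f|[i n]]; simpl.
  - apply (trans_cts (@phi I) _ (fun A => sub (split1 (top A)) (top A)) (fun A => A)).
    + intros i. apply cts_minus; apply Ht.
    + intros g. apply cts_coord.
  - apply Ht.
Qed.

Lemma release_cts {T K : Type} (c : K -> T -> R) D (p : T -> X * (I -> nat -> R)) :
  (forall f, cts c D (fun s => phi f (fst (p s)))) ->
  (forall i n, cts c D (fun s => snd (p s) i n)) ->
  forall f, cts c D (fun s => phi f (release (p s))).
Proof.
  intros H1 H2. unfold release. apply trans_cts; auto. intros i.
  apply cts_minus; [|apply H1]. unfold merge. destruct (b i) as [j [|n]]; [apply H1|apply H2].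
Qed.

End Translate.

Theorem theorem4p4 (I : Type) (hI : omega1_type I) :
  homeomorphic (vietoris_open I) (prod_open I).
Proof.
  destruct hI as (lt & Hirr & Htr & Htot & Hwf & Hcnt & Hunc).
  destruct (times_nat_bij I lt Hirr Htr Htot Hwf (omega1_no_max I lt Htot Hcnt Hunc)) as (b & b' & b'b & bb').
  destruct (tower_homeo I lt Hirr Htr Htot Hwf Hcnt) as (H & G & GH & HG & Hc & GAc & Gyc).
  (* The target R^(I x N) is read as R^I through the same bijection [b] that governs [absorb]. *)
  set (f := fun (A : mpcc I) (j : I) => H (absorb I b' A) (fst (b j)) (snd (b j))).
  set (un := fun (x : I -> R) i n => x (b' (i, n))).
  set (g := fun x : I -> R => release I b (G (un x))).
  assert (fc : forall j, cts (@phi I) (fun _ => True) (fun A => f A j)).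
  { intros j. apply (cts_comp (@phi I) (fun _ => True) (prodc (@phi I) (yc I)) (fun _ => True)
      (absorb I b') (fun p => H p (fst (b j)) (snd (b j)))); auto. apply absorb_cts. }
  assert (gc : forall k, cts (@seqc I) (fun _ => True) (fun x => phi k (g x))).
  { assert (Hun : forall k, cts (@seqc I) (fun _ => True) (fun x => yc I k (un x))).
    { intros [i n]. apply (cts_coord _ _ (@seqc I) (fun _ => True) (b' (i, n))). }
    apply release_cts.
    - intros k. apply (cts_comp _ _ (yc I) (fun _ => True) un (fun z => phi k (fst (G z)))); auto.
    - intros i n. apply (cts_comp _ _ (yc I) (fun _ => True) un (fun z => snd (G z) i n)); auto. }
  exists f, g. split; [|split; [|split]].
  - intros A. unfold g. replace (un (f A)) with (H (absorb I b' A)).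
    + rewrite GH. apply release_absorb. exact b'b.
    + apply functional_extensionality. intros i. apply functional_extensionality. intros n.
      unfold un, f. rewrite bb'. reflexivity.
  - intros x. apply functional_extensionality. intros j. unfold f, g.
    rewrite absorb_release, HG by exact bb'. unfold un. rewrite <- surjective_pairing, b'b. reflexivity.
  - intros V HV. apply vietoris_iff. intros A VA. destruct (HV _ VA) as (F & e & He & HF).
    assert (Hev : ev (@phi I) (fun _ => True) A (fun B => forall j, In j F -> Rabs (f B j - f A j) < e)).
    { apply ev_list. intros j _. apply (fc j A Logic.I e He). }
    destruct Hev as (L & d & Hd & HL). exists (flat_map supp L), (d/4). split; [lra|].
    intros B HB. apply HF, HL; auto. intros k Hk. rewrite Rabs_minus_sym.
    assert (Rabs (phi k A - phi k B) <= 2 * (d/4)); [|lra].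
    apply phi_near; [lra|]. eapply near_weaken; [| |exact HB]; [|lra].
    intros i Hi. apply in_flat_map. eauto.
  - intros W HW x Wx. destruct (proj1 (vietoris_iff I W) HW _ Wx) as (F & e & He & HF).
    destruct (ev_near_of_cts I (@seqc I) (fun _ => True) g x F e gc Logic.I He) as (L & d & Hd & HL).
    exists L, d. auto.
Qed.
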